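(* Let $\omega\in\mathbb{R}$, $\omega\neq 0$, and let $\alpha_{01},\alpha_{\epsilon 0},\alpha_{\epsilon 1},\alpha_{\epsilon 2},\alpha_{\epsilon 3},\beta_{\epsilon 0},\beta_{\epsilon 1},\beta_{\epsilon 2},\beta_{\epsilon 3}\in\mathbb{C}$ be constants with $\alpha_{01R}:=\mathrm{Re}(\alpha_{01})<0$. For $\lambda,\epsilon\in\mathbb{R}$ consider the system of ordinary differential equations for $(z_1,z_2)\in\mathbb{C}^2\cong\mathbb{R}^4$ $$ \begin{aligned} \frac{dz_1}{dt} &= z_1\big(\lambda+i\omega+\alpha_{01}|z_1|^2\big)+\epsilon\Big[z_1\big(\alpha_{\epsilon 0}+\alpha_{\epsilon 1}|z_1|^2+\alpha_{\epsilon 2}|z_2|^2+\alpha_{\epsilon 3}\bar z_2 z_1\big)+z_2\big(\beta_{\epsilon 0}+\beta_{\epsilon 1}|z_1|^2+\beta_{\epsilon 2}|z_2|^2+\beta_{\epsilon 3}\bar z_1 z_2\big)\Big],\\ \frac{dz_2}{dt} &= z_2\big(\lambda+i\omega+\alpha_{01}|z_2|^2\big)+\epsilon\Big[z_2\big(\alpha_{\epsilon 0}+\alpha_{\epsilon 1}|z_2|^2+\alpha_{\epsilon 2}|z_1|^2+\alpha_{\epsilon 3}\bar z_1 z_2\big)+z_1\big(\beta_{\epsilon 0}+\beta_{\epsilon 1}|z_2|^2+\beta_{\epsilon 2}|z_1|^2+\beta_{\epsilon 3}\bar z_2 z_1\big)\Big]. \end{aligned} $$ For $\lambda>0$ let $$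 \mathcal{T}_0=\Big\{(z_1,z_2)\in\mathbb{C}^2 : |z_1|=|z_2|=\sqrt{\tfrac{-\lambda}{\alpha_{01R}}}\Big\}, $$ which is an invariant $2$-dimensional torus of the system with $\epsilon=0$. Then for every fixed $\lambda>0$ there exists $\epsilon_0=\epsilon_0(\lambda)>0$ such that for every $\epsilon$ with $0\le\epsilon\le\epsilon_0$ the system has a stable invariant $2$-dimensional torus $\mathcal{T}_\epsilon$ that is $\mathcal{C}^1$-close to $\mathcal{T}_0$.
   Context: The subscripts $\epsilon j$ in $\alpha_{\epsilon j},\beta_{\epsilon j}$ are only labels; these coefficients are fixed complex constants independent of $\epsilon$, $\lambda$ and $t$. ''Invariant'' means invariant under the flow of the system. ''Stable'' means that the invariant torus is (locally, asymptotically) attracting: nearby solutions stay near it and converge to it as $t\to+\infty$. ''$\mathcal{C}^1$-close to $\mathcal{T}_0$'' is meant in the usual sense of persistence of normally hyperbolic invariant manifolds: $\mathcal{T}_\epsilon$ is the image of a $\mathcal{C}^1$ embedding of $\mathcal{T}_0$ into $\mathbb{C}^2\cong\mathbb{R}^4$ whose $\mathcal{C}^1$-distance from the inclusion map $\mathcal{T}_0\hookrightarrow\mathbb{C}^2$ tends to $0$ as $\epsilon\to0$. *)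

(* Defs.v *)
(* Stdlib real numbers with Coquelicot. *)
From Stdlib Require Import Reals.
From Coquelicot Require Import Coquelicot.
Open Scope R_scope.

(* R^2 and C^2 = R^4 as real normed spaces; the product norms are Euclidean. *)
Definition R2 : NormedModule R_AbsRing :=
  prod_NormedModule R_AbsRing R_NormedModule R_NormedModule.
Definition C2 : NormedModule R_AbsRing :=
  prod_NormedModule R_AbsRing C_R_NormedModule C_R_NormedModule.

Definition sqmod (z : C) : C := RtoC (Cmod z ^ 2).

(* dz/dt for the oscillator z coupled to the oscillator w; the two equations
   of the system are exchanged by swapping the oscillators. *)
Definition oscillator (omega : R) (a01 a0 a1 a2 a3 b0 b1 b2 b3 : C)
    (lambda eps : R) (z w : C) : C :=
  (z * (RtoC lambda + Ci * RtoC omega + a01 * sqmod z)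
   + RtoC eps *
     (z * (a0 + a1 * sqmod z + a2 * sqmod w + a3 * Cconj w * z)
      + w * (b0 + b1 * sqmod z + b2 * sqmod w + b3 * Cconj z * w)))%C.

Definition coupled (omega : R) (a01 a0 a1 a2 a3 b0 b1 b2 b3 : C)
    (lambda eps : R) (p : C2) : C2 :=
  (oscillator omega a01 a0 a1 a2 a3 b0 b1 b2 b3 lambda eps (fst p) (snd p),
   oscillator omega a01 a0 a1 a2 a3 b0 b1 b2 b3 lambda eps (snd p) (fst p)).

(* z solves z' = F(z) on the open interval (a, b). *)
Definition solution_on (F : C2 -> C2) (a b : Rbar) (z : R -> C2) : Prop :=
  forall t : R, Rbar_lt a t -> Rbar_lt t b -> is_derive z t (F (z t)).

(* Solutions starting in T are global and never leave T; the second clause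
   is about every solution, so it does not rely on uniqueness. *)
Definition invariant (F : C2 -> C2) (T : C2 -> Prop) : Prop :=
  forall p : C2, T p ->
    (exists z : R -> C2, solution_on F m_infty p_infty z /\ z 0 = p) /\
    (forall (a b : Rbar) (z : R -> C2),
        Rbar_lt a 0 -> Rbar_lt 0 b -> solution_on F a b z -> z 0 = p ->
        forall t : R, Rbar_lt a t -> Rbar_lt t b -> T (z t)).

(* The points at distance less than d from T. *)
Definition neighborhood (T : C2 -> Prop) (d : R) (p : C2) : Prop :=
  exists q : C2, T q /\ norm (minus p q) < d.

Definition forward_complete_near (F : C2 -> C2) (T : C2 -> Prop) : Prop :=
  exists delta : R, 0 < delta /\
    forall p : C2, neighborhood T delta p ->
      exists (a : R) (z : R -> C2),
        a < 0 /\ solution_on F a p_infty z /\ z 0 = p.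

Definition lyapunov_stable (F : C2 -> C2) (T : C2 -> Prop) : Prop :=
  forall eta : R, 0 < eta ->
    exists delta : R, 0 < delta /\
      forall (a b : Rbar) (z : R -> C2),
        Rbar_lt a 0 -> Rbar_lt 0 b -> solution_on F a b z ->
        neighborhood T delta (z 0) ->
        forall t : R, 0 <= t -> Rbar_lt t b -> neighborhood T eta (z t).

Definition locally_attracting (F : C2 -> C2) (T : C2 -> Prop) : Prop :=
  exists delta : R, 0 < delta /\
    forall (a : Rbar) (z : R -> C2),
      Rbar_lt a 0 -> solution_on F a p_infty z ->
      neighborhood T delta (z 0) ->
      forall eta : R, 0 < eta ->
        exists t0 : R, forall t : R, t0 <= t -> neighborhood T eta (z t).

Definition stable (F : C2 -> C2) (T : C2 -> Prop) : Prop :=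
  forward_complete_near F T /\ lyapunov_stable F T /\ locally_attracting F T.

Definition torus (r : R) (p : C2) : Prop :=
  Cmod (fst p) = r /\ Cmod (snd p) = r.

Definition torus_chart (r : R) (x : R2) : C2 :=
  ((r * cos (fst x), r * sin (fst x)), (r * cos (snd x), r * sin (snd x))).

(* For r > 0, torus_chart r is a smooth covering of the torus, so a map h on
   the torus is C^1 with differential D in angular coordinates iff
   h o torus_chart r is C^1 with differential D.  Values of h off the torus
   are irrelevant. As R2 is finite-dimensional, continuity of x |-> D x v for
   each v is continuity of D in operator norm. *)
Definition C1_on_torus (r : R) (h : C2 -> C2) (D : R2 -> R2 -> C2) : Prop :=
  forall x : R2,
    filterdiff (fun y : R2 => h (torus_chart r y)) (locally x) (D x) /\
    (forall v : R2, continuous (fun y : R2 => D y v) x).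

(* C^1 immersion that is a homeomorphism onto its image. *)
Definition C1_embedding_of_torus (r : R) (h : C2 -> C2) : Prop :=
  (exists D : R2 -> R2 -> C2,
      C1_on_torus r h D /\
      forall x v : R2, D x v = zero -> v = zero) /\
  (forall p q : C2, torus r p -> torus r q -> h p = h q -> p = q) /\
  (forall p : C2, torus r p ->
     forall eta : R, 0 < eta ->
       exists delta : R, 0 < delta /\
         forall q : C2, torus r q ->
           norm (minus (h q) (h p)) < delta -> norm (minus q p) < eta).

Definition image (T : C2 -> Prop) (h : C2 -> C2) (q : C2) : Prop :=
  exists p : C2, T p /\ h p = q.

(* Sup norm of g - h and of the difference of the differentials.  Measuring
   the latter in angular coordinates rather than in arc length only rescales
   it by the constant r. *)
Definition C1_dist_le (r : R) (g h : C2 -> C2) (eta : R) : Prop :=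
  (forall p : C2, torus r p -> norm (minus (g p) (h p)) <= eta) /\
  exists Dg Dh : R2 -> R2 -> C2,
    C1_on_torus r g Dg /\ C1_on_torus r h Dh /\
    forall x v : R2, norm (minus (Dg x v) (Dh x v)) <= eta * norm v.

(* Main.v *)
Require Import Defs.
From Stdlib Require Import Reals.
From Coquelicot Require Import Coquelicot.
From Stdlib Require Import Lra Lia Psatz ZArith ClassicalChoice FunctionalExtensionality.
Open Scope R_scope.

(** Put r^2 = - lambda / Re a01 and mu = 2 lambda. With y_j = r^2 / |z_j|^2 - 1 and the isochronous
    phases psi_j = arg z_j - (Im a01 / Re a01) ln (|z_j| / r), the unperturbed system is exactly
    linear: y_j' = - mu y_j and psi_j' = constant. By phase invariance the perturbation depends only
    on y_1, y_2 and phi = psi_1 - psi_2, so that y' = - mu y + eps g(y, phi) and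
    phi' = eps q(y, phi): the angle is slow everywhere, and by the exchange symmetry an invariant
    curve y_1 = s(phi), y_2 = s(- phi) is described by one function solving
    eps q s' = - mu s + eps g.

    No flow is needed to solve this equation. The explicit Euler graph transform
    (T_h s)(x) = (1 - mu h) s(x - h eps q) + h eps g is a contraction in the uniform norm and preserves a ball
    of radius A = 2 eps C / mu in C^{1,1}, uniformly in h. Its fixed points are Cauchy as h -> 0 by
    consistency, and C^{1,1} bounds upgrade uniform convergence to C^1 convergence. The limit solves
    the equation, and s, s' = O(eps).

    Given s, the defects d_1 = y_1 - s(phi), d_2 = y_2 - s(- phi) satisfy d' = - mu d + O(eps) |d|,
    which yields invariance (d = 0 persists) and exponential attraction of the torus d = 0. *)

(** * Functions with Lipschitz derivative *)

(** The coordinates come from d ln |z| / dt = lambda + Re a01 |z|^2 and d arg z / dt = omega + Im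
    a01 |z|^2 at eps = 0. Since Re a01 r^2 = - lambda, 1 / |z|^2 obeys a linear equation, and
    eliminating |z|^2 between the two leaves a phase of constant speed. As the phase difference then
    drifts only at speed O(eps) against the normal rate mu, a smallness condition on eps C / mu is
    all the spectral gap required. The Euler step goes backward along characteristics with the speed
    read at the arrival point, so no circle map is inverted; the price is a fixed point that depends
    on h and solves the equation only in the limit. A C^{1,1} ball is closed under uniform limits,
    so the transform has to contract in the sup norm only. Polar coordinates degenerate at z_j = 0,
    and the statement speaks of every solution in C^2. Hence the amplitudes are truncated, the
    truncated system is solved for all times, estimates confine the solution to the region where the
    truncation is inactive, and uniqueness in C^2 transfers the conclusion to arbitrary
    solutions. *)

Lemma Rabs_plus_le a b A B : Rabs a <= A -> Rabs b <= B -> Rabs (a + b) <= A + B.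
Proof. intros; eapply Rle_trans; [apply Rabs_triang|lra]. Qed.

Lemma Rabs_minus_le a b A B : Rabs a <= A -> Rabs b <= B -> Rabs (a - b) <= A + B.
Proof. intros; apply Rabs_plus_le; [|rewrite Rabs_Ropp]; assumption. Qed.

Lemma Rabs_mult_le a b A B : Rabs a <= A -> Rabs b <= B -> Rabs (a * b) <= A * B.
Proof.
  intros; rewrite Rabs_mult.
  apply Rmult_le_compat; auto using Rabs_pos.
Qed.

Lemma Rabs_sq a : Rabs a * Rabs a = a * a.
Proof. rewrite <- Rabs_mult; apply Rabs_pos_eq; nra. Qed.

Lemma continuous_of_lipschitz (f : R -> R) (K x : R) :
  0 <= K -> (forall y, Rabs (f x - f y) <= K * Rabs (x - y)) -> continuous f x.
Proof.
  intros HK H. apply (filterlim_locally (F := locally x) f). intros e.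
  assert (Hp : 0 < e / (K + 1)) by (apply Rdiv_lt_0_compat; [apply cond_pos|lra]).
  exists (mkposreal _ Hp). intros y Hy. assert (Hy' : Rabs (y - x) < e / (K + 1)) by exact Hy.
  change (Rabs (f y - f x) < e). rewrite Rabs_minus_sym. apply Rle_lt_trans with (1 := H y).
  rewrite (Rabs_minus_sym x y).
  apply Rle_lt_trans with ((K + 1) * Rabs (y - x)); [generalize (Rabs_pos (y - x)); nra|].
  replace (pos e) with ((K + 1) * (e / (K + 1))) by (field; lra).
  apply Rmult_lt_compat_l; lra.
Qed.

(** A quadratic remainder bound, unlike a difference quotient, is an inequality that survives
    pointwise limits. Derivatives of limits, both of curves and of Picard iterates, are obtained
    through it. *)
Lemma is_derive_of_quadratic (f : R -> R) (x l A : R) :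
  (forall y, Rabs (f y - f x - l * (y - x)) <= A * (y - x) ^ 2) -> is_derive f x l.
Proof.
  intros H. apply is_derive_Reals. intros e He.
  assert (Hp : 0 < e / (Rabs A + 1)).
  { apply Rdiv_lt_0_compat; [|generalize (Rabs_pos A)]; lra. }
  exists (mkposreal _ Hp); intros k Hk Hlt; simpl in Hlt.
  specialize (H (x + k)). replace (x + k - x) with k in H by ring.
  replace ((f (x + k) - f x) / k - l) with ((f (x + k) - f x - l * k) / k) by (field; assumption).
  rewrite Rabs_div by assumption.
  assert (0 < Rabs k) by (apply Rabs_pos_lt; assumption).
  apply (Rmult_lt_reg_r (Rabs k)); [assumption|].
  unfold Rdiv; rewrite Rmult_assoc, Rinv_l, Rmult_1_r by lra.
  apply Rle_lt_trans with (1 := H).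
  replace (k ^ 2) with (Rabs k * Rabs k) by (rewrite Rabs_sq; ring).
  apply Rle_lt_trans with ((Rabs A + 1) * Rabs k * Rabs k).
  - generalize (Rle_abs A); intro. rewrite <- Rmult_assoc. apply Rmult_le_compat_r; [lra|].
    apply Rmult_le_compat_r; lra.
  - apply Rmult_lt_compat_r; [assumption|].
    apply (Rmult_lt_reg_r (/ (Rabs A + 1))).
    { apply Rinv_0_lt_compat; generalize (Rabs_pos A); lra. }
    replace ((Rabs A + 1) * Rabs k * / (Rabs A + 1)) with (Rabs k); [exact Hlt|].
    field; generalize (Rabs_pos A); lra.
Qed.

(** One constant bounds the value, the derivative and the Lipschitz constant of the derivative, so
    that balls form a one-parameter family. The derivative is an explicit argument because limits
    are taken of it too. *)
Definition C11 (A : R) (f df : R -> R) : Prop :=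
  forall x, Rabs (f x) <= A /\ Rabs (df x) <= A /\ is_derive f x (df x) /\
    forall y, Rabs (df x - df y) <= A * Rabs (x - y).

Lemma C11_pos A f df : C11 A f df -> 0 <= A.
Proof. intros H; destruct (H 0) as [H0 _]; generalize (Rabs_pos (f 0)); lra. Qed.

Lemma C11_mono A B f df : A <= B -> C11 A f df -> C11 B f df.
Proof.
  intros HAB H x. destruct (H x) as (H0 & H1 & H2 & H3).
  split; [lra|split; [lra|split; [exact H2|]]]. intros y. apply Rle_trans with (1 := H3 y).
  apply Rmult_le_compat_r; auto using Rabs_pos.
Qed.

Lemma C11_lipschitz A f df : C11 A f df -> forall x y, Rabs (f x - f y) <= A * Rabs (x - y).
Proof.
  intros H x y. apply (bounded_variation f df). intros t _.
  destruct (H t) as (_ & H1 & H2 & _). now split.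
Qed.

Lemma taylor_of_lipschitz_derivative A f df :
  0 <= A -> (forall x, is_derive f x (df x)) ->
  (forall x y, Rabs (df x - df y) <= A * Rabs (x - y)) ->
  forall x y, Rabs (f y - f x - df x * (y - x)) <= A * (y - x) ^ 2.
Proof.
  intros HA Hd HL x y.
  destruct (MVT_cor4 f df x (Rabs (y - x)) (fun c _ => Hd c) y) as (c & Hc & Hcx); [lra|].
  rewrite Hc, <- Rmult_minus_distr_r.
  replace (A * (y - x) ^ 2) with (A * Rabs (y - x) * Rabs (y - x))
    by (rewrite Rmult_assoc, Rabs_sq; ring).
  apply Rabs_mult_le; [|lra].
  apply Rle_trans with (1 := HL c x). now apply Rmult_le_compat_l.
Qed.

Lemma C11_taylor A f df :
  C11 A f df -> forall x y, Rabs (f y - f x - df x * (y - x)) <= A * (y - x) ^ 2.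
Proof.
  intros H. apply taylor_of_lipschitz_derivative; [eapply C11_pos; eassumption| |]; intros x; apply H.
Qed.

Lemma ex_lim_cauchy_rate (u e : nat -> R) :
  (forall N n m, (N <= n)%nat -> (N <= m)%nat -> Rabs (u n - u m) <= e N) ->
  (forall eta, 0 < eta -> exists N, e N < eta) ->
  exists l : R, is_lim_seq u l.
Proof.
  intros H He.
  assert (E : ex_finite_lim_seq u).
  { apply ex_lim_seq_cauchy_corr. intros eta. destruct (He eta (cond_pos eta)) as [N HN].
    exists N; intros n m Hn Hm. apply Rle_lt_trans with (2 := HN). now apply H. }
  exact E.
Qed.

Lemma is_lim_seq_Rabs_le (u : nat -> R) (l B : R) (N : nat) :
  is_lim_seq u l -> (forall n, (N <= n)%nat -> Rabs (u n) <= B) -> Rabs l <= B.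
Proof.
  intros Hu HB.
  assert (L : is_lim_seq (fun n => Rabs (u n)) (Rabs l)) by now apply (is_lim_seq_abs u l).
  assert (L' := is_lim_seq_const B).
  apply (is_lim_seq_le_loc _ _ (Rabs l) B) with (2 := L) (3 := L').
  exists N; exact HB.
Qed.

(** The values converge at the given rate, interpolation makes the derivatives converge pointwise,
    and the bound of [C11_taylor] passes to the limit, which identifies the limit of the derivatives
    as the derivative of the limit. *)
Lemma C11_limit A (f df : nat -> R -> R) (e : nat -> R) :
  (forall n, C11 A (f n) (df n)) ->
  (forall N n m x, (N <= n)%nat -> (N <= m)%nat -> Rabs (f n x - f m x) <= e N) ->
  (forall eta, 0 < eta -> exists N, e N < eta) ->
  exists g dg, C11 A g dg /\ (forall n x, Rabs (f n x - g x) <= e n) /\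
    (forall x, is_lim_seq (fun n => f n x) (g x)) /\
    (forall x, is_lim_seq (fun n => df n x) (dg x)).
Proof.
  intros HC Hf He.
  assert (HA : 0 <= A) by (eapply C11_pos; apply (HC 0%nat)).
  assert (Lf : forall x, exists l : R, is_lim_seq (fun n => f n x) l).
  { intros x; apply (ex_lim_cauchy_rate _ e); auto. }
  assert (Ldf : forall x, exists l : R, is_lim_seq (fun n => df n x) l).
  { intros x.
    (* Landau's interpolation: a small difference with Lipschitz derivative has a small derivative. *)
    assert (I : forall N n m d, (N <= n)%nat -> (N <= m)%nat -> 0 < d ->
       Rabs (df n x - df m x) <= 2 * e N / d + 2 * A * d).
    { intros N n m d Hn Hm Hd.
      generalize (C11_taylor _ _ _ (HC n) x (x + d)) (C11_taylor _ _ _ (HC m) x (x + d))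
        (Hf N n m x Hn Hm) (Hf N n m (x + d) Hn Hm).
      replace (x + d - x) with d by ring. intros T1 T2 D1 D2.
      apply (Rmult_le_reg_r d); [assumption|].
      replace ((2 * e N / d + 2 * A * d) * d) with (2 * e N + 2 * A * d ^ 2) by (field; lra).
      rewrite <- (Rabs_pos_eq d) at 1 by lra. rewrite <- Rabs_mult.
      replace ((df n x - df m x) * d) with
        ((f m (x + d) - f m x - df m x * d) - (f n (x + d) - f n x - df n x * d)
         + ((f n (x + d) - f m (x + d)) - (f n x - f m x))) by ring.
      eapply Rle_trans.
      { apply Rabs_plus_le; apply Rabs_minus_le; eassumption. }
      lra. }
    assert (E : ex_finite_lim_seq (fun n => df n x)); [|exact E].
    apply ex_lim_seq_cauchy_corr. intros eta.
    (* The increment balances the two terms of the interpolation bound: once [e N < d * d], the sum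
       2 e N / d + 2 A d stays below (2 + 2 A) d, hence below [eta]. *)
    assert (Hd : 0 < eta / (4 * A + 4)) by (apply Rdiv_lt_0_compat; [apply cond_pos|lra]).
    set (d := eta / (4 * A + 4)) in Hd.
    assert (Hde : eta = (4 * A + 4) * d :> R) by (unfold d; field; lra).
    destruct (He (d * d)) as [N HN]; [nra|].
    exists N; intros n m Hn Hm.
    apply Rle_lt_trans with (1 := I N n m d Hn Hm Hd).
    rewrite Hde. apply Rlt_le_trans with (2 * (d * d) / d + 2 * A * d); [|replace (2 * (d * d) / d) with (2 * d) by (field; lra); nra].
    apply Rplus_lt_compat_r. apply Rmult_lt_compat_r; [apply Rinv_0_lt_compat|]; lra. }
  destruct (choice _ Lf) as [g Hg].
  destruct (choice _ Ldf) as [dg Hdg].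
  exists g, dg. split; [|split; [|split; assumption]].
  - intros x.
    assert (B0 : Rabs (g x) <= A).
    { apply (is_lim_seq_Rabs_le _ _ _ 0 (Hg x)). intros n _. apply (HC n x). }
    assert (B1 : Rabs (dg x) <= A).
    { apply (is_lim_seq_Rabs_le _ _ _ 0 (Hdg x)). intros n _. apply (HC n x). }
    split; [exact B0|split; [exact B1|split]].
    + apply (is_derive_of_quadratic _ _ _ A). intros y.
      apply (is_lim_seq_Rabs_le (fun n => f n y - f n x - df n x * (y - x)) _ _ 0).
      * apply is_lim_seq_minus'; [apply is_lim_seq_minus'; auto|].
        apply (is_lim_seq_scal_r _ _ (dg x)); auto.
      * intros n _. now apply C11_taylor.
    + intros y. apply (is_lim_seq_Rabs_le (fun n => df n x - df n y) _ _ 0).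
      * now apply is_lim_seq_minus'.
      * intros n _. apply (HC n x).
  - intros n x. apply (is_lim_seq_Rabs_le (fun m => f n x - f m x) _ _ n).
    + apply is_lim_seq_minus'; auto using is_lim_seq_const.
    + intros m Hm. now apply Hf.
Qed.

(** The supremum D of |f| is finite thanks to [D0], and the third hypothesis applied to D itself
    gives D <= th D + e. This measures how far an approximate fixed point lies from a true one. *)
Lemma contraction_sup (f : R -> R) (th e D0 : R) :
  0 <= th < 1 -> (forall x, Rabs (f x) <= D0) ->
  (forall D, (forall x, Rabs (f x) <= D) -> forall x, Rabs (f x) <= th * D + e) ->
  forall x, Rabs (f x) <= e / (1 - th).
Proof.
  intros Hth HD Hc x.
  destruct (completeness (fun a => exists x, a = Rabs (f x))) as [D [Hub Hl]].
  - exists D0. intros a [t ->]. apply HD.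
  - exists (Rabs (f 0)), 0. reflexivity.
  - assert (B : forall x, Rabs (f x) <= D) by (intros t; apply Hub; now exists t).
    assert (D <= th * D + e).
    { apply Hl. intros a [t ->]. now apply Hc. }
    apply Rle_trans with (1 := B x). apply (Rmult_le_reg_r (1 - th)); [lra|].
    replace (e / (1 - th) * (1 - th)) with e by (field; lra). lra.
Qed.

(** * The invariant curve *)

Section InvariantCurve.

Variables (mu C : R) (q g : R -> R -> R -> R).
Hypothesis mu_pos : 0 < mu.
Hypothesis q_lip : forall a b a' b' x D,
  Rabs (a - a') <= D -> Rabs (b - b') <= D ->
  Rabs (q a b x) <= C /\ Rabs (q a b x - q a' b' x) <= C * D.
Hypothesis g_lip : forall a b a' b' x D,
  Rabs (a - a') <= D -> Rabs (b - b') <= D ->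
  Rabs (g a b x) <= C /\ Rabs (g a b x - g a' b' x) <= C * D.
Hypothesis q_per : forall a b x, q a b (x + 2 * PI) = q a b x.
Hypothesis g_per : forall a b x, g a b (x + 2 * PI) = g a b x.
(** Smoothness is asked of [q] and [g] only along candidate curves, with one constant for all of
    them. The radius 1/4 keeps the amplitudes strictly inside the range where the truncation used
    later is the identity. *)
Hypothesis q_C11 : forall s ds, C11 (1/4) s ds ->
  exists dq, C11 C (fun x => q (s x) (s (- x)) x) dq.
Hypothesis g_C11 : forall s ds, C11 (1/4) s ds ->
  exists dg, C11 C (fun x => g (s x) (s (- x)) x) dg.

Definition periodic (s : R -> R) : Prop := forall x, s (x + 2 * PI) = s x.

Lemma C_nonneg : 0 <= C.
Proof.
  destruct (q_lip 0 0 0 0 0 0) as [H _]; try (rewrite Rminus_0_r, Rabs_R0; lra).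
  generalize (Rabs_pos (q 0 0 0)); lra.
Qed.

Section Epsilon.

Variable eps : R.
Hypothesis eps_nonneg : 0 <= eps.
Hypothesis eps_small : 8 * (eps * C) <= mu.

Let k := eps * C.
(** The amplitude k / mu is where damping balances a forcing of size k; the factor 2 leaves half of
    the damping free to absorb the drift of the angle. *)
Let A := 2 * k / mu.

Lemma k_nonneg : 0 <= k.
Proof. unfold k; generalize C_nonneg; nra. Qed.

Lemma A_bounds : 0 <= A <= 1 / 4 /\ mu * A = 2 * k.
Proof.
  generalize k_nonneg; intros Hk.
  assert (E : mu * A = 2 * k) by (unfold A; field; lra).
  fold k in eps_small. split; [split|exact E]; nra.
Qed.

(* Explicit Euler step of size h of the graph transform for x' = eps q, y' = - mu y + eps g. *)
Definition euler (h : R) (s : R -> R) (x : R) : R :=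
  (1 - mu * h) * s (x - h * (eps * q (s x) (s (- x)) x)) + h * (eps * g (s x) (s (- x)) x).

Lemma eps_le a : Rabs a <= C -> Rabs (eps * a) <= k.
Proof. intros; unfold k; apply Rabs_mult_le; [rewrite Rabs_pos_eq; lra|assumption]. Qed.

Section Step.

Variable h : R.
Hypothesis h_pos : 0 < h.
Hypothesis h_small : h * (mu + k) <= 1.

Lemma step_bounds : 0 <= mu * h <= 1 /\ 0 <= h * k <= 1.
Proof. generalize k_nonneg; intro; repeat split; nra. Qed.

(** The tightest of the three bounds is the Lipschitz constant of the derivative, (1 - mu h) A ((1 +
    h k)^2 + h k) + h k. Since h k <= 1 and 8 h k <= mu h, its first term is at most A (1 - mu h /
    2), and h k = A mu h / 2 by the choice of [A], so the sum closes exactly at [A]. *)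
Lemma euler_C11 s ds : C11 A s ds -> exists ds', C11 A (euler h s) ds'.
Proof.
  intros Hs. destruct A_bounds as [[A0 A1] AE]. destruct step_bounds as [[m0 m1] [k0 k1]].
  destruct (q_C11 _ _ (C11_mono _ _ _ _ A1 Hs)) as [dq Hq].
  destruct (g_C11 _ _ (C11_mono _ _ _ _ A1 Hs)) as [dg Hg].
  set (Q := fun x => q (s x) (s (- x)) x) in *. set (G := fun x => g (s x) (s (- x)) x) in *.
  set (xi := fun x => x - h * (eps * Q x)).
  assert (kh : forall a, Rabs a <= C -> Rabs (h * (eps * a)) <= h * k).
  { intros a Ha. apply Rabs_mult_le; [rewrite Rabs_pos_eq; lra|now apply eps_le]. }
  assert (khL : forall a d, Rabs a <= C * d -> Rabs (h * (eps * a)) <= h * k * d).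
  { intros a d Ha. rewrite !Rabs_mult, (Rabs_pos_eq h), (Rabs_pos_eq eps) by lra.
    unfold k. rewrite !Rmult_assoc. apply Rmult_le_compat_l; [lra|]. apply Rmult_le_compat_l; lra. }
  assert (Hxi : forall x y, Rabs (xi x - xi y) <= (1 + h * k) * Rabs (x - y)).
  { intros x y. unfold xi.
    replace (x - h * (eps * Q x) - (y - h * (eps * Q y))) with
      (x - y - h * (eps * (Q x - Q y))) by ring.
    eapply Rle_trans; [apply Rabs_minus_le; [apply Rle_refl|apply khL, (C11_lipschitz _ _ _ Hq)]|].
    lra. }
  assert (H1 : Rabs (1 - mu * h) <= 1 - mu * h) by (rewrite Rabs_pos_eq; lra).
  assert (Hd : forall x, Rabs (1 - h * (eps * dq x)) <= 1 + h * k).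
  { intros x. apply Rabs_minus_le; [rewrite Rabs_R1; lra|]. apply kh, (Hq x). }
  exists (fun x => (1 - mu * h) * (ds (xi x) * (1 - h * (eps * dq x))) + h * (eps * dg x)).
  intros x. split; [|split; [|split]].
  - unfold euler. eapply Rle_trans.
    { apply Rabs_plus_le; [apply Rabs_mult_le; [exact H1|apply (Hs (xi x))]|].
      apply kh, (Hg x). }
    nra.
  - eapply Rle_trans.
    { apply Rabs_plus_le; [apply Rabs_mult_le; [exact H1|apply Rabs_mult_le; [apply (Hs (xi x))|apply Hd]]|].
      apply kh, (Hg x). }
    assert ((1 - mu * h) * (1 + h * k) <= 1 - mu * h + h * k) by nra.
    assert (0 <= h * k * (1 - A)) by nra.
    nra.
  - unfold euler.
    apply (is_derive_ext (fun t => (1 - mu * h) * s (xi t) + h * (eps * G t))); [reflexivity|].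
    assert (Dxi : is_derive xi x (1 - h * (eps * dq x))).
    { unfold xi. apply @is_derive_minus; [apply @is_derive_id|].
      apply is_derive_scal, is_derive_scal, (Hq x). }
    apply @is_derive_plus.
    + apply is_derive_scal. rewrite Rmult_comm. apply (is_derive_comp s xi); [apply (Hs (xi x))|exact Dxi].
    + apply is_derive_scal, is_derive_scal, (Hg x).
  - intros y.
    replace (_ - _) with
      ((1 - mu * h) * ((ds (xi x) - ds (xi y)) * (1 - h * (eps * dq x)) - ds (xi y) * (h * (eps * (dq x - dq y))))
       + h * (eps * (dg x - dg y))) by ring.
    eapply Rle_trans.
    { apply Rabs_plus_le.
      - apply Rabs_mult_le; [exact H1|]. apply Rabs_minus_le; apply Rabs_mult_le.
        + apply Rle_trans with (A * ((1 + h * k) * Rabs (x - y))).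
          * eapply Rle_trans; [apply (Hs (xi x))|]. apply Rmult_le_compat_l; [lra|apply Hxi].
          * apply Rle_refl.
        + apply Hd.
        + apply (Hs (xi y)).
        + apply khL, (Hq x).
      - apply khL, (Hg x). }
    generalize (Rabs_pos (x - y)). set (d := Rabs (x - y)). intros Hd0.
    replace (_ + _) with
      (((1 - mu * h) * (A * ((1 + h * k) * (1 + h * k)) + A * (h * k)) + h * k) * d) by ring.
    apply Rmult_le_compat_r; [assumption|].
    assert (HH : (1 + h * k) * (1 + h * k) + h * k <= 1 + 4 * (h * k)) by nra.
    assert (HM : (1 - mu * h) * (1 + 4 * (h * k)) <= 1 - mu * h / 2).
    { fold k in eps_small. assert (8 * (h * k) <= mu * h) by nra. nra. }
    assert (HX : (1 - mu * h) * ((1 + h * k) * (1 + h * k) + h * k) <= 1 - mu * h / 2) by nra.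
    assert (HY : A * ((1 - mu * h) * ((1 + h * k) * (1 + h * k) + h * k)) <= A * (1 - mu * h / 2))
      by (apply Rmult_le_compat_l; lra).
    assert (HZ : h * k = A * (mu * h / 2)) by (replace (A * (mu * h / 2)) with (h / 2 * (mu * A)) by field; rewrite AE; field).
    nra.
Qed.

(** The two foot points differ by at most h k D, which the Lipschitz constant [A] of [s] turns into
    A h k D; the forcing adds h k D. Both are covered by half of the damping because 8 h k <= mu
    h. *)
Lemma euler_contracts s ds s' D :
  C11 A s ds -> (forall x, Rabs (s x - s' x) <= D) ->
  forall x, Rabs (euler h s x - euler h s' x) <= (1 - mu * h / 2) * D.
Proof.
  intros Hs HD x. destruct A_bounds as [[A0 A1] AE]. destruct step_bounds as [[m0 m1] [k0 k1]].
  assert (D0 : 0 <= D) by (generalize (HD 0) (Rabs_pos (s 0 - s' 0)); lra).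
  unfold euler.
  set (Q := q (s x) (s (- x)) x). set (Q' := q (s' x) (s' (- x)) x).
  set (G := g (s x) (s (- x)) x). set (G' := g (s' x) (s' (- x)) x).
  assert (HQ : Rabs (Q - Q') <= C * D) by (apply q_lip; apply HD).
  assert (HG : Rabs (G - G') <= C * D) by (apply g_lip; apply HD).
  assert (khL : forall a, Rabs a <= C * D -> Rabs (h * (eps * a)) <= h * k * D).
  { intros a Ha. rewrite !Rabs_mult, (Rabs_pos_eq h), (Rabs_pos_eq eps) by lra.
    unfold k. rewrite !Rmult_assoc. apply Rmult_le_compat_l; [lra|]. apply Rmult_le_compat_l; lra. }
  replace (_ - _) with
    ((1 - mu * h) * ((s (x - h * (eps * Q)) - s (x - h * (eps * Q')))
       + (s (x - h * (eps * Q')) - s' (x - h * (eps * Q'))))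
     + h * (eps * (G - G'))) by ring.
  eapply Rle_trans.
  { apply Rabs_plus_le; [apply Rabs_mult_le; [rewrite Rabs_pos_eq; [apply Rle_refl|lra]|]|apply khL, HG].
    apply Rabs_plus_le; [|apply HD].
    eapply Rle_trans; [apply (C11_lipschitz _ _ _ Hs)|].
    replace (x - h * (eps * Q) - (x - h * (eps * Q'))) with (- (h * (eps * (Q - Q')))) by ring.
    rewrite Rabs_Ropp. apply Rmult_le_compat_l; [lra|apply khL, HQ]. }
  replace (_ + _) with (((1 - mu * h) * (A * (h * k) + 1) + h * k) * D) by ring.
  apply Rmult_le_compat_r; [assumption|].
  fold k in eps_small. assert (8 * (h * k) <= mu * h) by nra.
  assert (A * (h * k) <= h * k) by nra.
  assert ((1 - mu * h) * (A * (h * k)) <= h * k) by nra. nra.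
Qed.

Lemma euler_periodic s : periodic s -> periodic (euler h s).
Proof.
  intros Hs x. unfold euler.
  assert (E : s (- (x + 2 * PI)) = s (- x)).
  { rewrite <- (Hs (- (x + 2 * PI))). f_equal; ring. }
  rewrite E, Hs, q_per, g_per.
  rewrite <- (Hs (x - h * (eps * q (s x) (s (- x)) x))).
  f_equal. f_equal. f_equal. ring.
Qed.

Lemma euler_fixpoint : exists s ds, C11 A s ds /\ periodic s /\ forall x, euler h s x = s x.
Proof.
  destruct A_bounds as [[A0 A1] AE]. destruct step_bounds as [[m0 m1] [k0 k1]].
  set (th := 1 - mu * h / 2).
  assert (Hth : 0 <= th < 1) by (unfold th; nra).
  set (f := fun n => Nat.iter n (euler h) (fun _ => 0)).
  assert (Hf : forall n, exists df, C11 A (f n) df).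
  { induction n as [|n [df IH]].
    - exists (fun _ => 0). intros x. change (f 0%nat) with (fun _ : R => 0). cbv beta. rewrite Rabs_R0.
      split; [auto|split; [auto|split; [apply @is_derive_const|]]]. intros y. rewrite Rminus_0_r, Rabs_R0.
      apply Rmult_le_pos; auto using Rabs_pos.
    - simpl. now apply (euler_C11 _ df). }
  destruct (choice _ Hf) as [df Hdf].
  assert (Hb : forall n m x, Rabs (f n x - f m x) <= 2 * A).
  { intros n m x. replace (2 * A) with (A + A) by ring.
    apply Rabs_minus_le; [apply (Hdf n x)|apply (Hdf m x)]. }
  (* Shifting both indices together lets induction on [N] give the Cauchy estimate directly,
     starting from the diameter 2 A of the ball, with no geometric series to sum. *)
  assert (Hc : forall N i j x, Rabs (f (N + i)%nat x - f (N + j)%nat x) <= th ^ N * (2 * A)).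
  { induction N as [|N IH]; intros i j x; simpl.
    - rewrite Rmult_1_l. apply Hb.
    - rewrite Rmult_assoc. apply (euler_contracts _ (df (N + i)%nat)); [apply Hdf|]. intros t. apply IH. }
  destruct (C11_limit A f df (fun n => th ^ n * (2 * A)) Hdf) as (s & ds & Hs & Hconv & Hl & _).
  - intros N n m x Hn Hm. replace n with (N + (n - N))%nat by lia. replace m with (N + (m - N))%nat by lia.
    apply Hc.
  - intros eta Heta.
    destruct (pow_lt_1_zero th) with (y := eta / (2 * A + 1)) as [N HN].
    + rewrite Rabs_pos_eq; lra.
    + apply Rdiv_lt_0_compat; lra.
    + exists N. specialize (HN N (Nat.le_refl N)). rewrite Rabs_pos_eq in HN by (apply pow_le; lra).
      apply Rle_lt_trans with (th ^ N * (2 * A + 1)).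
      * apply Rmult_le_compat_l; [apply pow_le|]; lra.
      * replace eta with (eta / (2 * A + 1) * (2 * A + 1)) by (field; lra).
        apply Rmult_lt_compat_r; lra.
  - exists s, ds. split; [exact Hs|split].
    + assert (P : forall n, periodic (f n)).
      { induction n; [intros x; reflexivity|now apply euler_periodic]. }
      intros x. assert (L := Hl (x + 2 * PI)).
      apply (is_lim_seq_ext _ (fun n => f n x)) in L; [|intros n; apply P].
      assert (E := is_lim_seq_unique _ _ L). rewrite (is_lim_seq_unique _ _ (Hl x)) in E.
      injection E; auto.
    + intros x.
      assert (B : forall n, Rabs (euler h s x - s x) <= th ^ n * (2 * A) * 2).
      { intros n. replace (euler h s x - s x) with
          ((f (S n) x - s x) - (euler h (f n) x - euler h s x)) by (replace (f (S n) x) with (euler h (f n) x) by reflexivity; ring).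
        assert (0 <= th ^ n * (2 * A)) by (apply Rmult_le_pos; [apply pow_le|]; lra).
        eapply Rle_trans.
        { apply Rabs_minus_le; [apply Hconv|].
          apply (euler_contracts _ _ _ (th ^ n * (2 * A)) (Hdf n)). intros t; apply Hconv. }
        fold th. simpl. nra. }
      assert (L : is_lim_seq (fun n => th ^ n * (2 * A) * 2) (0 * (2 * A) * 2)).
      { apply (is_lim_seq_scal_r _ 2 (Finite (0 * (2 * A)))).
        apply (is_lim_seq_scal_r _ (2 * A) (Finite 0)). apply is_lim_seq_geom. rewrite Rabs_pos_eq; lra. }
      assert (L2 := is_lim_seq_le _ _ _ _ B (is_lim_seq_const _) L). simpl in L2.
      rewrite !Rmult_0_l in L2. assert (E : Rabs (euler h s x - s x) = 0).
      { apply Rle_antisym; [exact L2|apply Rabs_pos]. }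
      assert (E2 : euler h s x - s x = 0).
      { destruct (Req_dec (euler h s x - s x) 0) as [|N]; [assumption|].
        apply Rabs_pos_lt in N; lra. }
      lra.
Qed.

(** The invariance equation reads [residual s ds x = 0]; it is the limit of (euler h s - s) / h as h
    tends to 0. *)
Definition residual (s ds : R -> R) (x : R) : R :=
  - mu * s x - eps * q (s x) (s (- x)) x * ds x + eps * g (s x) (s (- x)) x.

(** Two second-order terms remain: the Taylor remainder [w] of [s] along the displacement h P, and
    the product of damping and transport, mu h times h P [ds x]. The ball bounds both uniformly, and
    A <= 1 removes [A] from the constant. *)
Lemma euler_consistent s ds x : C11 A s ds ->
  Rabs (euler h s x - s x - h * residual s ds x) <= (mu * k + k * k) * h ^ 2.
Proof.
  intros Hs. destruct A_bounds as [[A0 A1] AE]. destruct step_bounds as [[m0 m1] [k0 k1]].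
  unfold euler, residual. set (Q := q (s x) (s (- x)) x).
  assert (HQ : Rabs (eps * Q) <= k).
  { apply eps_le. eapply (q_lip (s x) (s (- x))); rewrite Rminus_eq_0, Rabs_R0; apply Rle_refl. }
  set (P := eps * Q) in *.
  assert (T := C11_taylor _ _ _ Hs x (x - h * P)).
  replace (x - h * P - x) with (- (h * P)) in T by ring.
  set (w := s (x - h * P) - s x - ds x * - (h * P)) in T.
  replace (_ - _) with ((1 - mu * h) * w + (mu * h) * (ds x * (h * P))) by (unfold w, P; ring).
  assert (HhP : Rabs (h * P) <= h * k) by (apply Rabs_mult_le; [rewrite Rabs_pos_eq|]; lra).
  assert (T' : Rabs w <= (h * k) * (h * k)).
  { apply Rle_trans with (1 := T). replace ((- (h * P)) ^ 2) with (Rabs (h * P) * Rabs (h * P)) by (rewrite Rabs_sq; ring).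
    generalize (Rabs_pos (h * P)). set (z := Rabs (h * P)) in *. intros. assert (z * z <= h * k * (h * k)) by nra. nra. }
  eapply Rle_trans.
  { apply Rabs_plus_le; apply Rabs_mult_le; [rewrite Rabs_pos_eq; [apply Rle_refl|lra]|exact T'|rewrite Rabs_pos_eq; [apply Rle_refl|lra]|].
    apply Rabs_mult_le; [apply (Hs x)|exact HhP]. }
  assert ((1 - mu * h) * (h * k * (h * k)) <= h * k * (h * k)) by nra.
  assert (mu * h * (A * (h * k)) <= mu * h * (h * k)).
  { apply Rmult_le_compat_l; [lra|]. nra. }
  simpl. nra.
Qed.

End Step.

Theorem invariant_curve : exists s ds, C11 (2 * (eps * C) / mu) s ds /\ periodic s /\
  forall x, eps * q (s x) (s (- x)) x * ds x = - mu * s x + eps * g (s x) (s (- x)) x.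
Proof.
  destruct A_bounds as [[A0 A1] AE]. assert (Hk := k_nonneg).
  set (h := fun n => / (mu + k) / INR (S n)).
  assert (HS : forall n, 1 <= INR (S n)).
  { intros n. rewrite S_INR. generalize (pos_INR n); lra. }
  assert (h_pos : forall n, 0 < h n).
  { intros n. apply Rdiv_lt_0_compat; [apply Rinv_0_lt_compat|generalize (HS n)]; lra. }
  assert (h_small : forall n, h n * (mu + k) <= 1).
  { intros n. replace (h n * (mu + k)) with (/ INR (S n)) by (unfold h; field; generalize (HS n); intro; split; lra).
    rewrite <- Rinv_1. apply Rinv_le_contravar; [lra|apply HS]. }
  assert (h_decr : forall n m, (n <= m)%nat -> h m <= h n).
  { intros n m Hnm. apply Rmult_le_compat_l; [left; apply Rinv_0_lt_compat; lra|].
    apply Rinv_le_contravar; [generalize (HS n); lra|]. apply le_INR; lia. }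
  assert (F : forall n, exists p : (R -> R) * (R -> R), C11 A (fst p) (snd p) /\ periodic (fst p) /\
     forall x, euler (h n) (fst p) x = fst p x).
  { intros n. destruct (euler_fixpoint _ (h_pos n) (h_small n)) as (s & ds & H). now exists (s, ds). }
  destruct (choice _ F) as [sp Hsp].
  set (K := mu * k + k * k). assert (HK : 0 <= K) by (unfold K; nra).
  (* At a fixed point the increment vanishes, so consistency bounds h times the residual by K
     h^2. *)
  assert (Hres : forall n x, Rabs (residual (fst (sp n)) (snd (sp n)) x) <= K * h n).
  { intros n x. destruct (Hsp n) as (H1 & _ & H3).
    assert (E := euler_consistent _ (h_pos n) (h_small n) _ _ x H1). rewrite H3 in E.
    replace (_ - _) with (- (h n * residual (fst (sp n)) (snd (sp n)) x)) in E by ring.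
    rewrite Rabs_Ropp, Rabs_mult, (Rabs_pos_eq (h n)) in E by (generalize (h_pos n); lra).
    fold K in E. apply (Rmult_le_reg_l (h n)); [apply h_pos|]. simpl in E. lra. }
  (* The fixed point for [h m] is nearly fixed by the step [h n]: the error is K (h n)^2 from
     consistency plus h n times the residual K h m. Dividing by the contraction margin mu h n / 2
     cancels one factor [h n], so the bound does not degenerate as the steps shrink. *)
  assert (Hdiff : forall n m x, Rabs (fst (sp n) x - fst (sp m) x) <= 2 * K * (h n + h m) / mu).
  { intros n m. destruct (Hsp n) as (Hn & _ & En). destruct (Hsp m) as (Hm & _ & Em).
    destruct (step_bounds _ (h_pos n) (h_small n)) as [[m0 m1] _].
    assert (Hh := h_pos n).
    replace (2 * K * (h n + h m) / mu) with (K * h n * (h n + h m) / (1 - (1 - mu * h n / 2)))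
      by (field; split; nra).
    apply (contraction_sup _ _ _ (A + A)).
    - nra.
    - intros x. apply Rabs_minus_le; [apply (Hn x)|apply (Hm x)].
    - intros D HD x.
      assert (E := euler_consistent _ (h_pos n) (h_small n) _ _ x Hm). fold K in E.
      rewrite <- (En x).
      replace (euler (h n) (fst (sp n)) x - fst (sp m) x) with
        ((euler (h n) (fst (sp n)) x - euler (h n) (fst (sp m)) x)
         + ((euler (h n) (fst (sp m)) x - fst (sp m) x - h n * residual (fst (sp m)) (snd (sp m)) x)
          + h n * residual (fst (sp m)) (snd (sp m)) x)) by ring.
      eapply Rle_trans.
      { apply Rabs_plus_le; [apply (euler_contracts _ (h_pos n) (h_small n) _ _ _ _ Hn HD)|].
        apply Rabs_plus_le; [exact E|]. apply Rabs_mult_le; [rewrite Rabs_pos_eq; [apply Rle_refl|lra]|apply Hres]. }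
      simpl. lra. }
  destruct (C11_limit A (fun n => fst (sp n)) (fun n => snd (sp n)) (fun n => 4 * K * h n / mu))
    as (s & ds & Hs & Hconv & Hl & Hdl).
  - intros n; apply Hsp.
  - intros N n m x Hn Hm. apply Rle_trans with (1 := Hdiff n m x).
    apply Rmult_le_compat_r; [left; now apply Rinv_0_lt_compat|].
    generalize (h_decr _ _ Hn) (h_decr _ _ Hm); nra.
  - intros eta Heta.
    (* The constant vanishes when eps = 0, and the Archimedean choice of [N] divides by it. *)
    destruct (Rle_dec (4 * K / mu * / (mu + k)) 0) as [Hz|Hz].
    + exists 0%nat. unfold h. simpl. apply Rle_lt_trans with (2 := Heta).
      replace (4 * K * (/ (mu + k) / 1) / mu) with (4 * K / mu * / (mu + k)) by (field; lra). exact Hz.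
    + apply Rnot_le_lt in Hz. destruct (archimed_cor1 (eta / (4 * K / mu * / (mu + k)))) as [N [HN1 HN2]].
      { apply Rdiv_lt_0_compat; assumption. }
      exists N. replace (4 * K * h N / mu) with ((4 * K / mu * / (mu + k)) * / INR (S N))
        by (unfold h; field; generalize (HS N); lra).
      set (L := 4 * K / mu * / (mu + k)) in *.
      apply Rle_lt_trans with (L * / INR N).
      { apply Rmult_le_compat_l; [lra|]. apply Rinv_le_contravar; [now apply lt_0_INR|]. apply le_INR; lia. }
      replace eta with (L * (eta / L)) by (field; lra). now apply Rmult_lt_compat_l.
  - exists s, ds. split; [exact Hs|split].
    + intros x. assert (L := Hl (x + 2 * PI)).
      apply (is_lim_seq_ext _ (fun n => fst (sp n) x)) in L; [|intros n; apply (Hsp n)].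
      assert (E := is_lim_seq_unique _ _ L). rewrite (is_lim_seq_unique _ _ (Hl x)) in E.
      injection E; auto.
    + intros x.
      assert (Lh : is_lim_seq h 0).
      { unfold h. replace (Finite 0) with (Rbar_mult (/ (mu + k)) 0) by (simpl; f_equal; ring).
        apply is_lim_seq_scal_l. apply (is_lim_seq_incr_1 (fun n => / INR n)).
        apply (is_lim_seq_inv _ p_infty); [apply is_lim_seq_INR|discriminate]. }
      assert (Lc : forall f : R -> R -> R -> R, (forall a b a' b' x D,
          Rabs (a - a') <= D -> Rabs (b - b') <= D ->
          Rabs (f a b x) <= C /\ Rabs (f a b x - f a' b' x) <= C * D) ->
          is_lim_seq (fun n => f (fst (sp n) x) (fst (sp n) (- x)) x) (f (s x) (s (- x)) x)).
      { intros f Hf. apply is_lim_seq_spec. intros eta.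
        assert (L0 : is_lim_seq (fun n => C * (4 * K * h n / mu)) 0).
        { replace (Finite 0) with (Rbar_mult (C * (4 * K / mu)) 0) by (simpl; f_equal; ring).
          apply (is_lim_seq_ext (fun n => C * (4 * K / mu) * h n)); [intros n; field; lra|].
          now apply is_lim_seq_scal_l. }
        apply is_lim_seq_spec in L0. destruct (L0 eta) as [N HN]. exists N. intros n Hn.
        specialize (HN n Hn). rewrite Rminus_0_r in HN.
        apply Rle_lt_trans with (2 := HN). apply Rle_trans with (2 := Rle_abs _).
        apply Hf; apply Hconv. }
      assert (L : is_lim_seq (fun n => residual (fst (sp n)) (snd (sp n)) x) (residual s ds x)).
      { unfold residual. apply is_lim_seq_plus'; [apply is_lim_seq_minus'|].
        - apply (is_lim_seq_scal_l _ (- mu) (Finite (s x))); apply Hl.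
        - apply is_lim_seq_mult'; [|apply Hdl].
          apply (is_lim_seq_scal_l _ eps (Finite _)). now apply Lc.
        - apply (is_lim_seq_scal_l _ eps (Finite _)). now apply Lc. }
      assert (Z : Rabs (residual s ds x) <= 0).
      { assert (LA := is_lim_seq_abs _ _ L).
        assert (LK : is_lim_seq (fun n => K * h n) (Rbar_mult K 0)) by now apply is_lim_seq_scal_l.
        assert (Le := is_lim_seq_le _ _ _ _ (fun n => Hres n x) LA LK). simpl in Le. lra. }
      assert (Z' : residual s ds x = 0).
      { destruct (Req_dec (residual s ds x) 0) as [|N]; [assumption|].
        apply Rabs_pos_lt in N; lra. }
      unfold residual in Z'. lra.
Qed.

End Epsilon.
End InvariantCurve.

(** * Algebras of smooth functions *)

(** The perturbation is built from its arguments by these operations alone, so one traversal of its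
    formula yields every regularity needed. The instances are bounded Lipschitz functions, functions
    uniformly C^{1,1} over a family, and functions continuous at a point. *)
Record smooth_algebra {X : Type} (K : (X -> R) -> Prop) : Prop := {
  sa_const : forall c, K (fun _ => c);
  sa_plus : forall f g, K f -> K g -> K (fun x => f x + g x);
  sa_mult : forall f g, K f -> K g -> K (fun x => f x * g x);
  sa_exp : forall f, K f -> K (fun x => exp (f x));
  sa_sin : forall f, K f -> K (fun x => sin (f x));
  sa_cos : forall f, K f -> K (fun x => cos (f x)) }.

Lemma sa_opp {X} (K : (X -> R) -> Prop) f : smooth_algebra K -> K f -> K (fun x => - f x).
Proof.
  intros S Hf. replace (fun x => - f x) with (fun x => -1 * f x).
  - apply (sa_mult _ S (fun _ => -1)); [apply (sa_const _ S)|exact Hf].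
  - apply FunctionalExtensionality.functional_extensionality; intros x; ring.
Qed.

Lemma sa_minus {X} (K : (X -> R) -> Prop) f g :
  smooth_algebra K -> K f -> K g -> K (fun x => f x - g x).
Proof. intros S Hf Hg. apply (sa_plus _ S f (fun x => - g x)); [exact Hf|now apply sa_opp]. Qed.

(** [E x y d] stands for: x and y are admissible and at distance at most d. A relation in place of a
    metric covers coordinatewise distances and restriction to a ball alike. *)
Definition bounded_lipschitz {X : Type} (E : X -> X -> R -> Prop) (f : X -> R) : Prop :=
  exists M, 0 <= M /\ forall x y d, E x y d -> 0 <= d ->
    Rabs (f x) <= M /\ Rabs (f y) <= M /\ Rabs (f x - f y) <= M * d.

Lemma bounded_lipschitz_comp {X} (E : X -> X -> R -> Prop) (phi : R -> R) (f : X -> R) :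
  (forall M, 0 <= M -> exists L, 0 <= L /\ forall a b, Rabs a <= M -> Rabs b <= M ->
     Rabs (phi a) <= L /\ Rabs (phi a - phi b) <= L * Rabs (a - b)) ->
  bounded_lipschitz E f -> bounded_lipschitz E (fun x => phi (f x)).
Proof.
  intros Hphi (M & HM & Hf). destruct (Hphi M HM) as (L & HL & H).
  exists (L + L * M). split; [nra|]. intros x y d Hxy Hd.
  destruct (Hf x y d Hxy Hd) as (H1 & H2 & H3).
  destruct (H _ _ H1 H2) as [P1 P2]. destruct (H _ _ H2 H1) as [P3 _].
  assert (0 <= L * M) by nra.
  split; [lra|split; [lra|]]. apply Rle_trans with (1 := P2).
  assert (L * Rabs (f x - f y) <= L * (M * d)) by (apply Rmult_le_compat_l; lra). nra.
Qed.

Lemma sin_lipschitz a b : Rabs (sin a - sin b) <= Rabs (a - b).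
Proof.
  rewrite <- (Rmult_1_l (Rabs (a - b))). apply (bounded_variation sin cos). intros t _.
  split; [apply is_derive_sin|]. apply Rabs_le, COS_bound.
Qed.

Lemma cos_lipschitz a b : Rabs (cos a - cos b) <= Rabs (a - b).
Proof.
  rewrite <- (Rmult_1_l (Rabs (a - b))). apply (bounded_variation cos (fun x => - sin x)). intros t _.
  split; [apply is_derive_cos|]. rewrite Rabs_Ropp. apply Rabs_le, SIN_bound.
Qed.

Lemma Rabs_sin_le a : Rabs (sin a) <= 1.
Proof. apply Rabs_le, SIN_bound. Qed.

Lemma Rabs_cos_le a : Rabs (cos a) <= 1.
Proof. apply Rabs_le, COS_bound. Qed.

Lemma exp_le a b : a <= b -> exp a <= exp b.
Proof. intros [H| ->]; [left; now apply exp_increasing|apply Rle_refl]. Qed.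

(** [bounded_variation] asks for the derivative bound at all points within |a - b| of one endpoint,
    not only between the two; these reach up to 3 M, hence the exponent. *)
Lemma exp_lipschitz M a b : Rabs a <= M -> Rabs b <= M ->
  Rabs (exp a) <= exp (3 * M) /\ Rabs (exp a - exp b) <= exp (3 * M) * Rabs (a - b).
Proof.
  intros Ha Hb. assert (HM : 0 <= M) by (generalize (Rabs_pos a); lra).
  split.
  - rewrite Rabs_pos_eq by (left; apply exp_pos). apply exp_le. generalize (Rle_abs a); lra.
  - apply (bounded_variation exp exp). intros t Ht. split; [apply is_derive_exp|].
    rewrite Rabs_pos_eq by (left; apply exp_pos). apply exp_le.
    apply Rabs_le_between in Ha. apply Rabs_le_between in Hb.
    assert (Rabs (a - b) <= 2 * M) by (apply Rabs_le; lra).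
    assert (Rabs (t - b) <= 2 * M) as T by lra. apply Rabs_le_between in T. lra.
Qed.

Lemma bounded_lipschitz_algebra {X} (E : X -> X -> R -> Prop) :
  smooth_algebra (bounded_lipschitz E).
Proof.
  split.
  - intros c. exists (Rabs c). split; [apply Rabs_pos|]. intros x y d _ Hd.
    rewrite Rminus_eq_0, Rabs_R0. generalize (Rabs_pos c). intros; repeat split; nra.
  - intros f g (M & HM & Hf) (L & HL & Hg). exists (M + L). split; [lra|]. intros x y d Hxy Hd.
    destruct (Hf _ _ _ Hxy Hd) as (F1 & F2 & F3). destruct (Hg _ _ _ Hxy Hd) as (G1 & G2 & G3).
    split; [now apply Rabs_plus_le|split; [now apply Rabs_plus_le|]].
    replace (_ - _) with ((f x - f y) + (g x - g y)) by ring.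
    rewrite Rmult_plus_distr_r. now apply Rabs_plus_le.
  - intros f g (M & HM & Hf) (L & HL & Hg). exists (2 * (M * L)). split; [nra|]. intros x y d Hxy Hd.
    destruct (Hf _ _ _ Hxy Hd) as (F1 & F2 & F3). destruct (Hg _ _ _ Hxy Hd) as (G1 & G2 & G3).
    assert (0 <= M * L) by nra.
    split; [|split].
    + apply Rle_trans with (M * L); [now apply Rabs_mult_le|lra].
    + apply Rle_trans with (M * L); [now apply Rabs_mult_le|lra].
    + replace (_ - _) with ((f x - f y) * g x + f y * (g x - g y)) by ring.
      eapply Rle_trans; [apply Rabs_plus_le; apply Rabs_mult_le; eassumption|]. lra.
  - intros f. apply bounded_lipschitz_comp. intros M HM. exists (exp (3 * M)).
    split; [left; apply exp_pos|]. intros a b. apply exp_lipschitz.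
  - intros f. apply bounded_lipschitz_comp. intros M HM. exists 1. split; [lra|].
    intros a b _ _. rewrite Rmult_1_l. split; [apply Rabs_sin_le|apply sin_lipschitz].
  - intros f. apply bounded_lipschitz_comp. intros M HM. exists 1. split; [lra|].
    intros a b _ _. rewrite Rmult_1_l. split; [apply Rabs_cos_le|apply cos_lipschitz].
Qed.

Lemma C11_comp (phi dphi f df : R -> R) (L M : R) :
  0 <= L ->
  (forall a, Rabs a <= M -> Rabs (phi a) <= L /\ Rabs (dphi a) <= L /\ is_derive phi a (dphi a)) ->
  (forall a b, Rabs a <= M -> Rabs b <= M -> Rabs (dphi a - dphi b) <= L * Rabs (a - b)) ->
  C11 M f df -> C11 (L * (1 + M + M * M)) (fun x => phi (f x)) (fun x => dphi (f x) * df x).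
Proof.
  intros HL H1 H2 Hf x. assert (HM := C11_pos _ _ _ Hf).
  assert (0 <= L * M) by nra. assert (0 <= L * (M * M)) by (apply Rmult_le_pos; nra).
  destruct (Hf x) as (F0 & F1 & F2 & F3). destruct (H1 _ F0) as (P0 & P1 & P2).
  split; [lra|split; [|split]].
  - apply Rle_trans with (L * M); [now apply Rabs_mult_le|lra].
  - rewrite Rmult_comm. now apply (is_derive_comp phi f).
  - intros y. destruct (Hf y) as (G0 & G1 & G2 & G3).
    replace (_ - _) with ((dphi (f x) - dphi (f y)) * df x + dphi (f y) * (df x - df y)) by ring.
    eapply Rle_trans.
    { apply Rabs_plus_le; apply Rabs_mult_le;
        [eapply Rle_trans; [now apply H2|apply Rmult_le_compat_l; [exact HL|apply (C11_lipschitz _ _ _ Hf)]]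
        |exact F1|apply (H1 _ G0)|apply F3]. }
    generalize (Rabs_pos (x - y)); intros.
    assert (0 <= L * Rabs (x - y)) by (apply Rmult_le_pos; lra). nra.
Qed.

Lemma C11_plus A B f df g dg :
  C11 A f df -> C11 B g dg -> C11 (A + B) (fun x => f x + g x) (fun x => df x + dg x).
Proof.
  intros Hf Hg x. destruct (Hf x) as (F0 & F1 & F2 & F3). destruct (Hg x) as (G0 & G1 & G2 & G3).
  split; [now apply Rabs_plus_le|split; [now apply Rabs_plus_le|split; [now apply @is_derive_plus|]]].
  intros y. replace (_ - _) with ((df x - df y) + (dg x - dg y)) by ring.
  rewrite Rmult_plus_distr_r. now apply Rabs_plus_le.
Qed.

Lemma C11_mult A B f df g dg :
  C11 A f df -> C11 B g dg ->
  C11 (4 * (A * B)) (fun x => f x * g x) (fun x => df x * g x + f x * dg x).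
Proof.
  intros Hf Hg x. destruct (Hf x) as (F0 & F1 & F2 & F3). destruct (Hg x) as (G0 & G1 & G2 & G3).
  assert (HA := C11_pos _ _ _ Hf). assert (HB := C11_pos _ _ _ Hg).
  assert (0 <= A * B) by nra.
  split; [|split; [|split]].
  - apply Rle_trans with (A * B); [now apply Rabs_mult_le|lra].
  - eapply Rle_trans; [apply Rabs_plus_le; apply Rabs_mult_le; eassumption|]. lra.
  - apply (is_derive_mult f g x (df x) (dg x)); auto. intros n m; apply Rmult_comm.
  - intros y. destruct (Hf y) as (K0 & K1 & _ & _). destruct (Hg y) as (L0 & L1 & _ & _).
    replace (_ - _) with
      (((df x - df y) * g x + df y * (g x - g y)) + ((f x - f y) * dg x + f y * (dg x - dg y))) by ring.
    eapply Rle_trans.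
    { apply Rabs_plus_le; apply Rabs_plus_le; apply Rabs_mult_le;
        first [eassumption|apply F3|apply G3|apply (C11_lipschitz _ _ _ Hf)|apply (C11_lipschitz _ _ _ Hg)]. }
    lra.
Qed.

(** The index will range over candidate curves, so that a single [M] serves the whole ball of
    curves. *)
Definition uniformly_C11 {I : Type} (P : I -> Prop) (f : I * R -> R) : Prop :=
  exists M, 0 <= M /\ forall i, P i -> exists df, C11 M (fun x => f (i, x)) df.

Lemma uniformly_C11_comp {I} (P : I -> Prop) (phi dphi : R -> R) (f : I * R -> R) :
  (forall M, exists L, 0 <= L /\
    (forall a, Rabs a <= M -> Rabs (phi a) <= L /\ Rabs (dphi a) <= L /\ is_derive phi a (dphi a)) /\
    (forall a b, Rabs a <= M -> Rabs b <= M -> Rabs (dphi a - dphi b) <= L * Rabs (a - b))) ->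
  uniformly_C11 P f -> uniformly_C11 P (fun x => phi (f x)).
Proof.
  intros Hphi (M & HM & Hf). destruct (Hphi M) as (L & HL & H1 & H2).
  exists (L * (1 + M + M * M)). split; [nra|]. intros i Hi. destruct (Hf i Hi) as [df Hdf].
  exists (fun x => dphi (f (i, x)) * df x). now apply (C11_comp phi dphi (fun x => f (i, x))).
Qed.

Lemma uniformly_C11_algebra {I} (P : I -> Prop) : smooth_algebra (uniformly_C11 P).
Proof.
  split.
  - intros c. exists (Rabs c). split; [apply Rabs_pos|]. intros i _. exists (fun _ => 0). intros x.
    rewrite Rabs_R0. split; [lra|split; [apply Rabs_pos|split; [apply @is_derive_const|]]].
    intros y. rewrite Rminus_0_r, Rabs_R0. apply Rmult_le_pos; apply Rabs_pos.
  - intros f g (M & HM & Hf) (L & HL & Hg). exists (M + L). split; [lra|]. intros i Hi.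
    destruct (Hf i Hi) as [df Hdf]. destruct (Hg i Hi) as [dg Hdg].
    exists (fun x => df x + dg x). now apply C11_plus.
  - intros f g (M & HM & Hf) (L & HL & Hg). exists (4 * (M * L)). split; [nra|]. intros i Hi.
    destruct (Hf i Hi) as [df Hdf]. destruct (Hg i Hi) as [dg Hdg].
    exists (fun x => df x * g (i, x) + f (i, x) * dg x). now apply C11_mult.
  - intros f. apply (uniformly_C11_comp P exp exp). intros M. exists (exp (3 * M)).
    split; [left; apply exp_pos|split].
    + intros a Ha. destruct (exp_lipschitz M a a Ha Ha) as [H _]. split; [exact H|split; [exact H|apply is_derive_exp]].
    + intros a b Ha Hb. now apply exp_lipschitz.
  - intros f. apply (uniformly_C11_comp P sin cos). intros M. exists 1. split; [lra|split].
    + intros a _. split; [apply Rabs_sin_le|split; [apply Rabs_cos_le|apply is_derive_sin]].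
    + intros a b _ _. rewrite Rmult_1_l. apply cos_lipschitz.
  - intros f. apply (uniformly_C11_comp P cos (fun x => - sin x)). intros M. exists 1. split; [lra|split].
    + intros a _. rewrite Rabs_Ropp. split; [apply Rabs_cos_le|split; [apply Rabs_sin_le|apply is_derive_cos]].
    + intros a b _ _. rewrite Rmult_1_l. replace (- sin a - - sin b) with (- (sin a - sin b)) by ring.
      rewrite Rabs_Ropp. apply sin_lipschitz.
Qed.

Definition in_algebra {X : Type} (K : (X -> R) -> Prop) (f : X -> C) : Prop :=
  K (fun x => Re (f x)) /\ K (fun x => Im (f x)).

Section ComplexAlgebra.

Context {X : Type} (K : (X -> R) -> Prop) (SA : smooth_algebra K).

Lemma in_algebra_const c : in_algebra K (fun _ => c).
Proof. split; [exact (sa_const _ SA (Re c))|exact (sa_const _ SA (Im c))]. Qed.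

Lemma in_algebra_pair f g : K f -> K g -> in_algebra K (fun x => (f x, g x)).
Proof. intros; split; assumption. Qed.

Lemma in_algebra_RtoC f : K f -> in_algebra K (fun x => RtoC (f x)).
Proof. intros; split; [assumption|exact (sa_const _ SA 0)]. Qed.

Lemma in_algebra_plus f g : in_algebra K f -> in_algebra K g -> in_algebra K (fun x => (f x + g x)%C).
Proof.
  intros [F1 F2] [G1 G2]; split.
  - apply (sa_plus _ SA _ _ F1 G1).
  - apply (sa_plus _ SA _ _ F2 G2).
Qed.

Lemma in_algebra_mult f g : in_algebra K f -> in_algebra K g -> in_algebra K (fun x => (f x * g x)%C).
Proof.
  intros [F1 F2] [G1 G2]; split.
  - apply (sa_minus _ (fun x => Re (f x) * Re (g x)) (fun x => Im (f x) * Im (g x)) SA); now apply (sa_mult _ SA).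
  - apply (sa_plus _ SA (fun x => Re (f x) * Im (g x)) (fun x => Im (f x) * Re (g x))); now apply (sa_mult _ SA).
Qed.

Lemma in_algebra_conj f : in_algebra K f -> in_algebra K (fun x => Cconj (f x)).
Proof. intros [F1 F2]; split; [exact F1|]. apply (sa_opp _ _ SA F2). Qed.

End ComplexAlgebra.

(** * Truncated amplitude and logarithmic modulus *)

Definition clamp (t : R) : R := Rmax (- (1/2)) (Rmin (1/2) t).

Lemma clamp_bounds t : - (1/2) <= clamp t <= 1/2.
Proof. unfold clamp, Rmax, Rmin; repeat destruct Rle_dec; lra. Qed.

Lemma clamp_id t : Rabs t <= 1/2 -> clamp t = t.
Proof.
  intros H; apply Rabs_le_between in H. unfold clamp, Rmax, Rmin; repeat destruct Rle_dec; lra.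
Qed.

Lemma clamp_lipschitz a b : Rabs (clamp a - clamp b) <= Rabs (a - b).
Proof.
  unfold clamp, Rmax, Rmin; repeat destruct Rle_dec; unfold Rabs; repeat destruct Rcase_abs; lra.
Qed.

(* ln (|z| / r) as a function of y = r^2 / |z|^2 - 1. *)
Definition logmod (t : R) : R := - (1/2) * ln (1 + clamp t).

Lemma ln_lipschitz_half a b : 1/2 <= a -> 1/2 <= b -> Rabs (ln a - ln b) <= 2 * Rabs (a - b).
Proof.
  assert (H : forall a b, 1/2 <= a -> 1/2 <= b -> ln a - ln b <= 2 * Rabs (a - b)).
  { clear a b. intros a b Ha Hb. rewrite <- ln_div by lra.
    assert (E := exp_ineq1_le (ln (a / b))). rewrite exp_ln in E by (apply Rdiv_lt_0_compat; lra).
    apply Rle_trans with ((a - b) / b).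
    - replace ((a - b) / b) with (a / b - 1) by (field; lra). lra.
    - apply (Rmult_le_reg_r b); [lra|]. replace ((a - b) / b * b) with (a - b) by (field; lra).
      generalize (Rle_abs (a - b)) (Rabs_pos (a - b)); nra. }
  intros Ha Hb. apply Rabs_le. split; [|now apply H].
  rewrite Rabs_minus_sym. generalize (H b a Hb Ha); lra.
Qed.

(** The truncation keeps the argument of [ln] above 1/2, where its slope is at most 2; the factor
    1/2 in [logmod] cancels this. *)
Lemma logmod_lipschitz a b : Rabs (logmod a - logmod b) <= Rabs (a - b).
Proof.
  unfold logmod. replace (_ - _) with (- (1/2) * (ln (1 + clamp a) - ln (1 + clamp b))) by ring.
  rewrite Rabs_mult, Rabs_Ropp, (Rabs_pos_eq (1/2)) by lra.
  assert (H := ln_lipschitz_half (1 + clamp a) (1 + clamp b)).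
  replace (1 + clamp a - (1 + clamp b)) with (clamp a - clamp b) in H by ring.
  generalize (clamp_bounds a) (clamp_bounds b) (clamp_lipschitz a b); intros.
  specialize (H ltac:(lra) ltac:(lra)). lra.
Qed.

Lemma logmod_0 : logmod 0 = 0.
Proof. unfold logmod. rewrite clamp_id by (rewrite Rabs_R0; lra). rewrite Rplus_0_r, ln_1; ring. Qed.

Lemma logmod_bound a : Rabs (logmod a) <= 1/2.
Proof.
  assert (E : logmod a = logmod (clamp a)).
  { unfold logmod. rewrite (clamp_id (clamp a)); [reflexivity|]. apply Rabs_le, clamp_bounds. }
  rewrite E, <- (Rminus_0_r (logmod (clamp a))), <- logmod_0.
  apply Rle_trans with (1 := logmod_lipschitz _ _). rewrite Rminus_0_r.
  apply Rabs_le, clamp_bounds.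
Qed.

Lemma exp_logmod a : exp (-2 * logmod a) = 1 + clamp a.
Proof.
  unfold logmod. replace (-2 * _) with (ln (1 + clamp a)) by field.
  apply exp_ln. generalize (clamp_bounds a); lra.
Qed.

Lemma is_derive_logmod a : Rabs a < 1/2 -> is_derive logmod a (- (1/2) * / (1 + a)).
Proof.
  intros Ha. apply (is_derive_ext_loc (fun t => - (1/2) * ln (1 + t))).
  - assert (Hp : 0 < 1/2 - Rabs a) by lra. exists (mkposreal _ Hp). intros t Ht.
    assert (Rabs (t - a) < 1/2 - Rabs a) by exact Ht.
    unfold logmod. rewrite clamp_id; [reflexivity|].
    replace t with (a + (t - a)) by ring. eapply Rle_trans; [apply Rabs_triang|]. lra.
  - apply Rabs_def2 in Ha. auto_derive; [lra|]. field. lra.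
Qed.

Lemma C11_logmod s ds : C11 (1/4) s ds ->
  C11 2 (fun x => logmod (s x)) (fun x => - (1/2) * / (1 + s x) * ds x).
Proof.
  intros Hs.
  assert (I : forall a, Rabs a <= 1/4 -> 0 < / (1 + a) <= 4/3).
  { intros a Ha. apply Rabs_le_between in Ha. split; [apply Rinv_0_lt_compat; lra|].
    replace (4/3) with (/ (3/4)) by field. apply Rinv_le_contravar; lra. }
  apply (C11_mono (1 * (1 + 1/4 + 1/4 * (1/4)))); [lra|].
  apply (C11_comp logmod (fun a => - (1/2) * / (1 + a))); [lra| | |exact Hs].
  - intros a Ha. split; [generalize (logmod_bound a); lra|split].
    + apply Rabs_le. generalize (I a Ha); lra.
    + apply is_derive_logmod; lra.
  - intros a b Ha Hb. assert (Ia := I a Ha). assert (Ib := I b Hb).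
    apply Rabs_le_between in Ha. apply Rabs_le_between in Hb.
    replace (_ - _) with (1/2 * (/ (1 + a) * / (1 + b)) * (a - b)) by (field; lra).
    rewrite Rabs_mult. apply Rmult_le_compat_r; [apply Rabs_pos|].
    rewrite Rabs_pos_eq; nra.
Qed.

(** * Global solutions of bounded Lipschitz equations *)

Lemma le_of_derive_nonneg (f df : R -> R) a b :
  a <= b -> (forall x, a <= x <= b -> is_derive f x (df x) /\ 0 <= df x) -> f a <= f b.
Proof.
  intros Hab H.
  destruct (MVT_gen f a b df) as (c & Hc & E).
  - intros x Hx. rewrite Rmin_left, Rmax_right in Hx by assumption. apply H; lra.
  - intros x Hx. rewrite Rmin_left, Rmax_right in Hx by assumption.
    apply continuity_pt_filterlim, (ex_derive_continuous f). exists (df x). now apply H.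
  - rewrite Rmin_left, Rmax_right in Hc by assumption. destruct (H c Hc) as [_ P]. nra.
Qed.

(** Integration against the weight exp (k |t|) gains a factor 1 / k. With this weight the Picard
    iteration converges on the whole line at once, so no local solutions are glued. Negative times
    and lower bounds follow by reflection. *)
Lemma exp_growth_bound (f df : R -> R) (k B : R) :
  0 < k -> 0 <= B -> f 0 = 0 -> (forall t, is_derive f t (df t)) ->
  (forall t, Rabs (df t) <= B * k * exp (k * Rabs t)) ->
  forall t, Rabs (f t) <= B * exp (k * Rabs t).
Proof.
  intros Hk HB.
  assert (P : forall f df : R -> R, f 0 = 0 -> (forall t, is_derive f t (df t)) ->
    (forall t, Rabs (df t) <= B * k * exp (k * Rabs t)) ->
    forall t, 0 <= t -> f t <= B * exp (k * t)).
  { clear f df. intros f df F0 Hd Hb t Ht.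
    assert (B * exp (k * 0) - f 0 <= B * exp (k * t) - f t).
    { apply (le_of_derive_nonneg (fun s => B * exp (k * s) - f s) (fun s => B * k * exp (k * s) - df s)); [assumption|].
      intros s Hs. split.
      - apply @is_derive_minus; [|apply Hd]. auto_derive; [exact Logic.I|ring].
      - specialize (Hb s). rewrite (Rabs_pos_eq s) in Hb by lra. generalize (Rle_abs (df s)); lra. }
    rewrite F0, Rmult_0_r, exp_0 in H. lra. }
  intros F0 Hd Hb t.
  assert (Q : forall f df : R -> R, f 0 = 0 -> (forall t, is_derive f t (df t)) ->
    (forall t, Rabs (df t) <= B * k * exp (k * Rabs t)) -> f t <= B * exp (k * Rabs t)).
  { clear f df F0 Hd Hb. intros f df F0 Hd Hb. destruct (Rle_dec 0 t) as [Ht|Ht].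
    - rewrite (Rabs_pos_eq t) by assumption. now apply (P f df).
    - rewrite (Rabs_left t) by lra. rewrite <- (Ropp_involutive t) at 1.
      apply (P (fun s => f (- s)) (fun s => - df (- s))); [now rewrite Ropp_0| | |lra].
      + intros s. replace (- df (- s)) with (scal (-1) (df (- s))) by (unfold scal; simpl; unfold mult; simpl; ring).
        apply (is_derive_comp f (fun s => - s)); [apply Hd|]. auto_derive; [exact Logic.I|ring].
      + intros s. rewrite Rabs_Ropp. rewrite <- (Rabs_Ropp s) at 1. apply Hb. }
  apply Rabs_le. split; [|now apply (Q f df)].
  assert (- f t <= B * exp (k * Rabs t)); [|lra].
  apply (Q (fun s => - f s) (fun s => - df s)); [lra| |].
  - intros s. apply @is_derive_opp. apply Hd.
  - intros s. rewrite Rabs_Ropp. apply Hb.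
Qed.

Section Picard.

Context {I : Type} (F : (I -> R) -> I -> R) (L M : R) (x0 : I -> R).
Hypothesis L_pos : 0 < L.
Hypothesis F_bounded : forall u i, Rabs (F u i) <= M.
Hypothesis F_lipschitz : forall u v B, (forall j, Rabs (u j - v j) <= B) ->
  forall i, Rabs (F u i - F v i) <= L * B.

Fixpoint picard (n : nat) (t : R) (i : I) : R :=
  match n with
  | O => x0 i
  | S m => x0 i + RInt (fun s => F (picard m s) i) 0 t
  end.

Lemma picard_0 n i : picard n 0 i = x0 i.
Proof. destruct n; [reflexivity|]. simpl. rewrite RInt_point. unfold zero; simpl; ring. Qed.

(** The time-Lipschitz bound of iterate [n] makes the next integrand continuous; isolating this step
    lets that bound be proved by induction from the derivative it provides. *)
Lemma picard_derive_aux n :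
  (forall i s t, Rabs (picard n s i - picard n t i) <= M * Rabs (s - t)) ->
  forall i t, is_derive (fun t => picard (S n) t i) t (F (picard n t) i).
Proof.
  intros HX i.
  assert (HF : forall s t, Rabs (F (picard n s) i - F (picard n t) i) <= L * (M * Rabs (s - t))).
  { intros s t. apply F_lipschitz. intros j. apply HX. }
  assert (Hc : forall t, continuous (fun s => F (picard n s) i) t).
  { intros t. apply (continuous_of_lipschitz _ (L * M)).
    - generalize (F_bounded x0 i) (Rabs_pos (F x0 i)); nra.
    - intros y. rewrite Rmult_assoc. apply HF. }
  intros t. replace (F (picard n t) i) with (plus zero (F (picard n t) i)) by apply plus_zero_l.
  apply @is_derive_plus; [apply @is_derive_const|].
  apply (is_derive_RInt (fun s => F (picard n s) i) _ 0); [|apply Hc].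
  apply filter_forall. intros b. apply (RInt_correct (fun s => F (picard n s) i)).
  apply (ex_RInt_continuous (fun s => F (picard n s) i)). intros z _. apply Hc.
Qed.

Lemma picard_lipschitz n i s t : Rabs (picard n s i - picard n t i) <= M * Rabs (s - t).
Proof.
  revert i s t. induction n as [|n IH]; intros i s t.
  - simpl. rewrite Rminus_eq_0, Rabs_R0. apply Rmult_le_pos; [|apply Rabs_pos].
    generalize (F_bounded x0 i) (Rabs_pos (F x0 i)); lra.
  - apply (bounded_variation (fun t => picard (S n) t i) (fun t => F (picard n t) i)).
    intros r _. split; [now apply picard_derive_aux|apply F_bounded].
Qed.

Lemma is_derive_picard n i t : is_derive (fun t => picard (S n) t i) t (F (picard n t) i).
Proof. apply picard_derive_aux. intros; apply picard_lipschitz. Qed.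

(** With weight exponent 2 L, the Lipschitz constant costs L and integration gains 1 / (2 L), so
    each iteration halves the difference. The first difference is at most M |t|, which the weight
    dominates. *)
Lemma picard_step n i t :
  Rabs (picard (S n) t i - picard n t i) <= M / (2 * L) * (1/2) ^ n * exp (2 * L * Rabs t).
Proof.
  assert (HM : 0 <= M) by (generalize (F_bounded x0 i) (Rabs_pos (F x0 i)); lra).
  assert (HML : 0 <= M / (2 * L)) by (apply Rdiv_le_0_compat; lra).
  revert i t. induction n as [|n IH]; intros i t.
  - simpl (picard 0 t i). rewrite <- (picard_0 1 i). apply Rle_trans with (1 := picard_lipschitz 1 i t 0).
    rewrite Rminus_0_r, pow_O, Rmult_1_r.
    generalize (exp_ineq1_le (2 * L * Rabs t)); intros E.
    replace (M * Rabs t) with (M / (2 * L) * (2 * L * Rabs t)) by (field; lra).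
    apply Rmult_le_compat_l; lra.
  - apply (exp_growth_bound (fun t => picard (S (S n)) t i - picard (S n) t i)
      (fun t => F (picard (S n) t) i - F (picard n t) i)).
    + lra.
    + apply Rmult_le_pos; [assumption|apply pow_le; lra].
    + rewrite !picard_0; ring.
    + intros s. apply @is_derive_minus; apply is_derive_picard.
    + intros s. replace (M / (2 * L) * (1/2) ^ S n * (2 * L) * exp (2 * L * Rabs s)) with
        (L * (M / (2 * L) * (1/2) ^ n * exp (2 * L * Rabs s))) by (simpl; field; lra).
      apply F_lipschitz. intros j; apply IH.
Qed.

Lemma picard_cauchy N n m i t : (N <= n)%nat -> (N <= m)%nat ->
  Rabs (picard n t i - picard m t i) <= (1/2) ^ N * (4 * (M / (2 * L)) * exp (2 * L * Rabs t)).
Proof.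
  assert (HM : 0 <= M) by (generalize (F_bounded x0 i) (Rabs_pos (F x0 i)); lra).
  assert (HML : 0 <= M / (2 * L)) by (apply Rdiv_le_0_compat; lra).
  set (K := M / (2 * L) * exp (2 * L * Rabs t)).
  assert (HK : 0 <= K) by (apply Rmult_le_pos; [assumption|left; apply exp_pos]).
  assert (H : forall j, Rabs (picard (N + j) t i - picard N t i) <= 2 * K * (1/2) ^ N * (1 - (1/2) ^ j)).
  { induction j as [|j IH].
    - rewrite Nat.add_0_r, Rminus_eq_0, Rabs_R0; simpl; lra.
    - rewrite Nat.add_succ_r.
      replace (_ - _) with ((picard (S (N + j)) t i - picard (N + j) t i) + (picard (N + j) t i - picard N t i)) by ring.
      eapply Rle_trans; [apply Rabs_plus_le; [apply picard_step|apply IH]|].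
      rewrite pow_add. unfold K. simpl. lra. }
  intros Hn Hm.
  replace (picard n t i - picard m t i) with
    ((picard (N + (n - N)) t i - picard N t i) - (picard (N + (m - N)) t i - picard N t i))
    by (replace (N + (n - N))%nat with n by lia; replace (N + (m - N))%nat with m by lia; ring).
  eapply Rle_trans; [apply Rabs_minus_le; apply H|].
  assert (PN : 0 <= (1/2) ^ N) by (apply pow_le; lra).
  assert (Pn : 0 <= (1/2) ^ (n - N)) by (apply pow_le; lra).
  assert (Pm : 0 <= (1/2) ^ (m - N)) by (apply pow_le; lra).
  assert (0 <= K * (1/2) ^ N) by (apply Rmult_le_pos; assumption).
  replace (4 * (M / (2 * L)) * exp (2 * L * Rabs t)) with (4 * K) by (unfold K; ring). nra.
Qed.

(** In time the iterates have derivatives with the common Lipschitz constant L M. Their Taylor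
    inequality passes to the limit and yields the differential equation without exchanging a limit
    with an integral. *)
Theorem global_solution : exists X : R -> I -> R,
  (forall i, X 0 i = x0 i) /\ forall t i, is_derive (fun t => X t i) t (F (X t) i).
Proof.
  assert (Hr : forall c eta : R, 0 <= c -> 0 < eta -> exists N, (1/2) ^ N * c < eta).
  { intros c eta Hc Heta. destruct (pow_lt_1_zero (1/2)) with (y := eta / (c + 1)) as [N HN].
    - rewrite Rabs_pos_eq; lra.
    - apply Rdiv_lt_0_compat; lra.
    - exists N. specialize (HN N (Nat.le_refl N)). rewrite Rabs_pos_eq in HN by (apply pow_le; lra).
      apply Rle_lt_trans with ((1/2) ^ N * (c + 1)).
      + apply Rmult_le_compat_l; [apply pow_le|]; lra.
      + replace eta with (eta / (c + 1) * (c + 1)) by (field; lra).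
        apply Rmult_lt_compat_r; lra. }
  (* The sign of [M] is read off a value of [F], so it requires an index: [I] may be empty. *)
  assert (HB : forall i : I, 0 <= M).
  { intros i. generalize (F_bounded x0 i) (Rabs_pos (F x0 i)); lra. }
  assert (HC : forall (i : I) t, 0 <= 4 * (M / (2 * L)) * exp (2 * L * Rabs t)).
  { intros i t. apply Rmult_le_pos; [|left; apply exp_pos].
    assert (0 <= M / (2 * L)) by (apply Rdiv_le_0_compat; [now apply HB|lra]). lra. }
  assert (Hl : forall p : R * I, exists l : R, is_lim_seq (fun n => picard n (fst p) (snd p)) l).
  { intros [t i]. apply (ex_lim_cauchy_rate _ (fun N => (1/2) ^ N * (4 * (M / (2 * L)) * exp (2 * L * Rabs t)))).
    - intros N n m Hn Hm. now apply picard_cauchy.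
    - intros eta Heta. apply Hr; auto. }
  destruct (choice _ Hl) as [X' HX']. set (X := fun t i => X' (t, i)).
  assert (HX : forall t i, is_lim_seq (fun n => picard n t i) (X t i)) by (intros t i; apply (HX' (t, i))).
  assert (Hconv : forall n t i, Rabs (picard n t i - X t i) <= (1/2) ^ n * (4 * (M / (2 * L)) * exp (2 * L * Rabs t))).
  { intros n t i. apply (is_lim_seq_Rabs_le (fun m => picard n t i - picard m t i) _ _ n).
    - apply is_lim_seq_minus'; auto using is_lim_seq_const.
    - intros m Hm. now apply picard_cauchy. }
  exists X. split.
  - intros i. assert (E := is_lim_seq_unique _ _ (HX 0 i)).
    rewrite (Lim_seq_ext _ (fun _ => x0 i)), Lim_seq_const in E by (intros n; apply picard_0).
    injection E; auto.
  - intros t i. apply (is_derive_of_quadratic _ _ _ (L * M)). intros s.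
    apply (is_lim_seq_Rabs_le (fun n => picard (S n) s i - picard (S n) t i - F (picard n t) i * (s - t)) _ _ 0).
    + apply is_lim_seq_minus'; [apply is_lim_seq_minus'|].
      * apply (is_lim_seq_incr_1 (fun n => picard n s i)), HX.
      * apply (is_lim_seq_incr_1 (fun n => picard n t i)), HX.
      * apply (is_lim_seq_scal_r _ (s - t) (Finite (F (X t) i))).
        apply is_lim_seq_spec. intros eta.
        destruct (Hr (L * (4 * (M / (2 * L)) * exp (2 * L * Rabs t))) eta) as [N HN].
        -- apply Rmult_le_pos; [lra|auto].
        -- apply cond_pos.
        -- exists N. intros n Hn. apply Rle_lt_trans with (2 := HN).
           apply Rle_trans with (L * ((1/2) ^ n * (4 * (M / (2 * L)) * exp (2 * L * Rabs t)))).
           ++ apply F_lipschitz. intros j; apply Hconv.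
           ++ assert ((1/2) ^ n <= (1/2) ^ N).
              { replace n with (N + (n - N))%nat by lia. rewrite pow_add.
                assert (0 <= (1/2) ^ N) by (apply pow_le; lra).
                assert ((1/2) ^ (n - N) <= 1) by (apply Rle_trans with (1 ^ (n - N)); [apply pow_incr; lra|rewrite pow1; lra]). nra. }
              generalize (HC i t); intros Hc0.
              assert (0 <= L * (4 * (M / (2 * L)) * exp (2 * L * Rabs t))) by (apply Rmult_le_pos; lra). nra.
    + intros n _.
      apply (taylor_of_lipschitz_derivative (L * M) (fun t => picard (S n) t i) (fun t => F (picard n t) i)).
      * generalize (HB i); nra.
      * intros; apply is_derive_picard.
      * intros x y. rewrite Rmult_assoc. apply F_lipschitz. intros j; apply picard_lipschitz.
Qed.

End Picard.

(** * Differential inequalities and derivatives of pairs *)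

(** The integrating factor exp (- k (x - a)) makes f nonincreasing. The rate [k] may be negative,
    and the exponential attraction uses it that way. *)
Lemma gronwall (f df : R -> R) k a b :
  a <= b -> (forall x, a <= x <= b -> is_derive f x (df x) /\ df x <= k * f x) ->
  f b <= f a * exp (k * (b - a)).
Proof.
  intros Hab H.
  assert (E : - (f a * exp (- k * (a - a))) <= - (f b * exp (- k * (b - a)))).
  { apply (le_of_derive_nonneg (fun x => - (f x * exp (- k * (x - a))))
      (fun x => - (df x * exp (- k * (x - a)) + f x * (- k * exp (- k * (x - a)))))); [assumption|].
    intros x Hx. destruct (H x Hx) as [H1 H2]. split.
    - apply @is_derive_opp. apply (is_derive_mult f (fun x => exp (- k * (x - a)))); [exact H1| |intros; apply Rmult_comm].
      auto_derive; [exact Logic.I|unfold Rminus; ring].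
    - generalize (exp_pos (- k * (x - a))). intros. nra. }
  rewrite Rminus_eq_0, Rmult_0_r, exp_0 in E.
  replace (- k * (b - a)) with (- (k * (b - a))) in E by ring. rewrite exp_Ropp in E.
  assert (P := exp_pos (k * (b - a))).
  apply (Rmult_le_reg_r (/ exp (k * (b - a)))); [now apply Rinv_0_lt_compat|].
  rewrite Rmult_assoc, Rinv_r by lra. lra.
Qed.

(** The two-sided bound on [df] allows time to be reversed, so vanishing propagates to the past as
    well; uniqueness and invariance both need the past. *)
Lemma gronwall_zero (f df : R -> R) k t :
  (forall x, Rmin 0 t <= x <= Rmax 0 t -> is_derive f x (df x) /\ 0 <= f x /\ Rabs (df x) <= k * f x) ->
  f 0 = 0 -> f t = 0.
Proof.
  intros H F0. apply Rle_antisym; [|apply H; split; [apply Rmin_r|apply Rmax_r]].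
  destruct (Rle_dec 0 t) as [Ht|Ht].
  - rewrite Rmin_left, Rmax_right in H by assumption.
    replace 0 with (f 0 * exp (k * (t - 0))) by (rewrite F0; ring).
    apply gronwall with df; [assumption|]. intros x Hx. destruct (H x Hx) as (H1 & H2 & H3).
    split; [exact H1|]. generalize (Rle_abs (df x)); lra.
  - rewrite Rmin_right, Rmax_left in H by lra.
    rewrite <- (Ropp_involutive t).
    replace 0 with (f (- 0) * exp (k * (- t - 0))) by (rewrite Ropp_0, F0; ring).
    apply (gronwall (fun x => f (- x)) (fun x => - df (- x))); [lra|]. intros x Hx.
    destruct (H (- x)) as (H1 & H2 & H3); [lra|]. split.
    + replace (- df (- x)) with (scal (-1) (df (- x))) by (unfold scal; simpl; unfold mult; simpl; ring).
      apply (is_derive_comp f (fun s => - s)); [exact H1|]. auto_derive; [exact Logic.I|ring].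
    + generalize (Rle_abs (- df (- x))). rewrite Rabs_Ropp. lra.
Qed.

Lemma is_derive_pos_part_sq x : is_derive (fun x => Rmax x 0 ^ 2) x (2 * Rmax x 0).
Proof.
  apply (is_derive_of_quadratic _ _ _ 1). intros y.
  apply Rabs_le. assert (0 <= (y - x) * (y - x)) by apply Rle_0_sqr.
  assert (0 <= x * x) by apply Rle_0_sqr. assert (0 <= y * y) by apply Rle_0_sqr.
  unfold Rmax; repeat destruct Rle_dec; split; try (assert (x * y <= 0) by nra); nra.
Qed.

(** The square of the positive part of f - c is differentiable, and its derivative is nonpositive
    because [df] has a sign wherever f >= c. This replaces an argument by first exit times. *)
Lemma barrier (f df : R -> R) c :
  (forall t, 0 <= t -> is_derive f t (df t) /\ (c <= f t -> df t <= 0)) ->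
  f 0 <= c -> forall t, 0 <= t -> f t <= c.
Proof.
  intros H F0 t Ht.
  assert (E : - Rmax (f 0 - c) 0 ^ 2 <= - Rmax (f t - c) 0 ^ 2).
  { apply (le_of_derive_nonneg (fun x => - Rmax (f x - c) 0 ^ 2)
      (fun x => - (df x * (2 * Rmax (f x - c) 0)))); [assumption|].
    intros x Hx. destruct (H x (proj1 Hx)) as [H1 H2]. split.
    - apply @is_derive_opp.
      apply (is_derive_comp (fun y => Rmax y 0 ^ 2) (fun x => f x - c)); [apply is_derive_pos_part_sq|].
      replace (df x) with (minus (df x) zero) by (unfold minus, plus, opp, zero; simpl; ring).
      apply @is_derive_minus; [exact H1|apply @is_derive_const].
    - unfold Rmax; destruct Rle_dec; [lra|]. assert (df x <= 0) by (apply H2; lra). nra. }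
  rewrite (Rmax_right (f 0 - c) 0) in E by lra.
  unfold Rmax in E; destruct Rle_dec; [lra|]. nra.
Qed.

Lemma filterdiff_pair {T U V : NormedModule R_AbsRing} (f : T -> U) (g : T -> V) x lf lg :
  filterdiff f (locally x) lf -> filterdiff g (locally x) lg ->
  filterdiff (fun y => (f y, g y) : prod_NormedModule R_AbsRing U V) (locally x) (fun y => (lf y, lg y)).
Proof.
  intros Hf Hg.
  apply (filterdiff_comp'_2 f g (fun a b => (a, b) : prod_NormedModule R_AbsRing U V) x lf lg (fun a b => (a, b)) Hf Hg).
  apply filterdiff_linear. apply is_linear_prod; [apply is_linear_fst|apply is_linear_snd].
Qed.

Lemma filterdiff_fst {T U V : NormedModule R_AbsRing} (f : T -> prod_NormedModule R_AbsRing U V) x lf :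
  filterdiff f (locally x) lf -> filterdiff (fun y => fst (f y)) (locally x) (fun y => fst (lf y)).
Proof.
  intros Hf. apply (filterdiff_comp' f (fun p : prod_NormedModule R_AbsRing U V => fst p) x lf (fun p => fst p) Hf).
  apply filterdiff_linear, is_linear_fst.
Qed.

Lemma filterdiff_snd {T U V : NormedModule R_AbsRing} (f : T -> prod_NormedModule R_AbsRing U V) x lf :
  filterdiff f (locally x) lf -> filterdiff (fun y => snd (f y)) (locally x) (fun y => snd (lf y)).
Proof.
  intros Hf. apply (filterdiff_comp' f (fun p : prod_NormedModule R_AbsRing U V => snd p) x lf (fun p => snd p) Hf).
  apply filterdiff_linear, is_linear_snd.
Qed.

Lemma is_derive_pair {U V : NormedModule R_AbsRing} (f : R -> U) (g : R -> V) t df dg :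
  is_derive f t df -> is_derive g t dg ->
  is_derive (fun t => (f t, g t) : prod_NormedModule R_AbsRing U V) t (df, dg).
Proof. intros Hf Hg. exact (filterdiff_pair f g t _ _ Hf Hg). Qed.

Lemma is_derive_fst {U V : NormedModule R_AbsRing} (f : R -> prod_NormedModule R_AbsRing U V) t df :
  is_derive f t df -> is_derive (fun t => fst (f t)) t (fst df).
Proof. intros Hf. exact (filterdiff_fst f t _ Hf). Qed.

Lemma is_derive_snd {U V : NormedModule R_AbsRing} (f : R -> prod_NormedModule R_AbsRing U V) t df :
  is_derive f t df -> is_derive (fun t => snd (f t)) t (snd df).
Proof. intros Hf. exact (filterdiff_snd f t _ Hf). Qed.

(** * Unit complex numbers and differentials in polar form *)

Definition cis (t : R) : C := (cos t, sin t).

Lemma cis_plus a b : cis (a + b) = (cis a * cis b)%C.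
Proof. unfold cis, Cmult; simpl. rewrite cos_plus, sin_plus. f_equal; ring. Qed.

Lemma cis_opp a : cis (- a) = Cconj (cis a).
Proof. unfold cis, Cconj; simpl. now rewrite cos_neg, sin_neg. Qed.

Lemma cis_0 : cis 0 = 1.
Proof. unfold cis. now rewrite cos_0, sin_0. Qed.

Lemma Cmod_cis a : Cmod (cis a) = 1.
Proof.
  unfold Cmod, cis; simpl. apply eq_trans with (sqrt 1); [f_equal|apply sqrt_1].
  generalize (sin2_cos2 a); unfold Rsqr; lra.
Qed.

Lemma cis_eq_1 a : (cis a * cis (- a) = 1)%C.
Proof. rewrite <- cis_plus, <- cis_0. f_equal; ring. Qed.

Lemma filterdiff_comp_derive {U : NormedModule R_AbsRing} (phi : R -> R) (u : U -> R) x lu l :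
  filterdiff u (locally x) lu -> is_derive phi (u x) l ->
  filterdiff (fun y => phi (u y)) (locally x) (fun v => lu v * l).
Proof.
  intros Hu Hphi. exact (filterdiff_comp' u phi x lu (fun v => scal v l) Hu Hphi).
Qed.

Lemma filterdiff_Rmult {U : NormedModule R_AbsRing} (f g : U -> R) x lf lg :
  filterdiff f (locally x) lf -> filterdiff g (locally x) lg ->
  filterdiff (fun y => f y * g y) (locally x) (fun v => lf v * g x + f x * lg v).
Proof. intros Hf Hg. exact (filterdiff_mult_fct f g x lf lg Rmult_comm Hf Hg). Qed.

(** This is the logarithmic derivative: rho exp (u + i th) has as differential itself times du + i
    dth, the complex number written here as a pair. *)
Lemma filterdiff_polar {U : NormedModule R_AbsRing} (rho : R) (u th : U -> R) x lu lth :
  filterdiff u (locally x) lu -> filterdiff th (locally x) lth ->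
  filterdiff (fun y => (RtoC (rho * exp (u y)) * cis (th y))%C : C_R_NormedModule) (locally x)
    (fun v => ((RtoC (rho * exp (u x)) * cis (th x)) * (lu v, lth v))%C).
Proof.
  intros Hu Hth.
  assert (He : filterdiff (fun y => rho * exp (u y)) (locally x) (fun v => lu v * (rho * exp (u x)))).
  { apply (filterdiff_comp_derive (fun t => rho * exp t)); [exact Hu|].
    apply is_derive_scal, is_derive_exp. }
  assert (Hc := filterdiff_Rmult _ _ _ _ _ He (filterdiff_comp_derive cos th x lth _ Hth (is_derive_cos _))).
  assert (Hs := filterdiff_Rmult _ _ _ _ _ He (filterdiff_comp_derive sin th x lth _ Hth (is_derive_sin _))).
  assert (H := filterdiff_pair (U := R_NormedModule) (V := R_NormedModule) _ _ _ _ _ Hc Hs).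
  eapply filterdiff_ext_lin.
  - apply filterdiff_ext with (2 := H). intros y. apply injective_projections; simpl; ring.
  - intros v. apply injective_projections; simpl; ring.
Qed.

Lemma is_derive_polar (rho : R) (u th : R -> R) t du dth :
  is_derive u t du -> is_derive th t dth ->
  is_derive (fun t => (RtoC (rho * exp (u t)) * cis (th t))%C : C_R_NormedModule) t
    ((RtoC (rho * exp (u t)) * cis (th t)) * (du, dth))%C.
Proof.
  intros Hu Hth. eapply filterdiff_ext_lin.
  - exact (filterdiff_polar rho u th t _ _ Hu Hth).
  - intros v. unfold scal; simpl. unfold prod_scal, scal; simpl. unfold mult; simpl.
    apply injective_projections; simpl; ring.
Qed.

(** * Uniqueness of solutions *)

Lemma norm_C (z : C_R_NormedModule) : norm z = Cmod z.
Proof.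
  unfold Cmod. change (sqrt (Rabs (fst z) ^ 2 + Rabs (snd z) ^ 2) = sqrt (fst z ^ 2 + snd z ^ 2)).
  now rewrite !pow2_abs.
Qed.

Lemma Cmod_fst_le_norm (p q : C2) : Cmod (fst p - fst q)%C <= norm (minus p q).
Proof.
  rewrite <- norm_C. apply (norm_le_prod_norm_1 (minus p q)).
Qed.

Lemma Cmod_snd_le_norm (p q : C2) : Cmod (snd p - snd q)%C <= norm (minus p q).
Proof.
  rewrite <- norm_C. apply (norm_le_prod_norm_2 (minus p q)).
Qed.

Lemma norm_C2_le (p q : C2) A B :
  Cmod (fst p - fst q)%C <= A -> Cmod (snd p - snd q)%C <= B -> norm (minus p q) <= A + B.
Proof.
  intros HA HB.
  set (x := (fst p - fst q)%C) in *. set (y := (snd p - snd q)%C) in *.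
  change (norm (minus p q)) with (sqrt (norm (x : C_R_NormedModule) ^ 2 + norm (y : C_R_NormedModule) ^ 2)).
  rewrite !norm_C. assert (X := Cmod_ge_0 x). assert (Y := Cmod_ge_0 y).
  apply Rle_trans with (Cmod x + Cmod y); [|lra].
  rewrite <- (sqrt_pow2 (Cmod x + Cmod y)) by lra. apply sqrt_le_1; nra.
Qed.

Lemma Rabs_Im_le (z : C) : Rabs (Im z) <= Cmod z.
Proof. eapply Rle_trans; [apply Rmax_r|apply (Rmax_Cmod z)]. Qed.

Lemma Cmod_le_Re_Im (z : C) A B : Rabs (Re z) <= A -> Rabs (Im z) <= B -> Cmod z <= A + B.
Proof.
  intros HA HB. assert (X := Rabs_pos (Re z)). assert (Y := Rabs_pos (Im z)).
  rewrite <- (sqrt_pow2 (A + B)) by lra. unfold Cmod. unfold Re, Im in *.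
  rewrite <- (pow2_abs (fst z)), <- (pow2_abs (snd z)). apply sqrt_le_1; nra.
Qed.

Definition coord (i : bool * bool) (p : C2) : R :=
  let z := if fst i then fst p else snd p in if snd i then Re z else Im z.

Lemma coord_ext (p q : C2) : (forall i, coord i p = coord i q) -> p = q.
Proof.
  intros H. destruct p as [[a b] [c d]], q as [[a' b'] [c' d']].
  assert (H1 := H (true, true)). assert (H2 := H (true, false)).
  assert (H3 := H (false, true)). assert (H4 := H (false, false)).
  unfold coord, Re, Im in *; simpl in *. now subst.
Qed.

Lemma Rabs_coord_le i (p : C2) : Rabs (coord i p) <= norm p.
Proof.
  destruct i as [[] []]; unfold coord; simpl.
  - apply Rle_trans with (Cmod (fst p)); [apply re_le_Cmod|]. rewrite <- norm_C. apply (norm_le_prod_norm_1 p).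
  - apply Rle_trans with (Cmod (fst p)); [apply Rabs_Im_le|]. rewrite <- norm_C. apply (norm_le_prod_norm_1 p).
  - apply Rle_trans with (Cmod (snd p)); [apply re_le_Cmod|]. rewrite <- norm_C. apply (norm_le_prod_norm_2 p).
  - apply Rle_trans with (Cmod (snd p)); [apply Rabs_Im_le|]. rewrite <- norm_C. apply (norm_le_prod_norm_2 p).
Qed.

Lemma is_derive_coord (z : R -> C2) t dz i :
  is_derive z t dz -> is_derive (fun t => coord i (z t)) t (coord i dz).
Proof.
  intros H. destruct i as [[] []]; unfold coord, Re, Im; simpl.
  - apply (is_derive_fst (U := R_NormedModule) (V := R_NormedModule) (fun t => fst (z t))).
    exact (is_derive_fst (U := C_R_NormedModule) (V := C_R_NormedModule) z t dz H).
  - apply (is_derive_snd (U := R_NormedModule) (V := R_NormedModule) (fun t => fst (z t))).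
    exact (is_derive_fst (U := C_R_NormedModule) (V := C_R_NormedModule) z t dz H).
  - apply (is_derive_fst (U := R_NormedModule) (V := R_NormedModule) (fun t => snd (z t))).
    exact (is_derive_snd (U := C_R_NormedModule) (V := C_R_NormedModule) z t dz H).
  - apply (is_derive_snd (U := R_NormedModule) (V := R_NormedModule) (fun t => snd (z t))).
    exact (is_derive_snd (U := C_R_NormedModule) (V := C_R_NormedModule) z t dz H).
Qed.

Lemma in_algebra_sqmod {X} (K : (X -> R) -> Prop) (SA : smooth_algebra K) f :
  in_algebra K f -> in_algebra K (fun x => sqmod (f x)).
Proof.
  intros H. replace (fun x => sqmod (f x)) with (fun x => (f x * Cconj (f x))%C).
  - apply in_algebra_mult; [assumption..|]. now apply in_algebra_conj.
  - apply functional_extensionality; intros x. unfold sqmod. rewrite <- Cmod2_conj. reflexivity.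
Qed.

Section Uniqueness.

Variables (omega : R) (a01 a0 a1 a2 a3 b0 b1 b2 b3 : C) (lambda eps : R).

Local Notation F := (coupled omega a01 a0 a1 a2 a3 b0 b1 b2 b3 lambda eps).

(** The field is a polynomial in the coordinates and their conjugates, so its real and imaginary
    parts belong to the algebra of bounded Lipschitz functions for the relation that confines both
    points to the ball. *)
Lemma coupled_lipschitz_on_ball B : exists M, 0 <= M /\ forall p q d, 0 <= d ->
  (forall i, Rabs (coord i p) <= B) -> (forall i, Rabs (coord i q) <= B) ->
  (forall i, Rabs (coord i p - coord i q) <= d) ->
  forall i, Rabs (coord i (F p) - coord i (F q)) <= M * d.
Proof.
  set (E := fun (p q : C2) d => (forall i, Rabs (coord i p) <= B) /\
    (forall i, Rabs (coord i q) <= B) /\ (forall i, Rabs (coord i p - coord i q) <= d)).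
  assert (SA := bounded_lipschitz_algebra E).
  assert (H : forall i, bounded_lipschitz E (coord i)).
  { intros i. exists (Rabs B + 1). split; [generalize (Rabs_pos B); lra|].
    intros p q d (H1 & H2 & H3) Hd. specialize (H1 i). specialize (H2 i). specialize (H3 i).
    generalize (Rle_abs B) (Rabs_pos B). intros.
    assert (0 <= Rabs B * d) by (apply Rmult_le_pos; lra). split; [lra|split; lra]. }
  assert (Hz : in_algebra (bounded_lipschitz E) (fun p : C2 => fst p : C)) by exact (conj (H (true, true)) (H (true, false))).
  assert (Hw : in_algebra (bounded_lipschitz E) (fun p : C2 => snd p : C)) by exact (conj (H (false, true)) (H (false, false))).
  assert (O : forall z w : C2 -> C, in_algebra (bounded_lipschitz E) z -> in_algebra (bounded_lipschitz E) w ->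
    in_algebra (bounded_lipschitz E) (fun p => oscillator omega a01 a0 a1 a2 a3 b0 b1 b2 b3 lambda eps (z p) (w p))).
  { intros z w Az Aw. unfold oscillator.
    repeat first [exact Az | exact Aw | apply (in_algebra_plus _ SA) | apply (in_algebra_mult _ SA)
      | apply (in_algebra_conj _ SA) | apply (in_algebra_sqmod _ SA) | apply (in_algebra_const _ SA)]. }
  destruct (O _ _ Hz Hw) as [[M1 [P1 H1]] [M2 [P2 H2]]].
  destruct (O _ _ Hw Hz) as [[M3 [P3 H3]] [M4 [P4 H4]]].
  exists (M1 + M2 + M3 + M4). split; [lra|]. intros p q d Hd Hp Hq Hpq i.
  assert (HE : E p q d) by (repeat split; assumption).
  destruct (H1 p q d HE Hd) as (_ & _ & K1). destruct (H2 p q d HE Hd) as (_ & _ & K2).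
  destruct (H3 p q d HE Hd) as (_ & _ & K3). destruct (H4 p q d HE Hd) as (_ & _ & K4).
  assert (0 <= M1 * d) by (apply Rmult_le_pos; lra). assert (0 <= M2 * d) by (apply Rmult_le_pos; lra).
  assert (0 <= M3 * d) by (apply Rmult_le_pos; lra). assert (0 <= M4 * d) by (apply Rmult_le_pos; lra).
  destruct i as [[] []]; (eapply Rle_trans; [first [exact K1|exact K2|exact K3|exact K4]|lra]).
Qed.

(** Both solutions are bounded on the compact interval between 0 and t, so one Lipschitz constant M
    serves there, and the squared distance f satisfies |f'| <= 8 M f, each of the four coordinates
    contributing 2 M f. *)
Lemma solution_unique (z w : R -> C2) t :
  (forall x, Rmin 0 t <= x <= Rmax 0 t -> is_derive z x (F (z x))) ->
  (forall x, Rmin 0 t <= x <= Rmax 0 t -> is_derive w x (F (w x))) ->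
  z 0 = w 0 -> z t = w t.
Proof.
  intros Hz Hw H0.
  destruct (bounded_continuity z (Rmin 0 t) (Rmax 0 t)) as [B1 HB1].
  { intros x Hx. apply (ex_derive_continuous z x). exists (F (z x)). now apply Hz. }
  destruct (bounded_continuity w (Rmin 0 t) (Rmax 0 t)) as [B2 HB2].
  { intros x Hx. apply (ex_derive_continuous w x). exists (F (w x)). now apply Hw. }
  destruct (coupled_lipschitz_on_ball (Rmax B1 B2)) as (M & HM & HL).
  set (df := fun i x => coord i (z x) - coord i (w x)).
  set (dd := fun i x => coord i (F (z x)) - coord i (F (w x))).
  set (f := fun x => df (true, true) x ^ 2 + df (true, false) x ^ 2 + df (false, true) x ^ 2 + df (false, false) x ^ 2).
  set (g := fun x => 2 * df (true, true) x * dd (true, true) x + 2 * df (true, false) x * dd (true, false) x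
    + 2 * df (false, true) x * dd (false, true) x + 2 * df (false, false) x * dd (false, false) x).
  assert (E : f t = 0).
  { apply (gronwall_zero f g (8 * M)).
    - intros x Hx.
      assert (D : forall i, is_derive (df i) x (dd i x)).
      { intros i. apply @is_derive_minus; apply is_derive_coord; auto. }
      assert (D2 : forall i, is_derive (fun x => df i x ^ 2) x (2 * df i x * dd i x)).
      { intros i. evar_last; [apply (is_derive_pow (df i)), D|]. simpl; ring. }
      split; [|split].
      + unfold f, g. repeat apply @is_derive_plus; apply D2.
      + unfold f. nra.
      + assert (Hi : forall i, df i x ^ 2 <= f x) by (intros [[] []]; unfold f; nra).
        assert (f0 : 0 <= f x) by (unfold f; nra).
        assert (Hs : forall i, Rabs (df i x) <= sqrt (f x)).
        { intros i. rewrite <- sqrt_Rsqr_abs. apply sqrt_le_1; [apply Rle_0_sqr|exact f0|].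
          unfold Rsqr. generalize (Hi i). simpl. lra. }
        assert (Hd : forall i, Rabs (dd i x) <= M * sqrt (f x)).
        { apply HL; [apply sqrt_pos| | |exact Hs].
          - intros i. eapply Rle_trans; [apply Rabs_coord_le|]. eapply Rle_trans; [left; now apply HB1|apply Rmax_l].
          - intros i. eapply Rle_trans; [apply Rabs_coord_le|]. eapply Rle_trans; [left; now apply HB2|apply Rmax_r]. }
        assert (P : forall i, Rabs (2 * df i x * dd i x) <= 2 * (M * f x)).
        { intros i. eapply Rle_trans.
          - apply Rabs_mult_le; [apply Rabs_mult_le; [rewrite Rabs_pos_eq; [apply Rle_refl|lra]|apply Hs]|apply Hd].
          - rewrite <- (sqrt_sqrt (f x)) at 3 by exact f0. right; ring. }
        unfold g. eapply Rle_trans.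
        { repeat (apply Rabs_plus_le; [|apply P]). apply P. }
        lra.
    - unfold f, df. rewrite H0. ring. }
  apply coord_ext. intros i.
  assert (df i t = 0); [|unfold df in *; lra].
  unfold f in E. destruct i as [[] []]; nra.
Qed.

End Uniqueness.

Lemma continuous_algebra {U : UniformSpace} (x : U) : smooth_algebra (fun f : U -> R => continuous f x).
Proof.
  split.
  - intros c. apply continuous_const.
  - intros f g Hf Hg. now apply @continuous_plus.
  - intros f g Hf Hg. now apply @continuous_mult.
  - intros f Hf. apply (continuous_comp f exp); [exact Hf|]. apply continuous_exp.
  - intros f Hf. apply (continuous_comp f sin); [exact Hf|]. apply continuous_sin.
  - intros f Hf. apply (continuous_comp f cos); [exact Hf|]. apply continuous_cos.
Qed.

Lemma continuous_pair {U V W : UniformSpace} (f : U -> V) (g : U -> W) x :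
  continuous f x -> continuous g x -> continuous (fun y => (f y, g y) : prod_UniformSpace V W) x.
Proof.
  intros Hf Hg. apply filterlim_locally. intros e.
  apply filterlim_locally with (eps := e) in Hf. apply filterlim_locally with (eps := e) in Hg.
  generalize (filter_and _ _ Hf Hg). apply filter_imp. intros y [H1 H2]. now split.
Qed.

Lemma continuous_epsilon_delta {U : NormedModule R_AbsRing} (f : U -> R) x e :
  continuous f x -> 0 < e ->
  exists d, 0 < d /\ forall y, norm (minus y x) < d -> Rabs (f y - f x) < e.
Proof.
  intros Hf He. apply filterlim_locally with (eps := mkposreal e He) in Hf.
  destruct (locally_norm_le_locally x _ Hf) as [d Hd].
  exists d. split; [apply cond_pos|]. intros y Hy. now apply (Hd y).
Qed.

(** * Polar coordinates *)

(** A branch with a jump across the negative real axis. The jump is harmless because its values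
    enter only through [cis] and through functions of period 2 pi. *)
Definition arg (z : C) : R :=
  if Rle_dec 0 (Im z) then acos (Re z / Cmod z) else - acos (Re z / Cmod z).

Lemma Cmod_Re_Im (z : C) : Cmod z * Cmod z = Re z * Re z + Im z * Im z.
Proof. generalize (Cmod2_alt z). simpl. lra. Qed.

Lemma polar_form (z : C) : z = (RtoC (Cmod z) * cis (arg z))%C.
Proof.
  destruct (Ceq_dec z 0) as [->|N].
  { rewrite Cmod_0. ring. }
  apply Cmod_gt_0 in N. assert (M := Cmod_Re_Im z).
  assert (Hr := re_le_Cmod z). apply Rabs_le_between in Hr.
  set (m := Cmod z) in *. set (x := Re z / m).
  assert (Hx : -1 <= x <= 1).
  { unfold x. split; apply (Rmult_le_reg_r m); try assumption;
      (replace (Re z / m * m) with (Re z) by (field; lra)); lra. }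
  assert (Hc : cos (arg z) = x).
  { unfold arg. fold m x. destruct Rle_dec; [|rewrite cos_neg]; now apply cos_acos. }
  assert (Hsq : sqrt (1 - x²) = Rabs (Im z / m)).
  { rewrite <- sqrt_Rsqr_abs. f_equal. unfold x, Rsqr.
    replace (1 - Re z / m * (Re z / m)) with ((m * m - Re z * Re z) / (m * m)) by (field; lra).
    replace (m * m - Re z * Re z) with (Im z * Im z) by lra. field. lra. }
  assert (Hs : sin (arg z) = Im z / m).
  { unfold arg. fold m x. destruct Rle_dec as [H|H].
    - rewrite sin_acos, Hsq by assumption. apply Rabs_pos_eq. apply Rdiv_le_0_compat; lra.
    - rewrite sin_neg, sin_acos, Hsq by assumption. rewrite Rabs_left; [ring|].
      replace (Im z / m) with (- (- Im z / m)) by (field; lra).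
      assert (0 < - Im z / m) by (apply Rdiv_lt_0_compat; lra). lra. }
  unfold cis. rewrite Hc, Hs. destruct z as [a b]. unfold x, RtoC, Cmult, Re, Im in *; simpl in *.
  apply injective_projections; simpl; field; lra.
Qed.

Lemma cis_inj_mod a b : cis a = cis b -> exists k : Z, a = b + IZR k * (2 * PI).
Proof.
  intros H. assert (Hc : cos a = cos b) by exact (f_equal fst H).
  assert (Hs : sin a = sin b) by exact (f_equal snd H).
  assert (E : cos (a - b) = 1).
  { rewrite cos_minus, Hc, Hs. generalize (sin2_cos2 b). unfold Rsqr. lra. }
  assert (S : sin ((a - b) / 2) = 0).
  { replace (a - b) with (2 * ((a - b) / 2)) in E by field. rewrite cos_2a_sin in E.
    assert (sin ((a - b) / 2) * sin ((a - b) / 2) = 0) by lra.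
    destruct (Rmult_integral _ _ H0); assumption. }
  destruct (sin_eq_0_0 _ S) as [k Hk]. exists k. lra.
Qed.

Lemma periodic_nat s n : periodic s -> forall x, s (x + INR n * (2 * PI)) = s x.
Proof.
  intros H x. induction n as [|n IH].
  - simpl. f_equal. ring.
  - rewrite S_INR, <- IH, <- (H (x + INR n * (2 * PI))). f_equal. ring.
Qed.

Lemma periodic_Z s k : periodic s -> forall x, s (x + IZR k * (2 * PI)) = s x.
Proof.
  intros H x. destruct (Z_le_dec 0 k) as [Hk|Hk].
  - rewrite <- (Z2Nat.id k), <- INR_IZR_INZ by assumption. now apply periodic_nat.
  - rewrite <- (periodic_nat s (Z.to_nat (- k)) H (x + _)). f_equal.
    rewrite INR_IZR_INZ, Z2Nat.id by lia. rewrite opp_IZR. ring.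
Qed.

Lemma Rabs_atan_le t : Rabs (atan t) <= Rabs t.
Proof.
  replace (atan t) with (atan t - atan 0) by (rewrite atan_0; ring).
  replace (Rabs t) with (1 * Rabs (t - 0)) by (rewrite Rminus_0_r; ring).
  apply (bounded_variation atan (fun x => / (1 + x²))). intros x _. split; [apply is_derive_atan|].
  assert (0 <= x²) by apply Rle_0_sqr.
  rewrite Rabs_pos_eq by (left; apply Rinv_0_lt_compat; lra).
  rewrite <- Rinv_1. apply Rinv_le_contravar; lra.
Qed.

(** The real part of w is at least 1/2, so atan (Im w / Re w) is an angle of w of size at most 2
    tau. Applied to a quotient of nearby points, it gives a small change of angle wherever the jump
    of [arg] lies. *)
Lemma polar_near_1 (w : C) tau : Cmod (w - 1)%C <= tau -> tau <= 1/2 ->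
  exists al, w = (RtoC (Cmod w) * cis al)%C /\ Rabs al <= 2 * tau.
Proof.
  intros Hw Ht. assert (H1 := re_le_Cmod (w - 1)%C). assert (H2 := Rabs_Im_le (w - 1)%C).
  assert (M := Cmod_Re_Im w). assert (Mp := Cmod_ge_0 w).
  destruct w as [a b]. unfold Re, Im in *; simpl in *. set (m := Cmod (a, b)) in *.
  rewrite Ropp_0, Rplus_0_r in H2.
  assert (Ha : Rabs (a + - (1)) <= tau) by lra. apply Rabs_le_between in Ha.
  set (t := b / a). assert (Hbt : b = t * a) by (unfold t; field; lra).
  exists (atan t). split.
  - assert (Hs : 0 < sqrt (1 + t²)) by (apply sqrt_lt_R0; generalize (Rle_0_sqr t); lra).
    assert (Hm : m = a * sqrt (1 + t²)).
    { apply Rsqr_inj; [assumption|apply Rmult_le_pos; lra|]. unfold Rsqr.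
      replace (a * sqrt (1 + t * t) * (a * sqrt (1 + t * t))) with (a * a * (sqrt (1 + t * t) * sqrt (1 + t * t))) by ring.
      rewrite sqrt_sqrt by nra. rewrite M, Hbt. ring. }
    unfold cis. rewrite cos_atan, sin_atan, Hm.
    apply injective_projections; simpl; rewrite ?Hbt; field; lra.
  - apply Rle_trans with (1 := Rabs_atan_le t). unfold t.
    rewrite Rabs_div, (Rabs_pos_eq a) by lra.
    apply (Rmult_le_reg_r a); [lra|]. replace (Rabs b / a * a) with (Rabs b) by (field; lra). nra.
Qed.

(** * The system in isochronous coordinates *)

Section ReducedSystem.

Variables (omega : R) (a01 a0 a1 a2 a3 b0 b1 b2 b3 : C) (lambda : R).
Hypothesis (ha01 : Re a01 < 0) (hlambda : 0 < lambda).

Definition rsq : R := - lambda / Re a01.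
Definition radius : R := sqrt rsq.
(** The ratio of angular to logarithmic radial response to |z|^2: subtracting [twist] times ln |z|
    from arg z removes |z|^2, leaving the constant speed omega - twist lambda. Level sets of this
    phase are the isochrons. *)
Definition twist : R := Im a01 / Re a01.

(* The perturbation of z1 divided by z1, as a function of u_j = ln (|z_j| / r) and of the cosine and
   sine of the difference of the isochronous phases psi_j = arg z_j - twist * u_j. *)
Definition pert (u1 u2 cf sf : R) : C :=
  let w := twist * (u1 - u2) in
  let e : C := (cf * cos w - sf * sin w, sf * cos w + cf * sin w) in
  let n1 := RtoC (rsq * (exp u1 * exp u1)) in
  let n2 := RtoC (rsq * (exp u2 * exp u2)) in
  let n12 := RtoC (rsq * (exp u1 * exp u2)) in
  (a0 + a1 * n1 + a2 * n2 + a3 * (n12 * e)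
   + (RtoC (exp u2 * exp (- u1)) * Cconj e) * (b0 + b1 * n1 + b2 * n2 + b3 * (n12 * Cconj e)))%C.

(** [pert] is the contribution to z' / z = u' + i (arg z)'. With psi = arg z - twist u and 1 + y =
    exp (-2 u), the chain rule gives this rate for psi and the next one for y. *)
Definition phase_pert (u1 u2 cf sf : R) : R :=
  Im (pert u1 u2 cf sf) - twist * Re (pert u1 u2 cf sf).
Definition radial_pert (u1 u2 cf sf : R) : R :=
  -2 * (exp (-2 * u1) * Re (pert u1 u2 cf sf)).

Definition phase_rate (y1 y2 f : R) : R := phase_pert (logmod y1) (logmod y2) (cos f) (sin f).
Definition radial_rate (y1 y2 f : R) : R := radial_pert (logmod y1) (logmod y2) (cos f) (sin f).
Definition diff_rate (y1 y2 f : R) : R := phase_rate y1 y2 f - phase_rate y2 y1 (- f).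

Lemma pert_in_algebra {X} (K : (X -> R) -> Prop) (SA : smooth_algebra K) u1 u2 cf sf :
  K u1 -> K u2 -> K cf -> K sf -> in_algebra K (fun x => pert (u1 x) (u2 x) (cf x) (sf x)).
Proof.
  intros H1 H2 Hc Hs. unfold pert.
  assert (E1 : K (fun x => exp (u1 x))) by now apply (sa_exp _ SA).
  assert (E2 : K (fun x => exp (u2 x))) by now apply (sa_exp _ SA).
  assert (E3 : K (fun x => exp (- u1 x))) by (apply (sa_exp _ SA); now apply sa_opp).
  assert (HR : K (fun _ => rsq)) by apply (sa_const _ SA).
  assert (W : K (fun x => twist * (u1 x - u2 x))).
  { apply (sa_mult _ SA (fun _ => twist)); [apply (sa_const _ SA)|]. now apply sa_minus. }
  assert (Cw : K (fun x => cos (twist * (u1 x - u2 x)))) by now apply (sa_cos _ SA).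
  assert (Sw : K (fun x => sin (twist * (u1 x - u2 x)))) by now apply (sa_sin _ SA).
  assert (e1 := sa_mult _ SA _ _ Hc Cw). assert (e2 := sa_mult _ SA _ _ Hs Sw).
  assert (e3 := sa_mult _ SA _ _ Hs Cw). assert (e4 := sa_mult _ SA _ _ Hc Sw).
  assert (He := in_algebra_pair K _ _ (sa_minus _ _ _ SA e1 e2) (sa_plus _ SA _ _ e3 e4)).
  assert (N1 := in_algebra_RtoC K SA _ (sa_mult _ SA _ _ HR (sa_mult _ SA _ _ E1 E1))).
  assert (N2 := in_algebra_RtoC K SA _ (sa_mult _ SA _ _ HR (sa_mult _ SA _ _ E2 E2))).
  assert (N12 := in_algebra_RtoC K SA _ (sa_mult _ SA _ _ HR (sa_mult _ SA _ _ E1 E2))).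
  assert (Q := in_algebra_RtoC K SA _ (sa_mult _ SA _ _ E2 E3)).
  repeat first [apply (in_algebra_plus K SA) | apply (in_algebra_mult K SA)
    | apply (in_algebra_conj K SA) | exact He | exact N1 | exact N2 | exact N12 | exact Q
    | apply (in_algebra_const K SA)].
Qed.

Lemma rates_in_algebra {X} (K : (X -> R) -> Prop) (SA : smooth_algebra K) u1 u2 cf sf :
  K u1 -> K u2 -> K cf -> K sf ->
  K (fun x => phase_pert (u1 x) (u2 x) (cf x) (sf x)) /\
  K (fun x => radial_pert (u1 x) (u2 x) (cf x) (sf x)).
Proof.
  intros H1 H2 Hc Hs. destruct (pert_in_algebra K SA u1 u2 cf sf H1 H2 Hc Hs) as [HR HI].
  split.
  - apply (sa_minus _ _ _ SA HI). apply (sa_mult _ SA (fun _ => twist)); [apply (sa_const _ SA)|exact HR].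
  - apply (sa_mult _ SA (fun _ => -2)); [apply (sa_const _ SA)|].
    apply (sa_mult _ SA (fun x => exp (-2 * u1 x))); [|exact HR].
    apply (sa_exp _ SA (fun x => -2 * u1 x)). apply (sa_mult _ SA (fun _ => -2)); [apply (sa_const _ SA)|exact H1].
Qed.

Definition lipschitz3 (C : R) (f : R -> R -> R -> R) : Prop :=
  forall a b x a' b' x' D, Rabs (a - a') <= D -> Rabs (b - b') <= D -> Rabs (x - x') <= D ->
    Rabs (f a b x) <= C /\ Rabs (f a b x - f a' b' x') <= C * D.

Lemma lipschitz3_bound C f a b x : lipschitz3 C f -> Rabs (f a b x) <= C.
Proof.
  intros H. destruct (H a b x a b x 0) as [B _]; try (rewrite Rminus_eq_0, Rabs_R0; apply Rle_refl).
  exact B.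
Qed.

Lemma rates_lipschitz : exists C, 0 <= C /\
  lipschitz3 C phase_rate /\ lipschitz3 C radial_rate /\ lipschitz3 C diff_rate.
Proof.
  set (E := fun (p p' : R * R * R) d => Rabs (fst (fst p) - fst (fst p')) <= d /\
     Rabs (snd (fst p) - snd (fst p')) <= d /\ Rabs (snd p - snd p') <= d).
  assert (SA := bounded_lipschitz_algebra E).
  assert (H1 : bounded_lipschitz E (fun p => logmod (fst (fst p)))).
  { exists 1. split; [lra|]. intros x y d (E1 & _) _. rewrite Rmult_1_l.
    generalize (logmod_bound (fst (fst x))) (logmod_bound (fst (fst y))) (logmod_lipschitz (fst (fst x)) (fst (fst y))); lra. }
  assert (H2 : bounded_lipschitz E (fun p => logmod (snd (fst p)))).
  { exists 1. split; [lra|]. intros x y d (_ & E1 & _) _. rewrite Rmult_1_l.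
    generalize (logmod_bound (snd (fst x))) (logmod_bound (snd (fst y))) (logmod_lipschitz (snd (fst x)) (snd (fst y))); lra. }
  assert (Hc : bounded_lipschitz E (fun p => cos (snd p))).
  { exists 1. split; [lra|]. intros x y d (_ & _ & E1) _. rewrite Rmult_1_l.
    generalize (Rabs_cos_le (snd x)) (Rabs_cos_le (snd y)) (cos_lipschitz (snd x) (snd y)); lra. }
  assert (Hs : bounded_lipschitz E (fun p => sin (snd p))).
  { exists 1. split; [lra|]. intros x y d (_ & _ & E1) _. rewrite Rmult_1_l.
    generalize (Rabs_sin_le (snd x)) (Rabs_sin_le (snd y)) (sin_lipschitz (snd x) (snd y)); lra. }
  assert (X : forall f, bounded_lipschitz E (fun p => f (fst (fst p)) (snd (fst p)) (snd p)) ->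
     exists C, 0 <= C /\ lipschitz3 C f).
  { intros f (M & HM & H). exists M. split; [exact HM|].
    intros a b x a' b' x' D Ha Hb Hx.
    assert (HD : 0 <= D) by (generalize (Rabs_pos (a - a')); lra).
    destruct (H (a, b, x) (a', b', x') D (conj Ha (conj Hb Hx)) HD) as (P1 & P2 & P3). now split. }
  destruct (rates_in_algebra _ SA _ _ _ _ H1 H2 Hc Hs) as [Hk Hg].
  destruct (X phase_rate Hk) as (Ck & Ck0 & HCk). destruct (X radial_rate Hg) as (Cg & Cg0 & HCg).
  assert (Hq : lipschitz3 (2 * Ck) diff_rate).
  { intros a b x a' b' x' D Ha Hb Hx. unfold diff_rate.
    destruct (HCk a b x a' b' x' D Ha Hb Hx) as [P1 P2].
    destruct (HCk b a (- x) b' a' (- x') D Hb Ha) as [P3 P4].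
    { replace (- x - - x') with (- (x - x')) by ring. now rewrite Rabs_Ropp. }
    split; [eapply Rle_trans; [apply Rabs_minus_le; eassumption|lra]|].
    replace (_ - _) with ((phase_rate a b x - phase_rate a' b' x')
      - (phase_rate b a (- x) - phase_rate b' a' (- x'))) by ring.
    eapply Rle_trans; [apply Rabs_minus_le; eassumption|lra]. }
  assert (mono : forall f C C', C <= C' -> lipschitz3 C f -> lipschitz3 C' f).
  { intros f C0 C' HC H a b x a' b' x' D Ha Hb Hx. destruct (H a b x a' b' x' D Ha Hb Hx) as [P1 P2].
    assert (0 <= D) by (generalize (Rabs_pos (a - a')); lra). split; [lra|nra]. }
  exists (2 * Ck + Cg). split; [lra|].
  split; [|split]; (eapply mono; [|eassumption]); lra.
Qed.

(** The curve itself is the index of the family, so the constant is uniform over the ball. The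
    values at - x are covered because reflection preserves [C11]. *)
Lemma rates_C11 : exists C, 0 <= C /\ forall s ds, C11 (1/4) s ds ->
  (exists dq, C11 C (fun x => diff_rate (s x) (s (- x)) x) dq) /\
  (exists dg, C11 C (fun x => radial_rate (s x) (s (- x)) x) dg).
Proof.
  set (P := fun i : (R -> R) * (R -> R) => C11 (1/4) (fst i) (snd i)).
  assert (SA := uniformly_C11_algebra P).
  assert (C11_refl : forall A f df, C11 A f df -> C11 A (fun x => f (- x)) (fun x => - df (- x))).
  { intros A f df H x. destruct (H (- x)) as (F0 & F1 & F2 & F3).
    split; [exact F0|split; [now rewrite Rabs_Ropp|split]].
    - replace (- df (- x)) with (scal (-1) (df (- x))) by (unfold scal; simpl; unfold mult; simpl; ring).
      apply (is_derive_comp f (fun s => - s)); [exact F2|]. auto_derive; [exact Logic.I|ring].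
    - intros y. replace (- df (- x) - - df (- y)) with (- (df (- x) - df (- y))) by ring.
      rewrite Rabs_Ropp. apply Rle_trans with (1 := F3 (- y)).
      replace (- x - - y) with (- (x - y)) by ring. rewrite Rabs_Ropp. apply Rle_refl. }
  assert (H1 : uniformly_C11 P (fun p => logmod (fst (fst p) (snd p)))).
  { exists 2. split; [lra|]. intros i Hi. eexists. apply (C11_logmod (fst i) (snd i) Hi). }
  assert (H2 : uniformly_C11 P (fun p => logmod (fst (fst p) (- snd p)))).
  { exists 2. split; [lra|]. intros i Hi. eexists. apply (C11_refl _ _ _ (C11_logmod (fst i) (snd i) Hi)). }
  assert (Kc : C11 1 cos (fun x => - sin x)).
  { intros x. rewrite Rabs_Ropp. split; [apply Rabs_cos_le|split; [apply Rabs_sin_le|split; [apply is_derive_cos|]]].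
    intros y. rewrite Rmult_1_l. replace (- sin x - - sin y) with (- (sin x - sin y)) by ring.
    rewrite Rabs_Ropp. apply sin_lipschitz. }
  assert (Ks : C11 1 sin cos).
  { intros x. split; [apply Rabs_sin_le|split; [apply Rabs_cos_le|split; [apply is_derive_sin|]]].
    intros y. rewrite Rmult_1_l. apply cos_lipschitz. }
  assert (Hc : uniformly_C11 P (fun p => cos (snd p))).
  { exists 1. split; [lra|]. intros i _. eexists. exact Kc. }
  assert (Hs : uniformly_C11 P (fun p => sin (snd p))).
  { exists 1. split; [lra|]. intros i _. eexists. exact Ks. }
  assert (Hc' : uniformly_C11 P (fun p => cos (- snd p))).
  { exists 1. split; [lra|]. intros i _. eexists. exact (C11_refl _ _ _ Kc). }
  assert (Hs' : uniformly_C11 P (fun p => sin (- snd p))).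
  { exists 1. split; [lra|]. intros i _. eexists. exact (C11_refl _ _ _ Ks). }
  destruct (rates_in_algebra _ SA _ _ _ _ H1 H2 Hc Hs) as [Hk Hg].
  destruct (rates_in_algebra _ SA _ _ _ _ H2 H1 Hc' Hs') as [Hk' _].
  destruct (sa_minus _ _ _ SA Hk Hk') as (M1 & M1p & HM1). destruct Hg as (M2 & M2p & HM2).
  exists (M1 + M2). split; [lra|]. intros s ds Hsd. split.
  - destruct (HM1 (s, ds) Hsd) as [dq Hq]. exists dq. apply (C11_mono M1); [lra|exact Hq].
  - destruct (HM2 (s, ds) Hsd) as [dg Hdg]. exists dg. apply (C11_mono M2); [lra|exact Hdg].
Qed.

Lemma rsq_pos : 0 < rsq.
Proof.
  unfold rsq. replace (- lambda / Re a01) with (lambda / - Re a01) by (field; lra).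
  apply Rdiv_lt_0_compat; lra.
Qed.

Lemma radius_pos : 0 < radius.
Proof. apply sqrt_lt_R0, rsq_pos. Qed.

Lemma radius_sq : radius * radius = rsq.
Proof. apply sqrt_sqrt. left; apply rsq_pos. Qed.

Definition osc (y psi : R) : C :=
  (RtoC (radius * exp (logmod y)) * cis (psi + twist * logmod y))%C.

Lemma Cmod_osc y psi : Cmod (osc y psi) = radius * exp (logmod y).
Proof.
  unfold osc. rewrite Cmod_mult, Cmod_cis, Cmod_R, Rmult_1_r. apply Rabs_pos_eq.
  apply Rmult_le_pos; left; [apply radius_pos|apply exp_pos].
Qed.

Lemma sqmod_osc y psi : sqmod (osc y psi) = RtoC (rsq * (exp (logmod y) * exp (logmod y))).
Proof. unfold sqmod. rewrite Cmod_osc, <- radius_sq. f_equal. ring. Qed.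

(** Phase invariance at work: once z is factored out, w / z, conj w z and conj z w depend on the two
    amplitudes and on the angle e between the oscillators only. *)
Lemma oscillator_osc eps y1 y2 psi1 psi2 :
  oscillator omega a01 a0 a1 a2 a3 b0 b1 b2 b3 lambda eps (osc y1 psi1) (osc y2 psi2) =
  (osc y1 psi1 * (RtoC lambda + Ci * RtoC omega
     + a01 * RtoC (rsq * (exp (logmod y1) * exp (logmod y1)))
     + RtoC eps * pert (logmod y1) (logmod y2) (cos (psi1 - psi2)) (sin (psi1 - psi2))))%C.
Proof.
  unfold oscillator. rewrite !sqmod_osc.
  set (u1 := logmod y1). set (u2 := logmod y2).
  set (e := cis ((psi1 - psi2) + twist * (u1 - u2))).
  assert (He : e = (cos (psi1 - psi2) * cos (twist * (u1 - u2)) - sin (psi1 - psi2) * sin (twist * (u1 - u2)),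
    sin (psi1 - psi2) * cos (twist * (u1 - u2)) + cos (psi1 - psi2) * sin (twist * (u1 - u2)))).
  { unfold e, cis. now rewrite cos_plus, sin_plus. }
  unfold pert. rewrite <- He.
  set (z := osc y1 psi1). set (w := osc y2 psi2).
  assert (Hz : z = (RtoC (radius * exp u1) * cis (psi1 + twist * u1))%C) by reflexivity.
  assert (Hw : w = (RtoC (radius * exp u2) * cis (psi2 + twist * u2))%C) by reflexivity.
  assert (C12 : e = (cis (psi1 + twist * u1) * Cconj (cis (psi2 + twist * u2)))%C).
  { rewrite <- cis_opp, <- cis_plus. unfold e. f_equal. ring. }
  assert (Cre : forall x : R, Cconj (RtoC x) = RtoC x).
  { intros x. unfold Cconj, RtoC; simpl. now rewrite Ropp_0. }
  assert (Cu : forall a : R, (cis a * Cconj (cis a) = 1)%C).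
  { intros a. rewrite <- cis_opp. apply cis_eq_1. }
  assert (Cm : forall a b : C, Cconj (a * b)%C = (Cconj a * Cconj b)%C).
  { intros a b. unfold Cconj, Cmult; simpl. f_equal; ring. }
  assert (Cc : forall a : C, Cconj (Cconj a) = a).
  { intros [a b]. unfold Cconj; simpl. now rewrite Ropp_involutive. }
  assert (Rn : RtoC (rsq * (exp u1 * exp u2)) = (RtoC (radius * exp u1) * RtoC (radius * exp u2))%C).
  { rewrite <- RtoC_mult. f_equal. rewrite <- radius_sq. ring. }
  assert (E1 : (Cconj w * z = RtoC (rsq * (exp u1 * exp u2)) * e)%C).
  { rewrite Rn, C12, Hz, Hw, Cm, Cre. ring. }
  assert (E2 : (Cconj z * w = RtoC (rsq * (exp u1 * exp u2)) * Cconj e)%C).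
  { rewrite Rn, C12, Hz, Hw, !Cm, Cre, Cc. ring. }
  assert (E3 : w = (z * (RtoC (exp u2 * exp (- u1)) * Cconj e))%C).
  { rewrite C12, Hz, Hw, !Cm, Cc.
    replace (RtoC (radius * exp u2)) with (RtoC (radius * exp u1) * RtoC (exp u2 * exp (- u1)))%C.
    - transitivity (RtoC (radius * exp u1) * RtoC (exp u2 * exp (- u1)) * cis (psi2 + twist * u2) * 1)%C; [ring|].
      rewrite <- (Cu (psi1 + twist * u1)). ring.
    - rewrite <- RtoC_mult. f_equal. rewrite exp_Ropp. field. apply Rgt_not_eq, exp_pos. }
  replace (a3 * Cconj w * z)%C with (a3 * (Cconj w * z))%C by ring.
  replace (b3 * Cconj z * w)%C with (b3 * (Cconj z * w))%C by ring.
  rewrite E1, E2. rewrite E3 at 1. ring.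
Qed.

(* inl b carries y and inr b the isochronous phase psi of oscillator b. The clamp makes the field
   bounded and globally Lipschitz, and is inactive where |y| <= 1/2. *)
Definition field (eps : R) (u : bool + bool -> R) (i : bool + bool) : R :=
  match i with
  | inl b => - (2 * lambda) * clamp (u (inl b))
      + eps * radial_rate (u (inl b)) (u (inl (negb b))) (u (inr b) - u (inr (negb b)))
  | inr b => omega - twist * lambda
      + eps * phase_rate (u (inl b)) (u (inl (negb b))) (u (inr b) - u (inr (negb b)))
  end.

Definition embed (u : bool + bool -> R) : C2 :=
  (osc (u (inl true)) (u (inr true)), osc (u (inl false)) (u (inr false))).

(** For eps = 0, y' = - 2 lambda y gives u' = lambda y / (1 + y) = lambda - lambda / (1 + y), which
    is lambda + Re a01 |z|^2 because |z|^2 = r^2 / (1 + y) and Re a01 r^2 = - lambda. The strict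
    bound on |y| makes the truncation the identity near y, so that [logmod] is differentiable
    there. *)
Lemma is_derive_osc eps (X : R -> bool + bool -> R) t b :
  (forall i, is_derive (fun t => X t i) t (field eps (X t) i)) ->
  Rabs (X t (inl b)) < 1/2 ->
  is_derive (fun t => osc (X t (inl b)) (X t (inr b)) : C_R_NormedModule) t
    (oscillator omega a01 a0 a1 a2 a3 b0 b1 b2 b3 lambda eps
       (osc (X t (inl b)) (X t (inr b))) (osc (X t (inl (negb b))) (X t (inr (negb b))))).
Proof.
  intros HX Hb. rewrite oscillator_osc.
  set (y := X t (inl b)) in *. set (y' := X t (inl (negb b))).
  set (f := X t (inr b) - X t (inr (negb b))).
  set (N := pert (logmod y) (logmod y') (cos f) (sin f)).
  assert (Hy : -1/2 < y < 1/2) by (apply Rabs_def2 in Hb; lra).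
  assert (Du : is_derive (fun t => logmod (X t (inl b))) t
     (field eps (X t) (inl b) * (- (1/2) * / (1 + y)))).
  { apply (is_derive_comp logmod (fun t => X t (inl b))); [now apply is_derive_logmod|apply HX]. }
  assert (Dth : is_derive (fun t => X t (inr b) + twist * logmod (X t (inl b))) t
     (field eps (X t) (inr b) + twist * (field eps (X t) (inl b) * (- (1/2) * / (1 + y))))).
  { apply @is_derive_plus; [apply HX|]. now apply is_derive_scal. }
  assert (D := is_derive_polar radius _ _ _ _ _ Du Dth).
  refine (eq_rect _ (fun v => is_derive _ t v) D _ _).
  unfold osc. fold y. f_equal.
  assert (E2 : exp (-2 * logmod y) = 1 + y) by (rewrite exp_logmod, clamp_id; [reflexivity|lra]).
  assert (E : exp (logmod y) * exp (logmod y) = / (1 + y)).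
  { rewrite <- E2, <- exp_plus, <- exp_Ropp. f_equal. ring. }
  rewrite E. unfold field, radial_rate, phase_rate, radial_pert, phase_pert. fold y y' f N.
  rewrite E2, clamp_id by lra.
  assert (Ha : Re a01 <> 0) by lra.
  clearbody N. unfold rsq, twist. unfold Re in *. unfold Im.
  apply injective_projections; simpl; field; lra.
Qed.

Lemma is_derive_embed eps (X : R -> bool + bool -> R) t :
  (forall i, is_derive (fun t => X t i) t (field eps (X t) i)) ->
  (forall b, Rabs (X t (inl b)) < 1/2) ->
  is_derive (fun t => embed (X t)) t
    (coupled omega a01 a0 a1 a2 a3 b0 b1 b2 b3 lambda eps (embed (X t))).
Proof.
  intros HX Hb.
  apply (is_derive_pair (U := C_R_NormedModule) (V := C_R_NormedModule)
    (fun t => osc (X t (inl true)) (X t (inr true))) (fun t => osc (X t (inl false)) (X t (inr false)))).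
  - exact (is_derive_osc eps X t true HX (Hb true)).
  - exact (is_derive_osc eps X t false HX (Hb false)).
Qed.

Lemma field_solution eps (x0 : bool + bool -> R) : 0 <= eps ->
  exists X, (forall i, X 0 i = x0 i) /\ forall t i, is_derive (fun t => X t i) t (field eps (X t) i).
Proof.
  intros He. destruct rates_lipschitz as (C & HC & Hk & Hg & _).
  assert (HeC : 0 <= eps * C) by nra.
  apply (global_solution (field eps) (2 * lambda + 2 * (eps * C) + 1) (2 * lambda + Rabs (omega - twist * lambda) + eps * C)).
  - lra.
  - assert (Ha := Rabs_pos (omega - twist * lambda)).
    intros u [b|b]; simpl.
    + eapply Rle_trans.
      { apply Rabs_plus_le; apply Rabs_mult_le.
        - rewrite Rabs_Ropp, Rabs_pos_eq by lra. apply Rle_refl.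
        - apply Rabs_le, clamp_bounds.
        - rewrite Rabs_pos_eq by lra. apply Rle_refl.
        - eapply lipschitz3_bound; eassumption. }
      lra.
    + eapply Rle_trans.
      { apply Rabs_plus_le; [apply Rle_refl|apply Rabs_mult_le].
        - rewrite Rabs_pos_eq by lra. apply Rle_refl.
        - eapply lipschitz3_bound; eassumption. }
      lra.
  - intros u v B HB.
    assert (B0 : 0 <= B) by (generalize (HB (inl true)) (Rabs_pos (u (inl true) - v (inl true))); lra).
    assert (Hf : forall b, Rabs ((u (inr b) - u (inr (negb b))) - (v (inr b) - v (inr (negb b)))) <= 2 * B).
    { intros b. replace (_ - _) with ((u (inr b) - v (inr b)) - (u (inr (negb b)) - v (inr (negb b)))) by ring.
      eapply Rle_trans; [apply Rabs_minus_le; apply HB|lra]. }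
    assert (HB2 : forall i, Rabs (u i - v i) <= 2 * B) by (intros i; generalize (HB i); lra).
    intros [b|b]; simpl.
    + replace (_ - _) with (- (2 * lambda) * (clamp (u (inl b)) - clamp (v (inl b)))
        + eps * (radial_rate (u (inl b)) (u (inl (negb b))) (u (inr b) - u (inr (negb b)))
          - radial_rate (v (inl b)) (v (inl (negb b))) (v (inr b) - v (inr (negb b))))) by ring.
      eapply Rle_trans.
      { apply Rabs_plus_le; apply Rabs_mult_le.
        - rewrite Rabs_Ropp, Rabs_pos_eq by lra. apply Rle_refl.
        - apply Rle_trans with (1 := clamp_lipschitz _ _). apply HB.
        - rewrite Rabs_pos_eq by lra. apply Rle_refl.
        - apply (Hg _ _ _ _ _ _ (2 * B)); auto. }
      nra.
    + replace (_ - _) with (eps * (phase_rate (u (inl b)) (u (inl (negb b))) (u (inr b) - u (inr (negb b)))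
          - phase_rate (v (inl b)) (v (inl (negb b))) (v (inr b) - v (inr (negb b))))) by ring.
      eapply Rle_trans.
      { apply Rabs_mult_le.
        - rewrite Rabs_pos_eq by lra. apply Rle_refl.
        - apply (Hk _ _ _ _ _ _ (2 * B)); auto. }
      nra.
Qed.

(** * Comparison of isochronous coordinates with the Euclidean distance *)

Definition distort (u : R) : C := (RtoC (exp u) * cis (twist * u))%C.

Lemma osc_distort y psi : osc y psi = (RtoC radius * cis psi * distort (logmod y))%C.
Proof. unfold osc, distort. rewrite cis_plus, RtoC_mult. ring. Qed.

Lemma distort_lipschitz : exists K, 0 <= K /\ forall y y',
  Cmod (distort (logmod y) - distort (logmod y'))%C <= K * Rabs (y - y').
Proof.
  set (E := fun y y' d : R => Rabs (y - y') <= d).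
  assert (SA := bounded_lipschitz_algebra E).
  assert (HU : bounded_lipschitz E logmod).
  { exists 1. split; [lra|]. intros x y d Hd _. unfold E in Hd.
    generalize (logmod_bound x) (logmod_bound y) (logmod_lipschitz x y). lra. }
  assert (HT : bounded_lipschitz E (fun y => twist * logmod y)).
  { apply (sa_mult _ SA (fun _ => twist)); [apply (sa_const _ SA)|exact HU]. }
  assert (H : in_algebra (bounded_lipschitz E) (fun y => distort (logmod y))).
  { apply (in_algebra_mult _ SA).
    - apply (in_algebra_RtoC _ SA (fun y => exp (logmod y))). now apply (sa_exp _ SA).
    - apply (in_algebra_pair (bounded_lipschitz E) (fun y => cos (twist * logmod y)) (fun y => sin (twist * logmod y)));
        [now apply (sa_cos _ SA)|now apply (sa_sin _ SA)]. }
  destruct H as [(M1 & P1 & H1) (M2 & P2 & H2)].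
  exists (M1 + M2). split; [lra|]. intros y y'. rewrite Rmult_plus_distr_r.
  apply Cmod_le_Re_Im.
  - apply (H1 y y' (Rabs (y - y'))); [apply Rle_refl|apply Rabs_pos].
  - apply (H2 y y' (Rabs (y - y'))); [apply Rle_refl|apply Rabs_pos].
Qed.

Lemma osc_lipschitz : exists K, 0 <= K /\ forall y y' psi,
  Cmod (osc y psi - osc y' psi)%C <= K * Rabs (y - y').
Proof.
  destruct distort_lipschitz as (K & HK & H). assert (R0 := radius_pos).
  exists (radius * K). split; [nra|]. intros y y' psi. rewrite !osc_distort.
  replace (_ - _)%C with (RtoC radius * cis psi * (distort (logmod y) - distort (logmod y')))%C by ring.
  rewrite !Cmod_mult, Cmod_cis, Cmod_R, Rabs_pos_eq, Rmult_1_r, Rmult_assoc by lra.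
  apply Rmult_le_compat_l; [lra|apply H].
Qed.

Lemma osc_0 psi : osc 0 psi = (RtoC radius * cis psi)%C.
Proof.
  rewrite osc_distort, logmod_0. unfold distort. rewrite exp_0, Rmult_0_r, cis_0. ring.
Qed.

Lemma Cmod_osc_bounds y psi : radius / 2 <= Cmod (osc y psi) <= 2 * radius.
Proof.
  rewrite Cmod_osc. assert (R0 := radius_pos).
  assert (U := logmod_bound y). apply Rabs_le_between in U.
  assert (E1 : / 2 <= exp (logmod y)) by (generalize (exp_ineq1_le (logmod y)); lra).
  assert (E2 : exp (logmod y) <= 2).
  { rewrite <- (Ropp_involutive (logmod y)), exp_Ropp, <- (Rinv_inv 2).
    apply Rinv_le_contravar; [lra|]. generalize (exp_ineq1_le (- logmod y)); lra. }
  split; nra.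
Qed.

(** Projection along isochrons onto the circle of radius r. It forgets the amplitude without knowing
    the curve, hence serves as an explicit continuous left inverse of every torus map below. *)
Definition unwarp (z : C) : C :=
  let u := ln (Cmod z / radius) in (z * (RtoC (exp (- u)) * cis (- (twist * u))))%C.

Lemma unwarp_osc y psi : unwarp (osc y psi) = (RtoC radius * cis psi)%C.
Proof.
  unfold unwarp. rewrite Cmod_osc. assert (R0 := radius_pos).
  replace (radius * exp (logmod y) / radius) with (exp (logmod y)) by (field; lra).
  rewrite ln_exp, osc_distort. unfold distort.
  transitivity (RtoC radius * cis psi * (RtoC (exp (logmod y)) * RtoC (exp (- logmod y)))
    * (cis (twist * logmod y) * cis (- (twist * logmod y))))%C; [ring|].
  rewrite cis_eq_1, <- RtoC_mult, <- exp_plus, Rplus_opp_r, exp_0. ring.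
Qed.

Lemma continuous_unwarp (z : C) : z <> 0 ->
  in_algebra (fun f : C_R_NormedModule -> R => continuous f z) unwarp.
Proof.
  intros N. apply Cmod_gt_0 in N. assert (R0 := radius_pos).
  set (K := fun f : C_R_NormedModule -> R => continuous f z).
  assert (SA : smooth_algebra K) by apply continuous_algebra.
  assert (Hid : in_algebra K (fun w => w)).
  { split; [apply (linear_cont (fun w : C_R_NormedModule => fst w)), is_linear_fst
           |apply (linear_cont (fun w : C_R_NormedModule => snd w)), is_linear_snd]. }
  assert (Hu : K (fun w => ln (Cmod w / radius))).
  { apply (continuous_comp (fun w : C_R_NormedModule => Cmod w / radius) ln).
    - apply (sa_mult _ SA (fun w => Cmod w)); [|apply (sa_const _ SA)].
      replace (fun w : C_R_NormedModule => Cmod w) with (fun w : C_R_NormedModule => norm w).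
      + exact (@filterlim_norm R_AbsRing C_R_NormedModule z).
      + apply functional_extensionality. apply norm_C.
    - apply (ex_derive_continuous ln). exists (/ (Cmod z / radius)). apply is_derive_ln.
      apply Rdiv_lt_0_compat; assumption. }
  assert (Ht : K (fun w => twist * ln (Cmod w / radius))).
  { apply (sa_mult _ SA (fun _ => twist)); [apply (sa_const _ SA)|exact Hu]. }
  unfold unwarp. apply (in_algebra_mult _ SA _ _ Hid), (in_algebra_mult _ SA).
  - apply (in_algebra_RtoC _ SA (fun w => exp (- ln (Cmod w / radius)))).
    apply (sa_exp _ SA). apply (sa_opp _ _ SA Hu).
  - apply (in_algebra_pair K (fun w => cos (- (twist * ln (Cmod w / radius)))) (fun w => sin (- (twist * ln (Cmod w / radius))))).
    + apply (sa_cos _ SA). apply (sa_opp _ _ SA Ht).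
    + apply (sa_sin _ SA). apply (sa_opp _ _ SA Ht).
Qed.

Lemma unwarp_inverse_continuous (z : C) eta : z <> 0 -> 0 < eta ->
  exists d, 0 < d /\ forall w : C, Cmod (w - z)%C < d -> Cmod (unwarp w - unwarp z)%C <= eta.
Proof.
  intros N He. destruct (continuous_unwarp z N) as [H1 H2].
  destruct (continuous_epsilon_delta _ _ (eta / 2) H1) as (d1 & D1 & K1); [lra|].
  destruct (continuous_epsilon_delta _ _ (eta / 2) H2) as (d2 & D2 & K2); [lra|].
  exists (Rmin d1 d2). split; [now apply Rmin_pos|]. intros w Hw.
  assert (L1 := Rmin_l d1 d2). assert (L2 := Rmin_r d1 d2).
  replace eta with (eta / 2 + eta / 2) by field.
  apply Cmod_le_Re_Im; left.
  - apply (K1 w). rewrite norm_C. change (Cmod (w - z)%C < d1). lra.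
  - apply (K2 w). rewrite norm_C. change (Cmod (w - z)%C < d2). lra.
Qed.

(** Dividing p by the reference point gives a number near 1, whose modulus moves the amplitude and
    whose small angle moves the phase. The factor radius / 2 is the lower bound of the reference
    modulus; tau <= 1/64 keeps the new amplitude below 1/8 + 8 tau <= 1/4. *)
Lemma osc_nearby : exists K, 0 <= K /\ forall y psi (p : C) tau,
  Rabs y <= 1/8 -> tau <= 1/64 -> Cmod (p - osc y psi)%C <= tau * (radius / 2) ->
  exists y' psi', p = osc y' psi' /\ Rabs (y' - y) <= 8 * tau /\ Rabs (psi' - psi) <= K * tau.
Proof.
  assert (R0 := radius_pos). assert (T0 := Rabs_pos twist).
  exists (2 + 8 * Rabs twist). split; [lra|].
  intros y psi p tau Hy Htau Hp.
  assert (B := Cmod_osc_bounds y psi). set (q := osc y psi) in *.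
  assert (Hq0 : 0 < Cmod q) by lra.
  assert (Hq : q <> 0) by now apply Cmod_gt_0.
  set (w := (p / q)%C).
  assert (Hpw : p = (w * q)%C) by (unfold w; field; exact Hq).
  assert (tau0 : 0 <= tau).
  { generalize (Cmod_ge_0 (p - q)%C). intros. apply (Rmult_le_reg_r (radius / 2)); lra. }
  assert (Hw : Cmod (w - 1)%C <= tau).
  { apply (Rmult_le_reg_r (Cmod q)); [assumption|]. rewrite <- Cmod_mult.
    replace ((w - 1) * q)%C with (p - q)%C by (rewrite Hpw; ring). nra. }
  destruct (polar_near_1 w tau Hw) as (al & Hal & Bal); [lra|].
  assert (Hm : Rabs (Cmod w - 1) <= tau).
  { apply Rle_trans with (2 := Hw).
    assert (T1 := Cmod_triangle (w - 1)%C 1). replace (w - 1 + 1)%C with w in T1 by ring.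
    assert (T2 := Cmod_triangle w (1 - w)%C). replace (w + (1 - w))%C with (RtoC 1) in T2 by ring.
    replace (1 - w)%C with (- (w - 1))%C in T2 by ring. rewrite Cmod_opp in T2. rewrite Cmod_1 in T1, T2.
    apply Rabs_le. lra. }
  apply Rabs_le_between in Hm. set (m := Cmod w) in *.
  assert (Hm0 : 0 < m) by lra.
  (* Forced by 1 + y = r^2 / |z|^2 when |z| is multiplied by m. *)
  set (y' := (1 + y) / (m * m) - 1).
  assert (Hy1 : -(1/8) <= y <= 1/8) by now apply Rabs_le_between.
  assert (Hy' : Rabs (y' - y) <= 8 * tau).
  { replace (y' - y) with ((1 + y) * ((1 - m) * (1 + m)) / (m * m)) by (unfold y'; field; lra).
    rewrite Rabs_div by nra. rewrite (Rabs_pos_eq (m * m)) by nra.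
    apply (Rmult_le_reg_r (m * m)); [nra|].
    replace (Rabs ((1 + y) * ((1 - m) * (1 + m))) / (m * m) * (m * m))
      with (Rabs ((1 + y) * ((1 - m) * (1 + m)))) by (field; lra).
    apply Rle_trans with (9/8 * (tau * (2 + tau))).
    - apply Rabs_mult_le; [apply Rabs_le; lra|]. apply Rabs_mult_le; apply Rabs_le; lra.
    - assert ((1 - tau) * (1 - tau) <= m * m) by nra. nra. }
  assert (By' : Rabs y' <= 1/2).
  { replace y' with ((y' - y) + y) by ring. eapply Rle_trans; [apply Rabs_triang|]. lra. }
  assert (Hexp : exp (logmod y') = exp (logmod y) * m).
  { assert (E1 := exp_logmod y). assert (E2 := exp_logmod y').
    rewrite clamp_id in E1 by lra. rewrite clamp_id in E2 by lra.
    assert (P1 := exp_pos (logmod y)). assert (P2 := exp_pos (logmod y')).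
    replace (-2 * logmod y) with (- (logmod y + logmod y)) in E1 by ring.
    replace (-2 * logmod y') with (- (logmod y' + logmod y')) in E2 by ring.
    rewrite exp_Ropp, exp_plus in E1, E2.
    apply Rsqr_inj; [lra|nra|]. unfold Rsqr.
    assert (E3 : 1 + y' = (1 + y) / (m * m)) by (unfold y'; ring).
    rewrite <- E1, <- E2 in E3. set (A := exp (logmod y)) in *. set (A' := exp (logmod y')) in *.
    apply Rinv_eq_reg. rewrite E3. field. lra. }
  exists y', (psi + twist * logmod y + al - twist * logmod y'). split; [|split; [exact Hy'|]].
  - rewrite Hpw, Hal. unfold q, osc. fold m. rewrite Hexp.
    replace (psi + twist * logmod y + al - twist * logmod y' + twist * logmod y')
      with (al + (psi + twist * logmod y)) by ring.
    rewrite (cis_plus al), !RtoC_mult. ring.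
  - replace (_ - psi) with (al - twist * (logmod y' - logmod y)) by ring.
    rewrite Rmult_plus_distr_r. apply Rabs_minus_le; [exact Bal|].
    replace (8 * Rabs twist * tau) with (Rabs twist * (8 * tau)) by ring.
    apply Rabs_mult_le; [apply Rle_refl|]. apply Rle_trans with (1 := logmod_lipschitz _ _). exact Hy'.
Qed.

(** * The invariant torus as an embedded image of the unperturbed one *)

Definition dlogmod (s ds : R -> R) (t : R) : R := - (1/2) * / (1 + s t) * ds t.

(* Because the oscillators are interchangeable, one function s gives both radii. *)
Definition param (s : R -> R) (x : R2) : C2 :=
  (osc (s (fst x - snd x)) (fst x), osc (s (snd x - fst x)) (snd x)).

Definition dosc (s ds : R -> R) (a b va vb : R) : C :=
  let du := dlogmod s ds (a - b) * (va - vb) in (osc (s (a - b)%R) a * (du, va + twist * du)%R)%C.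

Definition dparam (s ds : R -> R) (x v : R2) : C2 :=
  (dosc s ds (fst x) (snd x) (fst v) (snd v), dosc s ds (snd x) (fst x) (snd v) (fst v)).

(** On the unperturbed torus arg z is the isochronous phase; z is moved along its isochron to the
    amplitude that s prescribes at the phase difference. *)
Definition warp (s : R -> R) (z w : C) : C := (z * distort (logmod (s (arg z - arg w)%R)))%C.

Definition torus_map (s : R -> R) (p : C2) : C2 := (warp s (fst p) (snd p), warp s (snd p) (fst p)).

Lemma torus_chart_cis (x : R2) :
  torus_chart radius x = (RtoC radius * cis (fst x), RtoC radius * cis (snd x))%C.
Proof.
  unfold torus_chart, cis, Cmult, RtoC; simpl. f_equal; f_equal; ring.
Qed.

Lemma torus_iff_chart (p : C2) : torus radius p <-> exists x : R2, p = torus_chart radius x.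
Proof.
  split.
  - intros [H1 H2]. exists (arg (fst p), arg (snd p)). rewrite torus_chart_cis. simpl.
    destruct p as [z w]. simpl in *. rewrite <- H1 at 1. rewrite <- H2. now rewrite <- !polar_form.
  - intros [x ->]. rewrite torus_chart_cis. assert (R0 := radius_pos).
    split; simpl; rewrite Cmod_mult, Cmod_cis, Cmod_R, Rabs_pos_eq; lra.
Qed.

Lemma arg_cis t : exists k : Z, arg (RtoC radius * cis t)%C = t + IZR k * (2 * PI).
Proof.
  apply cis_inj_mod. assert (R0 := radius_pos).
  assert (H := polar_form (RtoC radius * cis t)%C).
  rewrite Cmod_mult, Cmod_cis, Cmod_R, Rabs_pos_eq, Rmult_1_r in H by lra.
  assert (N : RtoC radius <> 0) by (intros E; apply RtoC_inj in E; lra).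
  transitivity (/ RtoC radius * (RtoC radius * cis t))%C; [rewrite H at 2|]; field; exact N.
Qed.

Lemma torus_map_chart s (x : R2) : periodic s -> torus_map s (torus_chart radius x) = param s x.
Proof.
  intros Hs. rewrite torus_chart_cis. unfold torus_map, warp, param. cbn [fst snd].
  destruct (arg_cis (fst x)) as [k ->]. destruct (arg_cis (snd x)) as [m ->].
  rewrite !osc_distort.
  replace (fst x + IZR k * (2 * PI) - (snd x + IZR m * (2 * PI))) with (fst x - snd x + IZR (k - m) * (2 * PI))
    by (rewrite minus_IZR; ring).
  replace (snd x + IZR m * (2 * PI) - (fst x + IZR k * (2 * PI))) with (snd x - fst x + IZR (m - k) * (2 * PI))
    by (rewrite minus_IZR; ring).
  now rewrite !periodic_Z.
Qed.

Lemma osc_neq_0 y psi : osc y psi <> 0.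
Proof. apply Cmod_gt_0. generalize (Cmod_osc_bounds y psi) radius_pos. lra. Qed.

Section Differential.

Variables (s ds : R -> R) (f g : R2 -> R).
Hypothesis s_C11 : C11 (1/4) s ds.
Hypothesis (f_linear : is_linear f) (g_linear : is_linear g).

(** [f] and [g] stand for the two angle projections in either order, so a single computation covers
    both oscillators. *)
Lemma filterdiff_osc (x : R2) :
  filterdiff (fun y => osc (s (f y - g y)) (f y) : C_R_NormedModule) (locally x)
    (fun v => dosc s ds (f x) (g x) (f v) (g v)).
Proof.
  assert (Hf : filterdiff f (locally x) f) by now apply filterdiff_linear.
  assert (Hg : filterdiff g (locally x) g) by now apply filterdiff_linear.
  assert (Hfg : filterdiff (fun y => f y - g y) (locally x) (fun v => f v - g v)).
  { exact (filterdiff_minus_fct (V := R_NormedModule) f g f g Hf Hg). }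
  assert (Hu : filterdiff (fun y => logmod (s (f y - g y))) (locally x)
     (fun v => (f v - g v) * dlogmod s ds (f x - g x))).
  { apply (filterdiff_comp_derive (fun t => logmod (s t)) (fun y => f y - g y)); [exact Hfg|].
    apply (C11_logmod s ds s_C11). }
  assert (Ht : filterdiff (fun y => f y + twist * logmod (s (f y - g y))) (locally x)
     (fun v => f v + twist * ((f v - g v) * dlogmod s ds (f x - g x)))).
  { apply (filterdiff_plus_fct (V := R_NormedModule) f (fun y => twist * logmod (s (f y - g y)))
      f (fun v => twist * ((f v - g v) * dlogmod s ds (f x - g x)))); [exact Hf|].
    apply (filterdiff_scal_r_fct (V := R_NormedModule) twist (fun y => logmod (s (f y - g y)))); [exact Rmult_comm|exact Hu]. }
  eapply filterdiff_ext_lin; [exact (filterdiff_polar radius _ _ _ _ _ Hu Ht)|].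
  intros v. unfold dosc. rewrite (Rmult_comm (f v - g v)). reflexivity.
Qed.

Lemma continuous_dosc (x : R2) va vb :
  continuous (fun y => dosc s ds (f y) (g y) va vb : C_R_NormedModule) x.
Proof.
  set (K := fun h : R2 -> R => continuous h x).
  assert (SA : smooth_algebra K) by apply continuous_algebra.
  assert (Kf : K f) by exact (linear_cont (V := R_NormedModule) f x f_linear).
  assert (Kg : K g) by exact (linear_cont (V := R_NormedModule) g x g_linear).
  assert (Kfg : K (fun y => f y - g y)) by (now apply (sa_minus _ _ _ SA)).
  assert (HL := C11_logmod s ds s_C11).
  assert (Ku : K (fun y => logmod (s (f y - g y)))).
  { apply (continuous_comp (fun y => f y - g y) (fun t => logmod (s t))); [exact Kfg|].
    apply (continuous_of_lipschitz _ 2); [lra|]. intros y. apply (C11_lipschitz _ _ _ HL). }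
  assert (Kd : K (fun y => dlogmod s ds (f y - g y))).
  { apply (continuous_comp (fun y => f y - g y) (dlogmod s ds)); [exact Kfg|].
    apply (continuous_of_lipschitz _ 2); [lra|]. intros y. apply HL. }
  assert (Kdu : K (fun y => dlogmod s ds (f y - g y) * (va - vb))).
  { apply (sa_mult _ SA _ (fun _ => va - vb) Kd). apply (sa_const _ SA). }
  assert (Kth : K (fun y => f y + twist * logmod (s (f y - g y)))).
  { apply (sa_plus _ SA _ _ Kf). apply (sa_mult _ SA (fun _ => twist) _ (sa_const _ SA _) Ku). }
  assert (H : in_algebra K (fun y => dosc s ds (f y) (g y) va vb)).
  { unfold dosc, osc. apply (in_algebra_mult _ SA); [apply (in_algebra_mult _ SA)|].
    - apply (in_algebra_RtoC _ SA (fun y => radius * exp (logmod (s (f y - g y))))).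
      apply (sa_mult _ SA (fun _ => radius)); [apply (sa_const _ SA)|]. now apply (sa_exp _ SA).
    - apply (in_algebra_pair K (fun y => cos (f y + twist * logmod (s (f y - g y))))
        (fun y => sin (f y + twist * logmod (s (f y - g y))))); [now apply (sa_cos _ SA)|now apply (sa_sin _ SA)].
    - apply (in_algebra_pair K (fun y => dlogmod s ds (f y - g y) * (va - vb))
        (fun y => va + twist * (dlogmod s ds (f y - g y) * (va - vb)))); [exact Kdu|].
      apply (sa_plus _ SA (fun _ => va)); [apply (sa_const _ SA)|].
      apply (sa_mult _ SA (fun _ => twist) _ (sa_const _ SA _) Kdu). }
  destruct H as [H1 H2].
  apply (continuous_ext (fun y => (Re (dosc s ds (f y) (g y) va vb), Im (dosc s ds (f y) (g y) va vb)))).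
  - intros y. now destruct (dosc s ds (f y) (g y) va vb).
  - exact (continuous_pair _ _ _ H1 H2).
Qed.

End Differential.

Lemma C1_param s ds h : C11 (1/4) s ds -> (forall x : R2, h (torus_chart radius x) = param s x) ->
  C1_on_torus radius h (dparam s ds).
Proof.
  intros Hs Hh x.
  assert (L1 : is_linear (fun x : R2 => fst x)) by apply is_linear_fst.
  assert (L2 : is_linear (fun x : R2 => snd x)) by apply is_linear_snd.
  split.
  - apply (filterdiff_ext (param s)); [intros y; symmetry; apply Hh|].
    exact (filterdiff_pair _ _ _ _ _ (filterdiff_osc s ds _ _ Hs L1 L2 x) (filterdiff_osc s ds _ _ Hs L2 L1 x)).
  - intros v.
    exact (continuous_pair _ _ _ (continuous_dosc s ds _ _ Hs L1 L2 x (fst v) (snd v))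
      (continuous_dosc s ds _ _ Hs L2 L1 x (snd v) (fst v))).
Qed.

(** The system is triangular: the real part of the logarithmic derivative is du, and once it
    vanishes the imaginary part va + twist du reduces to va. The torus map is therefore an immersion
    even where s' is nonzero. *)
Lemma dosc_eq_0 s ds a b va vb : dosc s ds a b va vb = 0 -> va = 0.
Proof.
  unfold dosc. set (du := dlogmod s ds (a - b) * (va - vb)). intros H.
  assert (E : (du, va + twist * du) = RtoC 0).
  { apply Cmod_eq_0. apply (f_equal Cmod) in H. rewrite Cmod_mult, Cmod_0 in H.
    destruct (Rmult_integral _ _ H) as [E|E]; [|exact E].
    apply Cmod_eq_0, osc_neq_0 in E. contradiction. }
  assert (E1 : du = 0) by exact (f_equal fst E).
  assert (E2 : va + twist * du = 0) by exact (f_equal snd E).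
  rewrite E1 in E2. lra.
Qed.

(** Each coordinate is recovered from its image by [unwarp], which gives injectivity and continuity
    of the inverse at once. *)
Lemma torus_map_embedding s ds : C11 (1/4) s ds -> periodic s -> C1_embedding_of_torus radius (torus_map s).
Proof.
  intros Hs Hp.
  assert (U : forall p, torus radius p -> fst p = unwarp (fst (torus_map s p)) /\ snd p = unwarp (snd (torus_map s p))).
  { intros p Ht. apply torus_iff_chart in Ht. destruct Ht as [x ->].
    rewrite torus_map_chart by assumption. rewrite torus_chart_cis. unfold param. cbn [fst snd].
    rewrite !unwarp_osc. now split. }
  split; [|split].
  - exists (dparam s ds). split.
    + apply C1_param; [exact Hs|]. intros x. now apply torus_map_chart.
    + intros x v H. apply injective_projections.
      * exact (dosc_eq_0 _ _ _ _ _ _ (f_equal fst H)).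
      * exact (dosc_eq_0 _ _ _ _ _ _ (f_equal snd H)).
  - intros p q Tp Tq H. destruct (U p Tp) as [P1 P2]. destruct (U q Tq) as [Q1 Q2].
    rewrite H in P1, P2. apply injective_projections; congruence.
  - intros p Tp eta Heta. destruct (U p Tp) as [P1 P2].
    assert (N : fst (torus_map s p) <> RtoC 0 /\ snd (torus_map s p) <> RtoC 0).
    { apply torus_iff_chart in Tp. destruct Tp as [x ->].
      rewrite torus_map_chart by assumption. split; apply osc_neq_0. }
    destruct (unwarp_inverse_continuous _ (eta / 3) (proj1 N)) as (d1 & D1 & K1); [lra|].
    destruct (unwarp_inverse_continuous _ (eta / 3) (proj2 N)) as (d2 & D2 & K2); [lra|].
    exists (Rmin d1 d2). split; [now apply Rmin_pos|]. intros q Tq Hq.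
    destruct (U q Tq) as [Q1 Q2].
    assert (L1 := Rmin_l d1 d2). assert (L2 := Rmin_r d1 d2).
    assert (C1 := Cmod_fst_le_norm (torus_map s q) (torus_map s p)).
    assert (C2 := Cmod_snd_le_norm (torus_map s q) (torus_map s p)).
    apply Rle_lt_trans with (eta / 3 + eta / 3); [|lra]. apply norm_C2_le.
    + rewrite P1, Q1. apply K1. lra.
    + rewrite P2, Q2. apply K2. lra.
Qed.

Lemma zero_C11 A : 0 <= A -> C11 A (fun _ => 0) (fun _ => 0).
Proof.
  intros HA x. rewrite Rabs_R0. split; [exact HA|split; [exact HA|split; [apply @is_derive_const|]]].
  intros y. rewrite Rminus_0_r, Rabs_R0. apply Rmult_le_pos; [exact HA|apply Rabs_pos].
Qed.

Lemma param_0 (x : R2) : torus_chart radius x = param (fun _ => 0) x.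
Proof. unfold param. now rewrite torus_chart_cis, !osc_0. Qed.

Lemma torus_map_C1_close : exists K, 0 <= K /\ forall A s ds, A <= 1/8 -> C11 A s ds -> periodic s ->
  C1_dist_le radius (torus_map s) (fun p => p) (K * A).
Proof.
  destruct osc_lipschitz as (K & HK & HL). assert (R0 := radius_pos). assert (T0 := Rabs_pos twist).
  set (B := 4 * radius * (1 + (1 + Rabs twist))).
  assert (HB : 0 <= B) by (unfold B; nra).
  exists (2 * (K + B)). split; [lra|]. intros A s ds HA Hs Hp.
  assert (A0 := C11_pos _ _ _ Hs).
  assert (Hs4 : C11 (1/4) s ds) by (apply (C11_mono A); [lra|exact Hs]).
  assert (HD : forall t, Rabs (dlogmod s ds t) <= A).
  { intros t. destruct (Hs t) as (S0 & S1 & _). unfold dlogmod.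
    apply Rabs_le_between in S0.
    assert (I : 0 < / (1 + s t) <= 2).
    { split; [apply Rinv_0_lt_compat; lra|]. rewrite <- (Rinv_inv 2). apply Rinv_le_contravar; lra. }
    replace A with (1 * A) by ring. apply Rabs_mult_le; [|exact S1]. apply Rabs_le. lra. }
  assert (Close : forall t psi, Cmod (osc (s t) psi - osc 0 psi)%C <= K * A).
  { intros t psi. apply Rle_trans with (1 := HL _ _ _). apply Rmult_le_compat_l; [lra|].
    rewrite Rminus_0_r. apply Hs. }
  split.
  - intros p Tp. apply torus_iff_chart in Tp. destruct Tp as [x ->].
    rewrite torus_map_chart, param_0 by assumption.
    apply Rle_trans with (K * A + K * A); [|nra]. apply norm_C2_le; apply Close.
  - exists (dparam s ds), (dparam (fun _ => 0) (fun _ => 0)). split; [|split].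
    + apply C1_param; [exact Hs4|]. intros x. now apply torus_map_chart.
    + apply C1_param; [apply zero_C11; lra|]. intros x. apply param_0.
    + intros x v. assert (N0 : 0 <= norm v) by apply norm_ge_0.
      assert (V1 : Rabs (fst v) <= norm v) by apply (norm_le_prod_norm_1 v).
      assert (V2 : Rabs (snd v) <= norm v) by apply (norm_le_prod_norm_2 v).
      assert (G : forall a b va vb, Rabs va <= norm v -> Rabs vb <= norm v ->
        Cmod (dosc s ds a b va vb - dosc (fun _ => 0) (fun _ => 0) a b va vb)%C <= (K + B) * A * norm v).
      { intros a b va vb Ha Hb. unfold dosc.
        replace (dlogmod (fun _ => 0) (fun _ => 0) (a - b)) with 0 by (unfold dlogmod; ring).
        set (du := dlogmod s ds (a - b) * (va - vb)).
        assert (Hdu : Rabs du <= A * (norm v + norm v)).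
        { apply Rabs_mult_le; [apply HD|now apply Rabs_minus_le]. }
        (* The first term is small by the closeness of the points, the second because the amplitude
           differential is O(A). *)
        replace (_ - _)%C with ((osc (s (a - b)%R) a - osc 0 a) * (0, va)%R + osc (s (a - b)%R) a * (du, twist * du)%R)%C.
        - eapply Rle_trans; [apply Cmod_triangle|]. rewrite !Cmod_mult.
          assert (M1 : Cmod (0, va) <= 0 + norm v).
          { apply Cmod_le_Re_Im; simpl; [rewrite Rabs_R0; lra|exact Ha]. }
          assert (M2 : Cmod (du, twist * du) <= A * (norm v + norm v) + Rabs twist * (A * (norm v + norm v))).
          { apply Cmod_le_Re_Im; simpl; [exact Hdu|]. apply Rabs_mult_le; [apply Rle_refl|exact Hdu]. }
          destruct (Cmod_osc_bounds (s (a - b)) a) as [_ M3].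
          apply Rle_trans with (K * A * (0 + norm v) + 2 * radius * (A * (norm v + norm v) + Rabs twist * (A * (norm v + norm v)))).
          + apply Rplus_le_compat; apply Rmult_le_compat; try apply Cmod_ge_0; try assumption. apply Close.
          + unfold B. assert (0 <= radius * (A * norm v)) by (apply Rmult_le_pos; [lra|]; apply Rmult_le_pos; assumption).
            nra.
        - apply injective_projections; simpl; ring. }
      replace (2 * (K + B) * A * norm v) with ((K + B) * A * norm v + (K + B) * A * norm v) by ring.
      apply norm_C2_le; apply G; assumption.
Qed.

(** * Invariance and asymptotic stability of the torus over a curve *)

Section Curve.

Variables (A C eps : R) (s ds : R -> R).
Hypothesis A_small : A <= 1/8.
Hypothesis C_nonneg : 0 <= C.
Hypothesis eps_nonneg : 0 <= eps.
Hypothesis eps_small : 4 * (eps * C) <= lambda.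
Hypothesis radial_lip : lipschitz3 C radial_rate.
Hypothesis diff_lip : lipschitz3 C diff_rate.
Hypothesis s_C11 : C11 A s ds.
Hypothesis s_invariant : forall x,
  eps * diff_rate (s x) (s (- x)) x * ds x = - (2 * lambda) * s x + eps * radial_rate (s x) (s (- x)) x.

Section Solution.

Variable X : R -> bool + bool -> R.
Hypothesis X_solution : forall t i, is_derive (fun t => X t i) t (field eps (X t) i).

Definition phase_diff (u : bool + bool -> R) (b : bool) : R := u (inr b) - u (inr (negb b)).

Definition defect (u : bool + bool -> R) (b : bool) : R := u (inl b) - s (phase_diff u b).

Definition defect_sq (u : bool + bool -> R) : R := defect u true ^ 2 + defect u false ^ 2.

Definition defect_rate (u : bool + bool -> R) (b : bool) : R :=
  field eps u (inl b) - eps * diff_rate (u (inl b)) (u (inl (negb b))) (phase_diff u b) * ds (phase_diff u b).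

Lemma phase_diff_negb u b : phase_diff u (negb b) = - phase_diff u b.
Proof. unfold phase_diff. rewrite Bool.negb_involutive. ring. Qed.

Lemma is_derive_defect t b : is_derive (fun t => defect (X t) b) t (defect_rate (X t) b).
Proof.
  unfold defect, defect_rate. apply @is_derive_minus; [apply X_solution|].
  apply (is_derive_comp s (fun t => phase_diff (X t) b)); [apply s_C11|].
  unfold phase_diff.
  replace (eps * _) with (field eps (X t) (inr b) - field eps (X t) (inr (negb b))).
  - apply @is_derive_minus; apply X_solution.
  - unfold diff_rate, field. rewrite Bool.negb_involutive, Ropp_minus_distr. ring.
Qed.

Lemma s_small x : Rabs (s x) <= 1/8.
Proof. apply Rle_trans with (2 := A_small). apply s_C11. Qed.

Lemma ds_small x : Rabs (ds x) <= 1/8.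
Proof. apply Rle_trans with (2 := A_small). apply s_C11. Qed.

(** Subtracting the invariance equation at the current phase difference leaves, besides the damping,
    only differences of rates between u and the curve at the same phase. Each is at most C D, and 1
    + |ds| <= 2. *)
Lemma defect_rate_bound u b :
  Rabs (defect_rate u b + 2 * lambda * (clamp (u (inl b)) - s (phase_diff u b)))
    <= 2 * (eps * C) * (Rabs (defect u true) + Rabs (defect u false)).
Proof.
  set (D := Rabs (defect u true) + Rabs (defect u false)).
  assert (P1 := Rabs_pos (defect u true)). assert (P2 := Rabs_pos (defect u false)).
  assert (HD : forall b, Rabs (defect u b) <= D) by (intros []; unfold D; lra).
  assert (I := s_invariant (phase_diff u b)).
  set (f := phase_diff u b) in *.
  assert (Hn : Rabs (u (inl (negb b)) - s (- f)) <= D).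
  { unfold f. rewrite <- phase_diff_negb. apply HD. }
  assert (F0 : Rabs (f - f) <= D) by (rewrite Rminus_eq_0, Rabs_R0; unfold D; lra).
  destruct (radial_lip _ _ _ _ _ _ _ (HD b) Hn F0) as [_ G].
  destruct (diff_lip _ _ _ _ _ _ _ (HD b) Hn F0) as [_ Q]. fold f in G, Q.
  unfold defect_rate, field. fold (phase_diff u b). fold f.
  replace (_ + _) with
    (eps * ((radial_rate (u (inl b)) (u (inl (negb b))) f - radial_rate (s f) (s (- f)) f)
      - (diff_rate (u (inl b)) (u (inl (negb b))) f - diff_rate (s f) (s (- f)) f) * ds f)) by lra.
  eapply Rle_trans.
  { apply Rabs_mult_le; [rewrite Rabs_pos_eq; [apply Rle_refl|lra]|].
    apply Rabs_minus_le; [exact G|]. apply Rabs_mult_le; [exact Q|]. apply ds_small. }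
  assert (0 <= C * D) by (apply Rmult_le_pos; unfold D; lra).
  assert (0 <= eps * (C * D)) by (apply Rmult_le_pos; lra). nra.
Qed.

Definition defect_sq_rate (u : bool + bool -> R) : R :=
  2 * defect u true * defect_rate u true + 2 * defect u false * defect_rate u false.

Lemma is_derive_defect_sq t : is_derive (fun t => defect_sq (X t)) t (defect_sq_rate (X t)).
Proof.
  unfold defect_sq, defect_sq_rate. apply @is_derive_plus.
  - evar_last; [apply (is_derive_pow (fun t => defect (X t) true)), is_derive_defect|]. simpl; ring.
  - evar_last; [apply (is_derive_pow (fun t => defect (X t) false)), is_derive_defect|]. simpl; ring.
Qed.

Lemma defect_cross u :
  (Rabs (defect u true) + Rabs (defect u false)) * (Rabs (defect u true) + Rabs (defect u false))
    <= 2 * defect_sq u.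
Proof.
  replace (defect_sq u) with (Rabs (defect u true) * Rabs (defect u true) + Rabs (defect u false) * Rabs (defect u false))
    by (unfold defect_sq; rewrite !Rabs_sq; ring).
  generalize (Rle_0_sqr (Rabs (defect u true) - Rabs (defect u false))). unfold Rsqr. lra.
Qed.

Lemma defect_sq_nonneg u : 0 <= defect_sq u.
Proof. unfold defect_sq. nra. Qed.

(** A crude two-sided bound valid for all amplitudes, truncated or not; it serves backward times,
    where no trapping is available. *)
Lemma defect_sq_rate_bound u : Rabs (defect_sq_rate u) <= 6 * lambda * (2 * defect_sq u).
Proof.
  set (D := Rabs (defect u true) + Rabs (defect u false)).
  assert (P1 := Rabs_pos (defect u true)). assert (P2 := Rabs_pos (defect u false)).
  assert (H : forall b, Rabs (defect_rate u b) <= 2 * lambda * Rabs (defect u b) + 2 * (eps * C) * D).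
  { intros b. assert (E := defect_rate_bound u b). fold D in E.
    replace (defect_rate u b) with ((defect_rate u b + 2 * lambda * (clamp (u (inl b)) - s (phase_diff u b)))
      - 2 * lambda * (clamp (u (inl b)) - s (phase_diff u b))) by ring.
    rewrite Rplus_comm. rewrite (Rplus_comm (2 * lambda * _)) at 1.
    apply Rle_trans with (2 * (eps * C) * D + 2 * lambda * Rabs (defect u b)); [|lra].
    replace (_ - _) with ((defect_rate u b + 2 * lambda * (clamp (u (inl b)) - s (phase_diff u b)))
      - 2 * lambda * (clamp (u (inl b)) - s (phase_diff u b))) by ring.
    apply Rabs_minus_le; [exact E|]. apply Rabs_mult_le; [rewrite Rabs_pos_eq; lra|].
    rewrite <- (clamp_id (s (phase_diff u b))) by (generalize (s_small (phase_diff u b)); lra).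
    apply clamp_lipschitz. }
  assert (X2 := defect_cross u). fold D in X2.
  unfold defect_sq_rate.
  eapply Rle_trans.
  { apply Rabs_plus_le; apply Rabs_mult_le; [|apply H| |apply H];
      (apply Rabs_mult_le; [rewrite Rabs_pos_eq; [apply Rle_refl|lra]|apply Rle_refl]). }
  fold D in P1, P2. set (p := Rabs (defect u true)) in *. set (q := Rabs (defect u false)) in *.
  assert (HD : D = p + q) by reflexivity.
  assert (p * p + q * q <= D * D) by (rewrite HD; nra).
  assert (0 <= eps * C) by nra.
  assert (eps * C * (D * D) <= lambda * (D * D)) by (apply Rmult_le_compat_r; nra).
  assert (lambda * (p * p + q * q) <= lambda * (D * D)) by (apply Rmult_le_compat_l; lra).
  assert (lambda * (D * D) <= lambda * (2 * defect_sq u)) by (apply Rmult_le_compat_l; lra).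
  replace (_ + _) with (4 * (lambda * (p * p + q * q)) + 4 * (eps * C) * (D * (p + q))) by ring.
  rewrite <- HD.
  assert (4 * (eps * C) * (D * D) <= lambda * (D * D)) by (apply Rmult_le_compat_r; nra). lra.
Qed.

(** Damping contributes - 4 lambda times the squared defect. The coupling contributes at most 4 eps
    C D^2 <= lambda D^2, hence at most 2 lambda times the squared defect, leaving the rate 2
    lambda. *)
Lemma defect_sq_rate_contracts u : (forall b, Rabs (u (inl b)) <= 1/2) ->
  defect_sq_rate u <= - (2 * lambda) * defect_sq u.
Proof.
  intros Hu. set (D := Rabs (defect u true) + Rabs (defect u false)).
  assert (P1 := Rabs_pos (defect u true)). assert (P2 := Rabs_pos (defect u false)).
  assert (H : forall b, 2 * defect u b * defect_rate u b
     <= - (4 * lambda) * defect u b ^ 2 + 4 * (eps * C) * D * Rabs (defect u b)).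
  { intros b. assert (E := defect_rate_bound u b). fold D in E.
    rewrite clamp_id in E by apply Hu. fold (defect u b) in E.
    set (v := defect_rate u b + 2 * lambda * defect u b) in E.
    replace (defect_rate u b) with (v - 2 * lambda * defect u b) by (unfold v; ring).
    assert (W : Rabs (defect u b * v) <= Rabs (defect u b) * (2 * (eps * C) * D)).
    { apply Rabs_mult_le; [apply Rle_refl|exact E]. }
    generalize (Rle_abs (defect u b * v)). lra. }
  assert (X2 := defect_cross u). fold D in X2.
  generalize (H true) (H false). unfold defect_sq_rate.
  assert (4 * (eps * C) * (D * D) <= lambda * (D * D)) by (apply Rmult_le_compat_r; [nra|lra]).
  assert (lambda * (D * D) <= lambda * (2 * defect_sq u)) by (apply Rmult_le_compat_l; lra).
  assert (4 * (eps * C) * D * Rabs (defect u true) + 4 * (eps * C) * D * Rabs (defect u false)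
    = 4 * (eps * C) * (D * D)) by (unfold D; ring).
  unfold defect_sq in *. lra.
Qed.

Lemma defect_zero_forever : defect_sq (X 0) = 0 -> forall t b, X t (inl b) = s (phase_diff (X t) b).
Proof.
  intros H0 t.
  assert (E : defect_sq (X t) = 0).
  { apply (gronwall_zero (fun t => defect_sq (X t)) (fun t => defect_sq_rate (X t)) (12 * lambda)); [|exact H0].
    intros x _. split; [apply is_derive_defect_sq|]. split; [apply defect_sq_nonneg|].
    eapply Rle_trans; [apply defect_sq_rate_bound|]. lra. }
  unfold defect_sq in E.
  assert (Z : forall b, defect (X t) b = 0) by (intros []; nra).
  intros b. generalize (Z b). unfold defect. lra.
Qed.

(** From |y| = 1/4 outward the truncated damping is at least lambda / 2, while the perturbation is
    at most eps C <= lambda / 4. The truncation thus stays inactive for all forward times. *)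
Lemma radii_trapped : (forall b, Rabs (X 0 (inl b)) <= 1/4) ->
  forall t, 0 <= t -> forall b, Rabs (X t (inl b)) <= 1/4.
Proof.
  intros H0 t Ht b.
  assert (G : forall u, Rabs (eps * radial_rate (u (inl b)) (u (inl (negb b))) (u (inr b) - u (inr (negb b)))) <= lambda / 4).
  { intros u. apply Rle_trans with (eps * C); [|lra].
    apply Rabs_mult_le; [rewrite Rabs_pos_eq; lra|].
    eapply lipschitz3_bound; eassumption. }
  assert (Hb := H0 b). apply Rabs_le_between in Hb.
  apply Rabs_le. split.
  - assert (- X t (inl b) <= 1/4); [|lra].
    apply (barrier (fun t => - X t (inl b)) (fun t => - field eps (X t) (inl b))); [|lra|exact Ht].
    intros r _. split; [apply @is_derive_opp, X_solution|]. intros Hr. simpl.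
    specialize (G (X r)). apply Rabs_le_between in G.
    assert (clamp (X r (inl b)) <= - (1/4)).
    { unfold clamp, Rmax, Rmin; repeat destruct Rle_dec; lra. }
    nra.
  - apply (barrier (fun t => X t (inl b)) (fun t => field eps (X t) (inl b))); [|lra|exact Ht].
    intros r _. split; [apply X_solution|]. intros Hr. simpl.
    specialize (G (X r)). apply Rabs_le_between in G.
    assert (1/4 <= clamp (X r (inl b))).
    { unfold clamp, Rmax, Rmin; repeat destruct Rle_dec; lra. }
    nra.
Qed.

Lemma defect_decay : (forall b, Rabs (X 0 (inl b)) <= 1/4) ->
  forall t, 0 <= t -> defect_sq (X t) <= defect_sq (X 0) * exp (- (2 * lambda) * t).
Proof.
  intros H0 t Ht. rewrite <- (Rminus_0_r t) at 2.
  apply (gronwall (fun t => defect_sq (X t)) (fun t => defect_sq_rate (X t))); [exact Ht|].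
  intros x Hx. split; [apply is_derive_defect_sq|]. apply defect_sq_rate_contracts.
  intros b. generalize (radii_trapped H0 x (proj1 Hx) b). lra.
Qed.

End Solution.

Variable T : C2 -> Prop.
Hypothesis T_param : forall p, T p <-> exists x : R2, p = param s x.

Local Notation F := (coupled omega a01 a0 a1 a2 a3 b0 b1 b2 b3 lambda eps).

Lemma embed_on_curve u : (forall b, u (inl b) = s (phase_diff u b)) -> T (embed u).
Proof.
  intros H. apply T_param. exists (u (inr true), u (inr false)).
  unfold embed, param. rewrite (H true), (H false). reflexivity.
Qed.

Definition curve_state (x : R2) (i : bool + bool) : R :=
  match i with
  | inl true => s (fst x - snd x)
  | inl false => s (snd x - fst x)
  | inr true => fst x
  | inr false => snd x
  end.

(** On the curve |y| <= 1/8 at all times, past and future, so the truncated solution solves the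
    original system on the whole line; uniqueness then covers every other solution. *)
Lemma curve_invariant : invariant F T.
Proof.
  intros p Hp. apply T_param in Hp. destruct Hp as [x ->].
  destruct (field_solution eps (curve_state x) eps_nonneg) as (X & X0 & HX).
  assert (E0 : embed (X 0) = param s x).
  { unfold embed. rewrite !X0. reflexivity. }
  assert (Z : forall t b, X t (inl b) = s (phase_diff (X t) b)).
  { apply defect_zero_forever; [exact HX|]. unfold defect_sq, defect, phase_diff. rewrite !X0. simpl. ring. }
  assert (Hd : forall t, is_derive (fun t => embed (X t)) t (F (embed (X t)))).
  { intros t. apply is_derive_embed; [apply HX|]. intros b. rewrite Z. generalize (s_small (phase_diff (X t) b)). lra. }
  split.
  - exists (fun t => embed (X t)). split; [|exact E0]. intros t _ _. apply Hd.
  - intros a b z Ha Hb Hz Hz0 t Hat Htb.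
    replace (z t) with (embed (X t)).
    + apply embed_on_curve, Z.
    + symmetry. apply (solution_unique omega a01 a0 a1 a2 a3 b0 b1 b2 b3 lambda eps z (fun t => embed (X t))).
      * intros y [H1 H2]. apply Hz.
        -- apply Rbar_lt_le_trans with (Rmin 0 t); [|exact H1]. unfold Rmin; destruct Rle_dec; assumption.
        -- apply Rbar_le_lt_trans with (Rmax 0 t); [exact H2|]. unfold Rmax; destruct Rle_dec; assumption.
      * intros y _. apply Hd.
      * now rewrite Hz0, E0.
Qed.

Lemma neighborhood_coordinates : exists K kappa, 0 < K /\ 0 < kappa /\ forall d p, d <= kappa ->
  neighborhood T d p -> exists u, embed u = p /\ (forall b, Rabs (u (inl b)) <= 1/4) /\ defect_sq u <= (K * d) ^ 2.
Proof.
  destruct osc_nearby as (Kn & HKn & N). assert (R0 := radius_pos).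
  (* The amplitude moves by at most 8 tau, while the phase difference, to which both phases
     contribute, moves by at most 2 Kn tau and displaces the value of s by no more. With tau = 2 d /
     radius, d <= radius / 128 gives tau <= 1/64. *)
  set (L := 8 + 2 * Kn).
  exists (2 * L * (2 / radius)), (radius / 128).
  assert (HL : 0 < L) by (unfold L; lra).
  assert (Hr : 0 < 2 / radius) by (apply Rdiv_lt_0_compat; lra).
  split; [nra|]. split; [lra|].
  intros d p Hd (q & Tq & Hq). apply T_param in Tq. destruct Tq as [x ->].
  assert (Q1 := Cmod_fst_le_norm p (param s x)). assert (Q2 := Cmod_snd_le_norm p (param s x)).
  set (tau := 2 / radius * d).
  assert (Ht : tau * (radius / 2) = d) by (unfold tau; field; lra).
  assert (Htau : tau <= 1/64).
  { apply (Rmult_le_reg_r (radius / 2)); [lra|]. rewrite Ht. lra. }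
  destruct (N (s (fst x - snd x)) (fst x) (fst p) tau) as (y1 & p1 & E1 & Y1 & P1); [apply s_small|exact Htau|rewrite Ht; apply Rle_trans with (1 := Q1); lra|].
  destruct (N (s (snd x - fst x)) (snd x) (snd p) tau) as (y2 & p2 & E2 & Y2 & P2); [apply s_small|exact Htau|rewrite Ht; apply Rle_trans with (1 := Q2); lra|].
  set (u := fun i : bool + bool => match i with inl true => y1 | inl false => y2 | inr true => p1 | inr false => p2 end).
  assert (Lip := C11_lipschitz _ _ _ s_C11).
  assert (A0 := C11_pos _ _ _ s_C11).
  assert (G : forall y a b a' b', Rabs (y - s (a - b)) <= 8 * tau -> Rabs (a' - a) <= Kn * tau -> Rabs (b' - b) <= Kn * tau ->
    Rabs (y - s (a' - b')) <= L * tau).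
  { intros y a b a' b' Hy Ha Hb.
    replace (y - s (a' - b')) with ((y - s (a - b)) - (s (a' - b') - s (a - b))) by ring.
    unfold L. rewrite Rmult_plus_distr_r. apply Rabs_minus_le; [exact Hy|].
    apply Rle_trans with (1 := Lip _ _).
    assert (W : Rabs (a' - b' - (a - b)) <= Kn * tau + Kn * tau).
    { replace (a' - b' - (a - b)) with ((a' - a) - (b' - b)) by ring. now apply Rabs_minus_le. }
    assert (P := Rabs_pos (a' - b' - (a - b))). nra. }
  assert (D1 : Rabs (defect u true) <= L * tau) by exact (G _ _ _ _ _ Y1 P1 P2).
  assert (D2 : Rabs (defect u false) <= L * tau) by exact (G _ _ _ _ _ Y2 P2 P1).
  exists u. split; [|split].
  - unfold embed, u. rewrite <- E1, <- E2. now destruct p.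
  - assert (S : forall y t, Rabs (y - s t) <= 8 * tau -> Rabs y <= 1/4).
    { intros y t H. replace y with ((y - s t) + s t) by ring.
      apply Rle_trans with (8 * tau + 1/8); [|lra]. apply Rabs_plus_le; [exact H|apply s_small]. }
    intros []; [exact (S _ _ Y1)|exact (S _ _ Y2)].
  - replace (2 * L * (2 / radius) * d) with (2 * (L * tau)) by (unfold tau; ring).
    unfold defect_sq. rewrite <- (pow2_abs (defect u true)), <- (pow2_abs (defect u false)).
    generalize (Rabs_pos (defect u true)) (Rabs_pos (defect u false)). nra.
Qed.

(** The comparison point on the torus has the same isochronous phases, so only the amplitudes
    differ. *)
Lemma embed_near_curve : exists K, 0 < K /\ forall u e, 0 < e -> defect_sq u <= e ^ 2 ->
  neighborhood T (K * e) (embed u).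
Proof.
  destruct osc_lipschitz as (K & HK & HL).
  exists (2 * K + 1). split; [lra|]. intros u e He Hu.
  exists (param s (u (inr true), u (inr false))). split.
  - apply T_param. now exists (u (inr true), u (inr false)).
  - assert (D : forall b, Rabs (defect u b) <= e).
    { intros b. rewrite <- (Rabs_pos_eq e) by lra. apply Rsqr_le_abs_0. unfold Rsqr, defect_sq in *.
      destruct b; nra. }
    apply Rle_lt_trans with (K * e + K * e); [|lra]. apply norm_C2_le.
    + apply Rle_trans with (1 := HL _ _ _). apply Rmult_le_compat_l; [lra|apply (D true)].
    + apply Rle_trans with (1 := HL _ _ _). apply Rmult_le_compat_l; [lra|apply (D false)].
Qed.

Lemma solution_near u : (forall b, Rabs (u (inl b)) <= 1/4) ->
  exists X a, a < 0 /\ embed (X 0) = embed u /\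
    (forall t, a < t -> is_derive (fun t => embed (X t)) t (F (embed (X t)))) /\
    (forall t, 0 <= t -> defect_sq (X t) <= defect_sq u * exp (- (2 * lambda) * t)).
Proof.
  intros Hu. destruct (field_solution eps u eps_nonneg) as (X & X0 & HX).
  assert (H0 : forall b, Rabs (X 0 (inl b)) <= 1/4) by (intros b; rewrite X0; apply Hu).
  (* A short past is needed so that 0 is interior to the interval of existence; continuity keeps the
     truncation inactive there. *)
  assert (Hc : forall b, exists a, 0 < a /\ forall t, - a < t -> t < 0 -> Rabs (X t (inl b)) < 1/2).
  { intros b.
    assert (Cb : continuous (fun t => X t (inl b)) 0).
    { apply (ex_derive_continuous (fun t => X t (inl b))). eexists. apply HX. }
    destruct (continuous_epsilon_delta (U := R_NormedModule) _ 0 (1/4) Cb) as (a & Ha & K); [lra|].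
    exists a. split; [exact Ha|]. intros t H1 H2.
    assert (Kt : Rabs (X t (inl b) - X 0 (inl b)) < 1/4).
    { apply K. change (Rabs (t - 0) < a). rewrite Rminus_0_r. apply Rabs_def1; lra. }
    replace (X t (inl b)) with ((X t (inl b) - X 0 (inl b)) + X 0 (inl b)) by ring.
    eapply Rle_lt_trans; [apply Rabs_triang|]. generalize (H0 b). lra. }
  destruct (Hc true) as (a_t & At & Kt). destruct (Hc false) as (a_f & Af & Kf).
  exists X, (- Rmin a_t a_f). split; [|split; [|split]].
  - generalize (Rmin_pos _ _ At Af). lra.
  - unfold embed. now rewrite !X0.
  - intros t Ht. apply is_derive_embed; [apply HX|]. intros b.
    destruct (Rle_dec 0 t) as [P|P].
    + generalize (radii_trapped X HX H0 t P b). lra.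
    + assert (L1 := Rmin_l a_t a_f). assert (L2 := Rmin_r a_t a_f).
      destruct b; [apply Kt|apply Kf]; lra.
  - intros t Ht. replace (defect_sq u) with (defect_sq (X 0)).
    + now apply defect_decay.
    + unfold defect_sq, defect, phase_diff. now rewrite !X0.
Qed.

Lemma neighborhood_mono d e p : d <= e -> neighborhood T d p -> neighborhood T e p.
Proof. intros H (q & Tq & Hq). exists q. split; [exact Tq|lra]. Qed.

Lemma solution_tracks u z (b : Rbar) (t : R) : (forall b, Rabs (u (inl b)) <= 1/4) -> z 0 = embed u ->
  solution_on F b p_infty z \/ (exists c, Rbar_lt t c /\ solution_on F b c z) -> Rbar_lt b 0 -> 0 <= t ->
  exists v, z t = embed v /\ defect_sq v <= defect_sq u * exp (- (2 * lambda) * t).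
Proof.
  intros Hu Hz0 Hz Hb Ht.
  destruct (solution_near u Hu) as (X & a & Ha & E0 & HX & HD).
  exists (X t). split; [|now apply HD].
  apply (solution_unique omega a01 a0 a1 a2 a3 b0 b1 b2 b3 lambda eps z (fun t => embed (X t))).
  - rewrite Rmin_left, Rmax_right by assumption. intros x Hx.
    assert (Hbx : Rbar_lt b x) by (apply Rbar_lt_le_trans with 0; [exact Hb|exact (proj1 Hx)]).
    destruct Hz as [Hz|(c & Hc & Hz)]; apply Hz; [exact Hbx|exact Logic.I|exact Hbx|].
    apply Rbar_le_lt_trans with t; [exact (proj2 Hx)|exact Hc].
  - rewrite Rmin_left by assumption. intros x Hx. apply HX. lra.
  - now rewrite Hz0, E0.
Qed.

(** An algebraic bound on the decay makes the waiting time in the proof of attraction explicit and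
    free of logarithms. *)
Lemma exp_decay_le t : 0 <= t -> exp (- (2 * lambda) * t) <= / (1 + 2 * lambda * t).
Proof.
  intros Ht. replace (- (2 * lambda) * t) with (- (2 * lambda * t)) by ring. rewrite exp_Ropp.
  apply Rinv_le_contravar; [|apply exp_ineq1_le]. assert (0 <= lambda * t) by (apply Rmult_le_pos; lra). lra.
Qed.

Lemma curve_stable : stable F T.
Proof.
  destruct neighborhood_coordinates as (K1 & kappa & HK1 & Hkappa & N).
  destruct embed_near_curve as (K2 & HK2 & M).
  split; [|split].
  - exists kappa. split; [exact Hkappa|]. intros p Hp.
    destruct (N kappa p (Rle_refl _) Hp) as (u & Eu & Hu & _).
    destruct (solution_near u Hu) as (X & a & Ha & E0 & HX & _).
    exists a, (fun t => embed (X t)). split; [exact Ha|split; [|congruence]].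
    intros t Hat _. now apply HX.
  - intros eta Heta. set (d := Rmin kappa (eta / (K1 * K2))).
    assert (HK : 0 < K1 * K2) by nra.
    assert (Hd : 0 < d) by (apply Rmin_pos; [exact Hkappa|now apply Rdiv_lt_0_compat]).
    assert (Hdk := Rmin_l kappa (eta / (K1 * K2))). assert (Hde := Rmin_r kappa (eta / (K1 * K2))). fold d in Hdk, Hde.
    exists d. split; [exact Hd|]. intros a b z Ha Hb Hz Hz0 t Ht Htb.
    destruct (N d (z 0) Hdk Hz0) as (u & Eu & Hu & Du).
    destruct (solution_tracks u z a t Hu (eq_sym Eu)) as (v & -> & Dv); [right; now exists b|exact Ha|exact Ht|].
    apply (neighborhood_mono (K2 * (K1 * d))).
    + replace eta with (K1 * K2 * (eta / (K1 * K2))) by (field; lra).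
      replace (K2 * (K1 * d)) with (K1 * K2 * d) by ring. apply Rmult_le_compat_l; lra.
    + apply M; [nra|]. apply Rle_trans with (1 := Dv). apply Rle_trans with (2 := Du).
      rewrite <- (Rmult_1_r (defect_sq u)) at 2. apply Rmult_le_compat_l; [apply defect_sq_nonneg|].
      rewrite <- exp_0. apply exp_le. assert (0 <= lambda * t) by (apply Rmult_le_pos; lra). lra.
  - exists kappa. split; [exact Hkappa|]. intros a z Ha Hz Hz0 eta Heta.
    destruct (N kappa (z 0) (Rle_refl _) Hz0) as (u & Eu & Hu & _).
    set (e := eta / K2). assert (He : 0 < e) by now apply Rdiv_lt_0_compat.
    set (D0 := defect_sq u). assert (HD0 : 0 <= D0) by apply defect_sq_nonneg.
    assert (He2 : 0 < 2 * lambda * (e * e)) by (apply Rmult_lt_0_compat; [lra|nra]).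
    (* From this time on D0 / (1 + 2 lambda t) is at most e^2. *)
    exists (D0 / (2 * lambda * (e * e))). intros t Ht.
    assert (Ht0 : 0 <= t) by (apply Rle_trans with (2 := Ht); apply Rdiv_le_0_compat; lra).
    destruct (solution_tracks u z a t Hu (eq_sym Eu)) as (v & -> & Dv); [now left|exact Ha|exact Ht0|].
    replace eta with (K2 * e) by (unfold e; field; lra).
    apply M; [exact He|]. apply Rle_trans with (1 := Dv). fold D0.
    assert (Hlt : 0 <= lambda * t) by (apply Rmult_le_pos; lra).
    apply Rle_trans with (D0 * / (1 + 2 * lambda * t)); [apply Rmult_le_compat_l; [exact HD0|now apply exp_decay_le]|].
    apply (Rmult_le_reg_r (1 + 2 * lambda * t)); [lra|].
    rewrite Rmult_assoc, Rinv_l, Rmult_1_r by lra.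
    assert (D0 <= 2 * lambda * (e * e) * t).
    { replace D0 with (2 * lambda * (e * e) * (D0 / (2 * lambda * (e * e)))) by (field; lra).
      apply Rmult_le_compat_l; lra. }
    simpl. nra.
Qed.

End Curve.

End ReducedSystem.

(** * Periodicity of the rates and assembly of the theorem *)

Lemma phase_rate_periodic a01 a0 a1 a2 a3 b0 b1 b2 b3 lambda y1 y2 f :
  phase_rate a01 a0 a1 a2 a3 b0 b1 b2 b3 lambda y1 y2 (f + 2 * PI) =
  phase_rate a01 a0 a1 a2 a3 b0 b1 b2 b3 lambda y1 y2 f.
Proof. unfold phase_rate. now rewrite cos_plus, sin_plus, cos_2PI, sin_2PI, !Rmult_1_r, !Rmult_0_r, Rminus_0_r, Rplus_0_r. Qed.

Lemma radial_rate_periodic a01 a0 a1 a2 a3 b0 b1 b2 b3 lambda y1 y2 f :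
  radial_rate a01 a0 a1 a2 a3 b0 b1 b2 b3 lambda y1 y2 (f + 2 * PI) =
  radial_rate a01 a0 a1 a2 a3 b0 b1 b2 b3 lambda y1 y2 f.
Proof. unfold radial_rate. now rewrite cos_plus, sin_plus, cos_2PI, sin_2PI, !Rmult_1_r, !Rmult_0_r, Rminus_0_r, Rplus_0_r. Qed.

Lemma diff_rate_periodic a01 a0 a1 a2 a3 b0 b1 b2 b3 lambda y1 y2 f :
  diff_rate a01 a0 a1 a2 a3 b0 b1 b2 b3 lambda y1 y2 (f + 2 * PI) =
  diff_rate a01 a0 a1 a2 a3 b0 b1 b2 b3 lambda y1 y2 f.
Proof.
  unfold diff_rate. rewrite phase_rate_periodic.
  rewrite <- (phase_rate_periodic _ _ _ _ _ _ _ _ _ _ _ _ (- (f + 2 * PI))).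
  now replace (- (f + 2 * PI) + 2 * PI) with (- f) by ring.
Qed.

Theorem lemma1 (omega : R) (a01 ae0 ae1 ae2 ae3 be0 be1 be2 be3 : C)
    (homega : omega <> 0) (ha01 : Re a01 < 0)
    (lambda : R) (hlambda : 0 < lambda) :
  let F := coupled omega a01 ae0 ae1 ae2 ae3 be0 be1 be2 be3 lambda in
  let r := sqrt (- lambda / Re a01) in
  invariant (F 0) (torus r) /\
  exists eps0 : R, 0 < eps0 /\
  exists h : R -> C2 -> C2,
    (forall eps : R, 0 <= eps <= eps0 ->
       C1_embedding_of_torus r (h eps) /\
       invariant (F eps) (image (torus r) (h eps)) /\
       stable (F eps) (image (torus r) (h eps))) /\
    (forall eta : R, 0 < eta ->
       exists delta : R, 0 < delta /\
         forall eps : R, 0 <= eps <= eps0 -> eps < delta ->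
           C1_dist_le r (h eps) (fun p => p) eta).
Proof.
  intros F r. change r with (radius a01 lambda).
  set (q := diff_rate a01 ae0 ae1 ae2 ae3 be0 be1 be2 be3 lambda).
  set (g := radial_rate a01 ae0 ae1 ae2 ae3 be0 be1 be2 be3 lambda).
  destruct (rates_lipschitz a01 ae0 ae1 ae2 ae3 be0 be1 be2 be3 lambda) as (C1 & HC1 & _ & Hg & Hq).
  destruct (rates_C11 a01 ae0 ae1 ae2 ae3 be0 be1 be2 be3 lambda) as (C2 & HC2 & HC11).
  fold q in Hq. fold g in Hg. fold q g in HC11.
  set (C := C1 + C2 + 1). assert (HC : 0 < C) by (unfold C; lra).
  assert (mono : forall f, lipschitz3 C1 f -> lipschitz3 C f).
  { intros f H a b x a' b' x' D Ha Hb Hx. destruct (H a b x a' b' x' D Ha Hb Hx) as [P1 P2].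
    assert (0 <= D) by (generalize (Rabs_pos (a - a')); lra). unfold C. split; [lra|nra]. }
  apply mono in Hg. apply mono in Hq.
  assert (lip : forall f, lipschitz3 C f -> forall a b a' b' x D,
    Rabs (a - a') <= D -> Rabs (b - b') <= D ->
    Rabs (f a b x) <= C /\ Rabs (f a b x - f a' b' x) <= C * D).
  { intros f H a b a' b' x D Ha Hb. apply H; [exact Ha|exact Hb|].
    rewrite Rminus_eq_0, Rabs_R0. generalize (Rabs_pos (a - a')); lra. }
  split.
  (* The unperturbed torus is the curve s = 0 at eps = 0. *)
  - apply (curve_invariant omega a01 ae0 ae1 ae2 ae3 be0 be1 be2 be3 lambda ha01 hlambda
      0 C 0 (fun _ => 0) (fun _ => 0)); try lra; try assumption.
    + apply zero_C11; lra.
    + intros x; ring.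
    + intros p. rewrite torus_iff_chart by assumption.
      split; intros [x ->]; exists x; [|symmetry]; apply param_0.
  (* With mu = 2 lambda the radius of the ball is eps C / lambda, so this threshold makes it at most
     1/8 and also meets the smallness conditions of the curve and of its stability. *)
  - set (eps0 := lambda / (8 * C)).
    assert (He0 : 0 < eps0) by (apply Rdiv_lt_0_compat; lra).
    assert (Heps : forall eps, 0 <= eps <= eps0 -> 8 * (eps * C) <= lambda).
    { intros eps He. replace lambda with (8 * (eps0 * C)) by (unfold eps0; field; lra). nra. }
    (* The range condition sits inside the existential so that choice yields a curve for every real
       eps; outside the range the zero curve is a placeholder. *)
    assert (Curve : forall eps, exists sd : (R -> R) * (R -> R), 0 <= eps <= eps0 ->
      C11 (2 * (eps * C) / (2 * lambda)) (fst sd) (snd sd) /\ periodic (fst sd) /\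
      forall x, eps * q (fst sd x) (fst sd (- x)) x * snd sd x =
        - (2 * lambda) * fst sd x + eps * g (fst sd x) (fst sd (- x)) x).
    { intros eps. destruct (Rle_dec 0 eps) as [H0|H0]; [destruct (Rle_dec eps eps0) as [H1|H1]|].
      - destruct (invariant_curve (2 * lambda) C q g) with (eps := eps) as (s & ds & H); try lra.
        + now apply lip.
        + now apply lip.
        + intros; apply diff_rate_periodic.
        + intros; apply radial_rate_periodic.
        + intros s ds H. destruct (proj1 (HC11 s ds H)) as [dq Hdq]. exists dq. apply (C11_mono C2); [unfold C; lra|exact Hdq].
        + intros s ds H. destruct (proj2 (HC11 s ds H)) as [dg Hdg]. exists dg. apply (C11_mono C2); [unfold C; lra|exact Hdg].
        + generalize (Heps eps (conj H0 H1)); lra.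
        + exists (s, ds). intros _. exact H.
      - exists (fun _ => 0, fun _ => 0). tauto.
      - exists (fun _ => 0, fun _ => 0). tauto. }
    destruct (choice _ Curve) as [sd Hsd].
    assert (HA : forall eps, 0 <= eps <= eps0 -> 2 * (eps * C) / (2 * lambda) <= 1/8).
    { intros eps He. apply (Rmult_le_reg_r (8 * lambda)); [lra|].
      replace (2 * (eps * C) / (2 * lambda) * (8 * lambda)) with (8 * (eps * C)) by (field; lra).
      generalize (Heps eps He). lra. }
    exists eps0. split; [exact He0|].
    exists (fun eps => torus_map a01 (fst (sd eps))). split.
    + intros eps He. destruct (Hsd eps He) as (H1 & H2 & H3). assert (HAe := HA eps He).
      assert (HT : forall p, image (torus (radius a01 lambda)) (torus_map a01 (fst (sd eps))) p <->
        exists x : R2, p = param a01 lambda (fst (sd eps)) x).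
      { intros p. split.
        - intros (p' & Tp & <-). apply torus_iff_chart in Tp; try assumption. destruct Tp as [x ->].
          exists x. now apply torus_map_chart.
        - intros [x ->]. exists (torus_chart (radius a01 lambda) x). split.
          + apply torus_iff_chart; try assumption. now exists x.
          + now apply torus_map_chart. }
      assert (Hsmall : 4 * (eps * C) <= lambda).
      { generalize (Heps eps He). assert (0 <= eps * C) by nra. lra. }
      split; [|split].
      * apply (torus_map_embedding a01 lambda ha01 hlambda _ (snd (sd eps))); [|exact H2].
        apply (C11_mono (2 * (eps * C) / (2 * lambda))); [lra|exact H1].
      * apply (curve_invariant omega a01 ae0 ae1 ae2 ae3 be0 be1 be2 be3 lambda ha01 hlambda
          (2 * (eps * C) / (2 * lambda)) C eps (fst (sd eps)) (snd (sd eps))); try lra; assumption.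
      * apply (curve_stable omega a01 ae0 ae1 ae2 ae3 be0 be1 be2 be3 lambda ha01 hlambda
          (2 * (eps * C) / (2 * lambda)) C eps (fst (sd eps)) (snd (sd eps))); try lra; assumption.
    + intros eta Heta.
      destruct (torus_map_C1_close a01 lambda ha01 hlambda) as (K & HK & Close).
      assert (HKC : 0 < (K + 1) * C) by (apply Rmult_lt_0_compat; lra).
      (* The distance is at most K eps C / lambda; K + 1 in place of K keeps the quotient defined
         when K = 0. *)
      exists (eta * lambda / ((K + 1) * C)). split; [apply Rdiv_lt_0_compat; [apply Rmult_lt_0_compat; lra|exact HKC]|].
      intros eps He Hlt. destruct (Hsd eps He) as (H1 & H2 & _).
      destruct (Close _ _ _ (HA eps He) H1 H2) as (D0 & Dg & Dh & P1 & P2 & P3).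
      assert (Hle : K * (2 * (eps * C) / (2 * lambda)) <= eta).
      { apply (Rmult_le_reg_r lambda); [lra|].
        replace (K * (2 * (eps * C) / (2 * lambda)) * lambda) with (K * (eps * C)) by (field; lra).
        apply Rle_trans with (eps * ((K + 1) * C)); [nra|].
        replace (eta * lambda) with (eta * lambda / ((K + 1) * C) * ((K + 1) * C)) by (field; split; lra).
        apply Rmult_le_compat_r; lra. }
      split.
      * intros p Tp. apply Rle_trans with (1 := D0 p Tp). exact Hle.
      * exists Dg, Dh. split; [exact P1|split; [exact P2|]]. intros x v.
        apply Rle_trans with (1 := P3 x v). apply Rmult_le_compat_r; [apply norm_ge_0|exact Hle].
Qed.
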